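(* Consider two independent types of stations: for $l=1,2$, initial positions form a homogeneous Poisson point process on $\mathbb R^2$ of intensity $\lambda_l$, each station moves at speed $v_l$ in an independent uniform direction, with $v_1>v_2$; let $\lambda=\lambda_1+\lambda_2$. Then: (i) the pure handover frequencies are $\Lambda_l=\frac{4v_l\sqrt\lambda}{\pi}\big(\frac{\lambda_l}{\lambda}\big)^2$, $l=1,2$; (ii) the mixed handover frequencies satisfy $\Lambda^{(1)}_{1,2}=\Lambda^{(2)}_{2,1}$ and $\Lambda^{(2)}_{1,2}=\Lambda^{(1)}_{2,1}$; (iii) for $k=1,2$, $$\Lambda^{(k)}_{2,1}=4\lambda_1\lambda_2v_1v_2\int_0^\infty\Big[\int_0^{h_1}\int_{t^*}^\infty e^{-\lambda\pi\hat h_k^2(t,h_1,h_2)}dt\,dh_2+\int_{h_1}^\infty\int_0^\infty e^{-\lambda\pi\hat h_k^2(t,h_1,h_2)}dt\,dh_2\Big]dh_1,$$ where $\hat h_k^2=v_1^2\big(\frac{v_2^2t+(-1)^k\sqrt\Delta}{v_1^2-v_2^2}\big)^2+h_1^2$, $\Delta=v_1^2v_2^2t^2-(h_1^2-h_2^2)(v_1^2-v_2^2)$, and $t^*=\frac1{v_1v_2}(h_1^2-h_2^2)^{1/2}(v_1^2-v_2^2)^{1/2}$.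
   Context: A user at the origin is served by the nearest station; a handover is a time at which two stations are simultaneously nearest. For a type-$l$ station, its head $(T,H)$ is the time and value of its minimal distance to the origin and its radial bird is $\{(t,(v_l^2(t-T)^2+H^2)^{1/2})\}$; handovers are intersections of two radial birds lying on the graph of the nearest-station distance. Two birds of the same type intersect at most once; two birds of different types intersect twice, once, or never. A pure handover of type $l$ is one produced by two type-$l$ birds; $\Lambda_l$ is the intensity of these handover epochs. A mixed handover of type $\binom{k}{l,r}$ ($l\neq r$, $k\in\{1,2\}$) is one produced by the $k$-th (in time order) intersection of a type-$l$ bird and a type-$r$ bird whose type-$l$ head lies to the left (smaller time coordinate) of the type-$r$ head; $\Lambda^{(k)}_{l,r}$ is the intensity of these handover epochs. *)

(* Defs.v *)
From HB Require Import structures.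
From mathcomp Require Import all_boot all_order all_algebra.
From mathcomp Require Import all_classical all_reals all_analysis.
Set Implicit Arguments. Unset Strict Implicit. Unset Printing Implicit Defensive.
Import Order.TTheory GRing.Theory Num.Theory.
Import numFieldNormedType.Exports.
Local Open Scope classical_set_scope.
Local Open Scope ring_scope.

Inductive ty := ty1 | ty2.

(** A marked station: ((x, y), theta) = initial position (x,y) in R^2 and
    direction angle theta (direction (cos theta, sin theta)). *)
Definition pt (R : realType) := ((R * R) * R)%type.

Definition station (R : realType) := (ty * pt R)%type.

Section defs.
Variables (R : realType) (d : measure_display) (Omega : measurableType d).
Variable (P : probability Omega R).
Variable (N : ty -> Omega -> set (pt R)).
Variables (v1 v2 : R).

Definition speed (l : ty) : R := match l with ty1 => v1 | ty2 => v2 end.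

Definition pdist (v : R) (p : pt R) (t : R) : R :=
  Num.sqrt ((p.1.1 + v * t * cos p.2) ^+ 2 + (p.1.2 + v * t * sin p.2) ^+ 2).

Definition sdist (s : station R) (t : R) : R := pdist (speed s.1) s.2 t.

Definition stations (w : Omega) : set (station R) := [set s | N s.1 w s.2].

Definition nearest (w : Omega) (s : station R) (t : R) : Prop :=
  stations w s /\ forall s', stations w s' -> sdist s t <= sdist s' t.

Definition is_head_time (s : station R) (T : R) : Prop :=
  forall t, sdist s T <= sdist s t.

Definition birds_meet (s s' : station R) (t : R) : Prop := sdist s t = sdist s' t.

Definition kth_meet (k : nat) (s s' : station R) (t : R) : Prop :=
  birds_meet s s' t /\
  (\esum_(u in [set u : R | (u < t)%R /\ birds_meet s s' u]) (1 : \bar R))%E = (k.-1)%:R%:E.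

Definition pure_handover (l : ty) (w : Omega) : set R :=
  [set t | exists s s' : station R, s <> s' /\ s.1 = l /\ s'.1 = l /\
           nearest w s t /\ nearest w s' t].

Definition mixed_handover (k : nat) (l r : ty) (w : Omega) : set R :=
  [set t | l <> r /\ exists s s' : station R, s.1 = l /\ s'.1 = r /\
           nearest w s t /\ nearest w s' t /\
           (exists T T', is_head_time s T /\ is_head_time s' T' /\ T < T') /\
           kth_meet k s s' t].

(** Intensity of a (stationary) random set of epochs E on the time line:
    expected number of epochs in [0,1]. *)
Definition intensity (E : Omega -> set R) : \bar R :=
  (\int[P]_w (\esum_(t in E w `&` `[0%R, 1%R]) (1 : \bar R)))%E.

Definition Lambda_pure (l : ty) : \bar R := intensity (pure_handover l).
Definition Lambda_mixed (k : nat) (l r : ty) : \bar R :=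
  intensity (mixed_handover k l r).

End defs.

Section ppp.
Variables (R : realType) (d : measure_display) (Omega : measurableType d).
Variable (P : probability Omega R).
Variable (N : ty -> Omega -> set (pt R)).
Variables (lam1 lam2 : R).

Definition rate (l : ty) : R := match l with ty1 => lam1 | ty2 => lam2 end.

Definition leb3 : set (pt R) -> \bar R :=
  ((@lebesgue_measure R \x @lebesgue_measure R) \x @lebesgue_measure R)%E.

(** Mean measure of the type-l marked process: intensity lam_l on R^2,
    independent uniform direction angle on [0, 2 pi). *)
Definition mean_measure (l : ty) (B : set (pt R)) : \bar R :=
  ((rate l / (2 * pi))%:E * leb3 (B `&` [set p : pt R | (0 <= p.2 < 2 * pi)%R]))%E.

Definition count (l : ty) (w : Omega) (B : set (pt R)) : \bar R :=
  (\esum_(p in N l w `&` B) (1 : \bar R))%E.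

Definition poisson_mass (m : R) (k : nat) : R := expR (- m) * m ^+ k / k`!%:R.

Definition count_event (l : ty) (B : set (pt R)) (k : nat) : set Omega :=
  [set w | count l w B = k%:R%:E].

(** N ty1 and N ty2 are independent Poisson point processes on R^2 x [0,2pi)
    with mean measures mean_measure ty1 / ty2, i.e. independent homogeneous
    PPPs of intensities lam1, lam2 with i.i.d. uniform directions. *)
Definition two_type_PPP : Prop :=
  (forall l B k, measurable B -> (mean_measure l B < +oo)%E ->
     measurable (count_event l B k) /\
     P (count_event l B k) = (poisson_mass (fine (mean_measure l B)) k)%:E) /\
  (forall n (l : 'I_n -> ty) (B : 'I_n -> set (pt R)) (K : 'I_n -> nat),
     (forall i, measurable (B i) /\ (mean_measure (l i) (B i) < +oo)%E) ->
     (forall i j, i <> j -> l i = l j -> B i `&` B j = set0) ->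
     P (\bigcap_(i in [set: 'I_n]) count_event (l i) (B i) (K i)) =
     (\prod_(i < n) P (count_event (l i) (B i) (K i)))%E).

End ppp.

Definition hhat2 (R : realType) (v1 v2 : R) (k : nat) (t h1 h2 : R) : R :=
  let Delta := v1 ^+ 2 * v2 ^+ 2 * t ^+ 2 - (h1 ^+ 2 - h2 ^+ 2) * (v1 ^+ 2 - v2 ^+ 2) in
  v1 ^+ 2 * ((v2 ^+ 2 * t + (-1) ^+ k * Num.sqrt Delta) / (v1 ^+ 2 - v2 ^+ 2)) ^+ 2
  + h1 ^+ 2.

Definition tstar (R : realType) (v1 v2 : R) (h1 h2 : R) : R :=
  (v1 * v2)^-1 * Num.sqrt (h1 ^+ 2 - h2 ^+ 2) * Num.sqrt (v1 ^+ 2 - v2 ^+ 2).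

Definition mixed_formula (R : realType) (lam1 lam2 v1 v2 : R) (k : nat) : \bar R :=
  let lam := lam1 + lam2 in
  let f t h1 h2 := (expR (- (lam * pi * hhat2 v1 v2 k t h1 h2)))%:E in
  ((4 * lam1 * lam2 * v1 * v2)%:E *
   \int[@lebesgue_measure R]_(h1 in `[0%R, +oo[%classic)
     (\int[@lebesgue_measure R]_(h2 in `[0%R, h1]%classic)
        \int[@lebesgue_measure R]_(t in `[tstar v1 v2 h1 h2, +oo[%classic) f t h1 h2
      + \int[@lebesgue_measure R]_(h2 in `[h1, +oo[%classic)
        \int[@lebesgue_measure R]_(t in `[0%R, +oo[%classic) f t h1 h2))%E.

(* Main.v *)
(** The station whose bird has head [(T, H)] is at squared distance
    [v^2 (t - T)^2 + H^2] from the origin at time [t], and the heads of the type-l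
    stations form a Poisson process of intensity [2 lam_l v_l] on the half-plane
    [H >= 0].  The heads of birds below height [r] at a fixed time fill half an
    ellipse of area [pi r^2 / (2 v_l)], so a meeting of two birds at height [r] is a
    handover with probability [exp (- lam pi r^2)].  The mean number of handovers is
    then the integral of this probability over pairs of heads.  Almost surely no
    three birds meet in a point, hence handover epochs and pairs correspond one to
    one.  Integrating out the position of the pair in time leaves an integral over
    the time lag [t] and the two heights.  For two types this is the claimed formula,
    and [t -> - t] exchanges the two meetings.  For a single type the squared meeting
    height is [(v t / 2 - b / t)^2 + max(h, h')^2], and [t -> a t - b / t] scales
    Lebesgue measure by [1 / a] (Boole), so the integral is Gaussian. *)

(* The hypothesis speaks only of counts in fixed measurable sets, whereas the region that must be
   empty moves with the two birds that meet. The mean over pairs is therefore derived from the count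
   laws alone. For a fixed empty region it follows from independence on rectangles and a Dynkin
   argument. A moving region is approached by regions that take countably many values and avoid both
   heads, so that independence still applies. Counts of one type are independent only over disjoint
   sets, so pairs of equal type are sorted into cells with separated head times; coinciding head
   times are excluded by a separate estimate. The same approximation, with thin annuli in place of
   discs, excludes three birds through one point. [N] is an arbitrary set-valued map: counts are
   finite, and numbers of pairs measurable, only on almost sure events, and the number of handovers
   is integrated as a lower integral. *)
Require Import Defs.
From HB Require Import structures.
From mathcomp Require Import all_boot all_order all_algebra finmap.
From mathcomp Require Import all_classical all_reals all_analysis.
From mathcomp Require Import measurable_realfun ring lra.
Import Order.TTheory GRing.Theory Num.Theory.
Import numFieldNormedType.Exports.
Set Implicit Arguments. Unset Strict Implicit. Unset Printing Implicit Defensive.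
Local Open Scope classical_set_scope.
Local Open Scope ring_scope.

(** * Cardinalities and lower integrals *)

Section cardinal.
Context {R : realType}.
Local Open Scope ereal_scope.

Definition card (T : choiceType) (S : set T) : \bar R := \esum_(x in S) 1.

Lemma card_ge0 (T : choiceType) (S : set T) : 0 <= card S.
Proof. exact: esum_ge0. Qed.

Lemma card0 (T : choiceType) : card (set0 : set T) = 0.
Proof. exact: esum_set0. Qed.

Lemma sume_const1 (I : Type) (s : seq I) :
  \sum_(i <- s) (1 : \bar R) = (size s)%:R%:E.
Proof.
elim: s => [|x s ih]; first by rewrite big_nil.
by rewrite big_cons ih -EFinD -natr1 addrC.
Qed.

Lemma card_counting (T : choiceType) (S : set T) : card S = counting S.
Proof.
rewrite /card /counting; case: ifPn => /asboolP finS.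
  by rewrite esum_fset// fsbig_finite//= sume_const1.
apply/eqyP => r r0; have [n rn] : exists n : nat, (r <= n%:R)%R.
  by exists (Num.truncn r).+1; rewrite ltW// truncnS_gt.
have [X XS Xn] := infinite_set_fset n finS.
apply: esum_ge; exists [set` X]; first by split.
rewrite fsbig_finite//= sume_const1 set_fsetK lee_fin (le_trans rn)//.
by rewrite ler_nat.
Qed.

Lemma card_fin (T : choiceType) (S : set T) :
  card S < +oo -> finite_set S.
Proof. by rewrite card_counting /counting; case: ifPn => // /asboolP. Qed.

Lemma finite_card (T : choiceType) (S : set T) :
  finite_set S -> exists n : nat, card S = n%:R%:E.
Proof.
by move=> fS; rewrite card_counting /counting asboolT//; eexists.
Qed.

Lemma card_nat (T : choiceType) (S : set T) :
  card S < +oo -> exists n : nat, card S = n%:R%:E.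
Proof. by move=> /card_fin/finite_card. Qed.

Lemma card_bigcup (T : choiceType) (F : nat -> set T) : trivIset setT F ->
  card (\bigcup_k F k) = \sum_(k <oo) card (F k).
Proof. by move=> tF; rewrite /card esum_bigcupT// nneseries_esumT//= => n; exact: card_ge0. Qed.

Lemma cardU (T : choiceType) (A B : set T) : A `&` B = set0 ->
  card (A `|` B) = card A + card B.
Proof.
move=> AB; rewrite /card (esumID A)// setIUl setIid.
rewrite (setIC B) AB setU0 setIUl setICr set0U; congr (_ + _).
by rewrite (_ : B `&` ~` A = B)//; apply/setIidPl/disjoints_subset; rewrite setIC.
Qed.

Lemma le_card (T : choiceType) (A B : set T) : A `<=` B -> card A <= card B.
Proof.
move=> AB; rewrite -(setDUK AB) cardU ?leeDl ?card_ge0//.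
by rewrite setDE setIC -setIA setICl setI0.
Qed.

Lemma card_eq0 (T : choiceType) (S : set T) : (card S = 0) <-> (S = set0).
Proof.
split=> [|->]; last exact: card0.
move=> S0; rewrite -subset0 => x Sx.
have : card [set x] <= card S by apply: le_card => _ ->.
by rewrite S0 /card esum_set1// lee_fin ler10.
Qed.

(** Infinite sets are allowed because [0 * +oo = 0] in the extended reals; the proof separates an
    empty factor from an infinite one. *)
Lemma cardX (T1 T2 : choiceType) (A : set T1) (B : set T2) :
  card (A `*` B) = card A * card B.
Proof.
rewrite {1}/card -(@esum_esum _ _ _ A (fun=> B) (fun _ _ => 1))//.
under eq_esum do rewrite -/(card B).
have [->|/set0P[b Bb]] := eqVneq B set0.
  by rewrite card0 mule0; apply: esum1.
have [|] := pselect (finite_set A); last first.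
  move=> iA; rewrite [in RHS]card_counting /counting asboolF//.
  rewrite gt0_mulye; last first.
    rewrite lt_neqAle card_ge0 andbT eq_sym; apply/eqP => /card_eq0 B0.
    by move: Bb; rewrite B0.
  apply/eqP; rewrite -leye_eq.
  have -> : +oo = card A by rewrite card_counting /counting asboolF.
  apply: le_esum => a Aa; rewrite -(@esum_set1 R _ b (fun=> 1))//.
  by apply: le_card => _ ->.
move=> fA; rewrite !esum_fset//; last by move=> ? _; exact: card_ge0.
have -> : card A = (\sum_(i \in A) (1%:E : \bar R))%R by rewrite /card esum_fset.
rewrite ge0_mule_fsuml//.
by apply: eq_fsbigr => i _; rewrite mul1e.
Qed.

Lemma card_bij (T1 T2 : choiceType) (A : set T1) (B : set T2) (e : T1 -> T2) :
  set_bij A B e -> card A = card B.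
Proof. by move=> eAB; rewrite /card (reindex_esum A B e). Qed.

End cardinal.

Section nonmeasurable_integral.
Local Open Scope ereal_scope.
Context d (T : measurableType d) (R : realType).
Variable mu : {measure set T -> \bar R}.
Import HBNNSimple.

(* The integral of a function that need not be measurable is a lower integral. *)
Lemma ge0_integral_conegligible (f : T -> \bar R) (G : set T) :
  measurable G -> mu (~` G) = 0 -> (forall x, 0 <= f x) ->
  measurable_fun G f -> \int[mu]_x f x = \int[mu]_(x in G) f x.
Proof.
move=> mG G0 f0 mf; apply/eqP; rewrite eq_le; apply/andP; split.
- rewrite ge0_integralTE//; apply: ge_ereal_sup => _ [k kf <-].
  rewrite -integralT_nnsfun.
  rewrite (ge0_negligible_integral (measurableC mG) measurableT _ _ G0)//=; last 2 first.
  - by apply/measurable_EFinP.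
  - by move=> x _; rewrite lee_fin.
  rewrite setTD setCK; apply: ge0_le_integral => //.
    by move=> x _; rewrite lee_fin.
  by apply/measurable_EFinP; exact: measurable_funTS.
- rewrite integral_mkcond !ge0_integralTE//; last first.
    by move=> x; rewrite patchE; case: ifPn.
  apply: le_ereal_sup => _ [k kf <-]; exists k => // x.
  by apply: (le_trans (kf x)); rewrite patchE; case: ifPn.
Qed.

End nonmeasurable_integral.

(** * Poisson weights and random variables with natural values *)

Section poisson_series.
Local Open Scope ereal_scope.
Context {R : realType}.

Lemma poisson_mass_ge0 (m : R) k : (0 <= m)%R -> (0 <= poisson_mass m k)%R.
Proof.
by move=> m0; rewrite /poisson_mass !mulr_ge0 ?expR_ge0 ?exprn_ge0.
Qed.

Lemma poisson_mass_sum (m : R) : (0 <= m)%R ->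
  \sum_(k <oo) (poisson_mass m k)%:E = 1.
Proof.
move=> m0; have := @poisson_mass_ge0 m ^~ m0 => pm0.
rewrite -[RHS]/(1%R%:E) -(mulVf (lt0r_neq0 (expR_gt0 m))) -expRN EFinM.
under eq_eseriesr do rewrite /poisson_mass -mulrA EFinM.
rewrite nneseriesZl; last first.
  by move=> k _; rewrite lee_fin divr_ge0// exprn_ge0.
congr (_ * _); rewrite expRE -EFin_lim; last first.
  rewrite /pseries/=; under eq_fun do rewrite mulrC.
  exact: is_cvg_series_exp_coeff.
apply/congr_lim/funext => n/=; rewrite /pseries/= /series/= -sumEFin//.
by under eq_bigr do rewrite mulrC.
Qed.

Lemma poisson_mass_mean (m : R) : (0 <= m)%R ->
  \sum_(k <oo) (k%:R * poisson_mass m k)%:E = m%:E.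
Proof.
(* The term of index 0 vanishes and [(k + 1) * poisson_mass m (k + 1) = m * poisson_mass m k], so
   the shifted partial sums are [m] times those of the weights themselves. *)
move=> m0; apply/cvg_lim => //; rewrite -cvg_shiftS/=.
rewrite (_ : (fun _ => _) =
    fun n => m%:E * \sum_(0 <= k < n) (poisson_mass m k)%:E); last first.
  apply/funext => n; rewrite big_nat_recl//= mul0r add0e !sumEFin -EFinM mulr_sumr.
  congr EFin; apply: eq_bigr => k _.
  rewrite /poisson_mass exprS factS natrM invfM.
  have k0 : k.+1%:R != 0%R :> R by rewrite pnatr_eq0.
  have f0 : k`!%:R != 0%R :> R by rewrite pnatr_eq0 -lt0n fact_gt0.
  by move: (k.+1%:R : R)%R (k`!%:R : R)%R k0 f0 => x y x0 y0; field; apply/andP.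
have h : m%:E * \sum_(0 <= k < n) (poisson_mass m k)%:E @[n --> \oo] --> m%:E * 1.
  apply: cvgeZl => //; rewrite -(poisson_mass_sum m0).
  apply: is_cvg_nneseries => k _ _; by rewrite lee_fin poisson_mass_ge0.
by rewrite mule1 in h.
Qed.

(** From [expR (- m) >= 1 - m] and [(1 - m) * (1 + m) = 1 - m ^+ 2]. The quadratic order is what
    makes two heads in a common thin slab negligible. *)
Lemma poisson_mass_ge2 (m : R) : (0 <= m)%R ->
  (1 - poisson_mass m 0 - poisson_mass m 1 <= m ^+ 2)%R.
Proof.
move=> m0; rewrite /poisson_mass expr0 expr1 fact0 (_ : 1`! = 1%N)// !divr1 mulr1.
have := expR_ge1Dx (- m); have := expR_gt0 (- m); nra.
Qed.

End poisson_series.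

Section conegligible.
Local Open Scope ereal_scope.
Context d (T : measurableType d) (R : realType) (P : probability T R).

Lemma conegligibleI (A B : set T) : measurable A -> measurable B ->
  P (~` A) = 0 -> P (~` B) = 0 -> P (~` (A `&` B)) = 0.
Proof.
move=> mA mB A0 B0; apply/negligibleP; first exact/measurableC/measurableI.
by rewrite setCI; apply: negligibleU; apply/negligibleP => //; exact: measurableC.
Qed.

Lemma conegligible1 (A : set T) : measurable A -> P A = 1 -> P (~` A) = 0.
Proof. by move=> mA A1; rewrite probability_setC// A1 subee. Qed.

Lemma conegligible_bigcap (F : nat -> set T) :
  (forall n, measurable (F n)) -> (forall n, P (~` F n) = 0) ->
  measurable (\bigcap_n F n) /\ P (~` \bigcap_n F n) = 0.
Proof.
move=> mF F0; split; first exact: bigcap_measurable.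
apply/negligibleP; first exact/measurableC/bigcap_measurable.
rewrite setC_bigcap; apply: negligible_bigcup => n.
by apply/negligibleP; [exact: measurableC|exact: F0].
Qed.

End conegligible.

Section nat_valued.
Local Open Scope ereal_scope.
Context {R : realType} d (T : measurableType d).

(** The Poisson law prescribes the events of finite counts only; an infinite count is the event left
    over, and its measurability is deduced from the others. *)
Definition nat_or_infty (f : T -> \bar R) :=
  forall w, f w < +oo -> exists k : nat, f w = k%:R%:E.

Lemma nat_or_infty_fin (f : T -> \bar R) : nat_or_infty f ->
  [set w | f w < +oo] = \bigcup_k [set w | f w = k%:R%:E].
Proof.
move=> fn; apply/seteqP; split=> w /=; first by move=> /fn[k fk]; exists k.
by move=> [k _ /= ->]; rewrite ltry.
Qed.

Lemma measurable_nat_or_infty (f : T -> \bar R) : nat_or_infty f ->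
  (forall k : nat, measurable [set w | f w = k%:R%:E]) -> (forall w, 0 <= f w) ->
  measurable_fun setT f.
Proof.
move=> fn mf f0 _ Y mY; rewrite setTI.
have mfin : measurable [set w | f w < +oo].
  by rewrite nat_or_infty_fin//; exact: bigcup_measurable.
rewrite (_ : f @^-1` Y =
    \bigcup_(k in [set k : nat | Y k%:R%:E]) [set w | f w = k%:R%:E] `|`
    (if `[< Y +oo >] then ~` [set w | f w < +oo] else set0)).
  apply: measurableU; first exact: bigcup_measurable.
  by case: ifPn => // _; exact: measurableC.
apply/seteqP; split=> w /=.
  move=> Yf; have [/fn[k fk]|] := boolP (f w < +oo).
    by left; exists k => //=; rewrite -fk.
  move=> fo; right; have fy : f w = +oo by apply/eqP; rewrite -leye_eq leNgt.
  by case: ifPn => [_ /=|/asboolP]; [rewrite fy|rewrite -fy].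
case=> [[k /= Yk ->//]|].
case: ifPn => [/asboolP Yy /= /negP|//].
by rewrite -leNgt leye_eq => /eqP ->.
Qed.

(** Almost surely both factors are finite, so the integral is a double series over their values and
    the joint law factors each term. In the application [E] is the event that a region is empty and
    [f], [g] count the two heads of a pair. *)
Lemma ge0_integral_indep (P : probability T R) (E : set T) (f g : T -> \bar R)
    (p q : nat -> R) (a b : R) :
  measurable E -> nat_or_infty f -> nat_or_infty g ->
  (forall w, 0 <= f w) -> (forall w, 0 <= g w) ->
  (forall k : nat, measurable [set w | f w = k%:R%:E]) ->
  (forall k : nat, measurable [set w | g w = k%:R%:E]) ->
  P [set w | f w < +oo] = 1 -> P [set w | g w < +oo] = 1 ->
  (forall i, (0 <= p i)%R) -> (forall i, (0 <= q i)%R) ->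
  (forall i j : nat, P (E `&` [set w | f w = i%:R%:E] `&` [set w | g w = j%:R%:E]) =
    P E * ((p i)%:E * (q j)%:E)) ->
  \sum_(k <oo) (k%:R * p k)%:E = a%:E -> \sum_(k <oo) (k%:R * q k)%:E = b%:E ->
  \int[P]_(w in E) (f w * g w) = P E * (a * b)%:E.
Proof.
move=> mE fn gn f0 g0 mf mg f1 g1 p0 q0 fg sp sq.
have mf' := measurable_nat_or_infty fn mf f0.
have mg' := measurable_nat_or_infty gn mg g0.
have mfg : measurable_fun setT (fun w => f w * g w) by exact: emeasurable_funM.
pose G := [set w | f w < +oo] `&` [set w | g w < +oo].
have mfin : measurable [set w | f w < +oo].
  by rewrite nat_or_infty_fin//; exact: bigcup_measurable.
have mgin : measurable [set w | g w < +oo].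
  by rewrite nat_or_infty_fin//; exact: bigcup_measurable.
have mG : measurable G by exact: measurableI.
have G0 : P (~` G) = 0.
  by apply: conegligibleI => //; exact: conegligible1.
rewrite (ge0_negligible_integral (measurableC mG) mE _ _ G0); last 2 first.
  - exact: measurable_funTS.
  - by move=> w _; rewrite mule_ge0.
pose F i j := E `&` [set w | f w = i%:R%:E] `&` [set w | g w = j%:R%:E].
have mF i j : measurable (F i j) by apply: measurableI => //; exact: measurableI.
have mF' i : measurable (\bigcup_j F i j) by exact: bigcup_measurable.
have -> : E `\` ~` G = \bigcup_i \bigcup_j F i j.
  rewrite setDE setCK /G !nat_or_infty_fin//.
  apply/seteqP; split=> w.
    by case=> Ew [[i _ fi] [j _ gj]]; exists i => //; exists j.
  by case=> i _ [j _ [[Ew fi] gj]]; split=> //; split; [exists i|exists j].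
have nat_inj (i j : nat) : i%:R%:E = j%:R%:E :> \bar R -> i = j.
  by move=> [] /eqP; rewrite eqr_nat => /eqP.
rewrite ge0_integral_bigcup//; last 3 first.
  - exact: measurable_funTS.
  - by move=> w _; rewrite mule_ge0.
  - move=> i j _ _ [w [[k _ [[_ fi] _]] [k' _ [[_ fj] _]]]].
    by apply: nat_inj; rewrite -fi -fj.
have [e e0 PE] : exists2 e, (0 <= e)%R & P E = e%:E.
  by exists (fine (P E)); rewrite ?fine_ge0// fineK// fin_num_measure.
have step i : \int[P]_(w in \bigcup_j F i j) (f w * g w) =
    (i%:R * p i)%:E * (e%:E * b%:E).
  rewrite ge0_integral_bigcup//; last 3 first.
    - exact: measurable_funTS.
    - by move=> w _; rewrite mule_ge0.
    - move=> j k _ _ [w [[_ gj] [_ gk]]].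
      by apply: nat_inj; rewrite -gj -gk.
  rewrite -sq -nneseriesZl; last first.
    by move=> j _; rewrite lee_fin mulr_ge0.
  rewrite -nneseriesZl; last first.
    by move=> j _; rewrite -EFinM lee_fin !mulr_ge0.
  apply: eq_eseriesr => j _.
  rewrite (eq_integral (cst (i%:R * j%:R)%:E)); last first.
    by move=> w /set_mem[[_ /= fi] /= gj]; rewrite fi gj.
  have PF : P (F i j) = P E * ((p i)%:E * (q j)%:E) by exact: fg.
  rewrite integral_cst// [X in _ * X]PF PE.
  by rewrite -!EFinM; congr EFin; ring.
under eq_eseriesr do rewrite step.
rewrite PE -!EFinM.
under eq_eseriesr do rewrite muleC.
rewrite nneseriesZl ?sp -?EFinM; first by congr EFin; ring.
by move=> i _; rewrite lee_fin mulr_ge0.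
Qed.

End nat_valued.

(** * Pairs of points of Poisson processes *)

Section point_process.
Local Open Scope ereal_scope.
Context {R : realType} {d} {Omega : measurableType d} (P : probability Omega R).
Context {dX} {X : measurableType dX} {S : choiceType}.
(* [S] is the type of marks and [hd l] maps a mark to the point that is counted. *)
Variables (N : ty -> Omega -> set S) (hd : ty -> S -> X).
Variable m : ty -> {sigma_finite_measure set X -> \bar R}.

Definition head_count (l : ty) (A : set X) (w : Omega) : \bar R :=
  card (N l w `&` hd l @^-1` A).

Definition count_eq l A (k : nat) : set Omega := [set w | head_count l A w = k%:R%:E].

Definition finite_mean l (A : set X) := measurable A /\ m l A < +oo.

Definition poisson_law := forall l A k, finite_mean l A ->
  measurable (count_eq l A k) /\ P (count_eq l A k) = (poisson_mass (fine (m l A)) k)%:E.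

Definition poisson_indep :=
  forall n (l : 'I_n -> ty) (B : 'I_n -> set X) (K : 'I_n -> nat),
    (forall i, finite_mean (l i) (B i)) ->
    (forall i j, i <> j -> l i = l j -> B i `&` B j = set0) ->
    P (\bigcap_(i in [set: 'I_n]) count_eq (l i) (B i) (K i)) =
    \prod_(i < n) P (count_eq (l i) (B i) (K i)).

Hypotheses (law : poisson_law) (indep : poisson_indep).

Lemma cnt_ge0 l A w : 0 <= head_count l A w. Proof. exact: card_ge0. Qed.

Lemma cnt_nat l A : nat_or_infty (head_count l A).
Proof. by move=> w /card_nat. Qed.

Lemma fmI l A B : finite_mean l A -> measurable B -> finite_mean l (A `&` B).
Proof.
move=> [mA Afin] mB; split; first exact: measurableI.
by apply: le_lt_trans Afin; apply: le_measure; rewrite ?inE//; exact: measurableI.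
Qed.

Lemma fm_sub l A B : measurable A -> A `<=` B -> finite_mean l B -> finite_mean l A.
Proof. by move=> mA /setIidr <- fB; exact: fmI. Qed.

Lemma measurable_ev l A k : finite_mean l A -> measurable (count_eq l A k).
Proof. by move=> fA; have [] := law k fA. Qed.

Lemma prob_ev l A k : finite_mean l A ->
  P (count_eq l A k) = (poisson_mass (fine (m l A)) k)%:E.
Proof. by move=> fA; have [] := law k fA. Qed.

Lemma measurable_cnt l A : finite_mean l A -> measurable_fun setT (head_count l A).
Proof.
move=> fA; apply: measurable_nat_or_infty; first exact: cnt_nat.
- by move=> k; exact: measurable_ev.
- by move=> w; exact: cnt_ge0.
Qed.

Definition finite_count l A : set Omega := [set w | head_count l A w < +oo].

Lemma measurable_fin l A : finite_mean l A -> measurable (finite_count l A).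
Proof.
move=> fA; rewrite /finite_count nat_or_infty_fin; last exact: cnt_nat.
by apply: bigcup_measurable => k _; exact: measurable_ev.
Qed.

Lemma prob_fin l A : finite_mean l A -> P (finite_count l A) = 1.
Proof.
move=> fA; rewrite /finite_count nat_or_infty_fin; last exact: cnt_nat.
rewrite measure_bigcup//=; last 2 first.
- by move=> k _; exact: measurable_ev.
- move=> i j _ _ [w [/= wi wj]].
  by have := wi; rewrite wj => -[/eqP]; rewrite eqr_nat => /eqP.
rewrite -(poisson_mass_sum (fine_ge0 (measure_ge0 (m l) A))).
rewrite eseries_mkcond; apply: eq_eseriesr => k _.
by rewrite mem_set//; exact: prob_ev.
Qed.

(** Four events are what a pair requires: an empty region for each of the two types, and one count
    for each of the two heads. *)
Lemma indep4 (l1 l2 l3 l4 : ty) (A1 A2 A3 A4 : set X) (k1 k2 k3 k4 : nat) :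
  finite_mean l1 A1 -> finite_mean l2 A2 -> finite_mean l3 A3 -> finite_mean l4 A4 ->
  (l1 = l2 -> A1 `&` A2 = set0) -> (l1 = l3 -> A1 `&` A3 = set0) ->
  (l1 = l4 -> A1 `&` A4 = set0) -> (l2 = l3 -> A2 `&` A3 = set0) ->
  (l2 = l4 -> A2 `&` A4 = set0) -> (l3 = l4 -> A3 `&` A4 = set0) ->
  P (count_eq l1 A1 k1 `&` count_eq l2 A2 k2 `&` count_eq l3 A3 k3 `&` count_eq l4 A4 k4) =
  P (count_eq l1 A1 k1) * P (count_eq l2 A2 k2) * P (count_eq l3 A3 k3) * P (count_eq l4 A4 k4).
Proof.
move=> f1 f2 f3 f4 d12 d13 d14 d23 d24 d34.
pose l i := nth l1 [:: l1; l2; l3; l4] i.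
pose A i := nth A1 [:: A1; A2; A3; A4] i.
pose K i := nth k1 [:: k1; k2; k3; k4] i.
have := @indep 4%N (fun i : 'I_4 => l i) (fun i : 'I_4 => A i) (fun i : 'I_4 => K i).
rewrite !big_ord_recr big_ord0/= mul1e => <-.
- congr (P _); apply/seteqP; split=> w /=.
    by move=> [[[w1 w2] w3] w4] [[|[|[|[|]]]]//= ?] _.
  move=> h; split; first split; first split.
  + exact: (h (@Ordinal 4%N 0%N isT)).
  + exact: (h (@Ordinal 4%N 1%N isT)).
  + exact: (h (@Ordinal 4%N 2%N isT)).
  + exact: (h (@Ordinal 4%N 3%N isT)).
- by move=> [[|[|[|[|]]]]//= ?].
- move=> [[|[|[|[|]]]]//= ?] [[|[|[|[|]]]]//= ?] ij /=; rewrite /l/A/=;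
    first [by case: ij; exact: val_inj | done |
      by move=> /esym e; rewrite setIC; auto].
Qed.

Definition pairs l r (C : set (X * X)) (w : Omega) : set (S * S) :=
  [set pq | N l w pq.1 /\ N r w pq.2 /\ C (hd l pq.1, hd r pq.2)].

Lemma pairs_rect l r A B w :
  pairs l r (A `*` B) w = (N l w `&` hd l @^-1` A) `*` (N r w `&` hd r @^-1` B).
Proof.
by apply/seteqP; split=> -[p q] /=; [move=> [? [? [? ?]]]|move=> [[? ?] [? ?]]].
Qed.

Lemma card_pairs_rect l r A B w :
  card (pairs l r (A `*` B) w) = head_count l A w * head_count r B w :> \bar R.
Proof. by rewrite pairs_rect cardX. Qed.

Lemma sub_pairs l r C D w : C `<=` D -> pairs l r C w `<=` pairs l r D w.
Proof. by move=> CD pq [? [? ?]]; split=> //; split=> //; exact: CD. Qed.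

Lemma finite_pairs l r A B C w : C `<=` A `*` B ->
  finite_count l A w -> finite_count r B w -> finite_set (pairs l r C w).
Proof.
move=> CAB /card_fin fA /card_fin fB; apply: sub_finite_set (sub_pairs CAB) _.
by rewrite pairs_rect; exact: finite_setX.
Qed.

Lemma trivIset_pairs l r (F : nat -> set (X * X)) w :
  trivIset setT F -> trivIset setT (fun n => pairs l r (F n) w).
Proof.
move=> tF i j _ _ [pq [[_ [_ Fi]] [_ [_ Fj]]]].
by apply: (tF i j) => //; exists (hd l pq.1, hd r pq.2).
Qed.

Lemma pairs_bigcup l r (F : nat -> set (X * X)) w :
  pairs l r (\bigcup_n F n) w = \bigcup_n pairs l r (F n) w.
Proof.
apply/seteqP; split=> pq.
  by move=> [p [q [n _ Fn]]]; exists n.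
by move=> [n _ [p [q Fn]]]; split=> //; split=> //; exists n.
Qed.

Section pair_formula.
Variables (l r : ty) (A B : set X) (E : set Omega).
Hypotheses (fA : finite_mean l A) (fB : finite_mean r B) (mE : measurable E).
Hypothesis indepE : forall A' B' i j, measurable A' -> A' `<=` A ->
  measurable B' -> B' `<=` B ->
  P (E `&` count_eq l A' i `&` count_eq r B' j) = P E * (P (count_eq l A' i) * P (count_eq r B' j)).

Let G := finite_count l A `&` finite_count r B.

Lemma conegligible_fin2 : measurable G /\ P (~` G) = 0.
Proof.
split; first by apply: measurableI; exact: measurable_fin.
by apply: conegligibleI; rewrite ?conegligible1//;
  do ?[exact: prob_fin|exact: measurable_fin].
Qed.

Let pair_formula_rect A' B' : measurable A' -> A' `<=` A ->
  measurable B' -> B' `<=` B ->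
  \int[P]_(w in E) (head_count l A' w * head_count r B' w) = P E * (m l \x m r) (A' `*` B').
Proof.
move=> mA' sA' mB' sB'.
have fA' : finite_mean l A' by exact: fm_sub fA.
have fB' : finite_mean r B' by exact: fm_sub fB.
have mA0 := fine_ge0 (measure_ge0 (m l) A').
have mB0 := fine_ge0 (measure_ge0 (m r) B').
have -> : (m l \x m r) (A' `*` B') = (fine (m l A') * fine (m r B'))%:E.
  rewrite product_measure1E// EFinM; congr (_ * _); apply/esym/fineK.
    by rewrite ge0_fin_numE//; case: fA'.
  by rewrite ge0_fin_numE//; case: fB'.
apply: (@ge0_integral_indep _ _ _ P E (head_count l A') (head_count r B')
  (poisson_mass (fine (m l A'))) (poisson_mass (fine (m r B')))) => //.
- exact: cnt_nat.
- exact: cnt_nat.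
- by move=> w; exact: cnt_ge0.
- by move=> w; exact: cnt_ge0.
- by move=> k; exact: measurable_ev.
- by move=> k; exact: measurable_ev.
- exact: prob_fin.
- exact: prob_fin.
- by move=> k; exact: poisson_mass_ge0.
- by move=> k; exact: poisson_mass_ge0.
- by move=> i j; rewrite -!prob_ev//; exact: indepE.
- exact: poisson_mass_mean.
- exact: poisson_mass_mean.
Qed.

(** Intersecting with the product of [A] and [B] puts the whole space into the class, as the Dynkin
    induction demands. *)
Let good (C : set (X * X)) :=
  measurable_fun G (fun w => card (pairs l r (C `&` A `*` B) w) : \bar R) /\
  \int[P]_(w in E `&` G) card (pairs l r (C `&` A `*` B) w) =
  P E * (m l \x m r) (C `&` A `*` B).

Let mAB : measurable (A `*` B).
Proof. by apply: measurableX; [case: fA|case: fB]. Qed.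

Let PEfin : P E \is a fin_num. Proof. exact: fin_num_measure. Qed.

Let ABfin : (m l \x m r) (A `*` B) < +oo.
Proof.
case: fA => mA Ao; case: fB => mB Bo.
by rewrite product_measure1E// lte_mul_pinfty// ge0_fin_numE.
Qed.

Let good_rect A' B' : measurable A' -> measurable B' -> good (A' `*` B').
Proof.
move=> mA' mB'; case: (fA) => mA _; case: (fB) => mB _.
have [mG G0] := conegligible_fin2.
rewrite /good -setXI; split.
  under eq_fun do rewrite card_pairs_rect.
  apply: measurable_funTS; apply: emeasurable_funM; apply: measurable_cnt;
    by rewrite setIC; exact: fmI.
under eq_integral do rewrite card_pairs_rect.
rewrite -pair_formula_rect//; do ?[exact: measurableI|exact: subIsetr].
rewrite [RHS](ge0_negligible_integral (measurableC mG) mE _ _ G0).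
- by rewrite setDE setCK.
- apply: measurable_funTS; apply: emeasurable_funM; apply: measurable_cnt;
    by rewrite setIC; exact: fmI.
- by move=> w _; rewrite mule_ge0// cnt_ge0.
Qed.

Let good_setT : good setT.
Proof. by have := @good_rect setT setT measurableT measurableT; rewrite setXTT. Qed.

Let mEG : measurable (E `&` G).
Proof. by apply: measurableI => //; have [] := conegligible_fin2. Qed.

(** Both the number of pairs and the mean are obtained by subtraction from the full rectangle. This
    is legitimate because on [G] the number of pairs is finite and the rectangle has finite
    measure. *)
Let good_setC C : measurable C -> good C -> good (~` C).
Proof.
move=> mC [mfC iC]; have [mfT iT] := good_setT.
have fC w : G w -> finite_set (pairs l r (C `&` A `*` B) w).
  by move=> [Gl Gr]; apply: finite_pairs Gl Gr; exact: subIsetr.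
have decomp w : card (pairs l r (setT `&` A `*` B) w) =
    card (pairs l r (C `&` A `*` B) w) + card (pairs l r (~` C `&` A `*` B) w) :> \bar R.
  rewrite -cardU.
    congr card; apply/seteqP; split=> -[p q].
      move=> [Np [Nq [_ ABpq]]]; have [Cpq|Cpq] := pselect (C (hd l p, hd r q)).
        by left; split.
      by right; split.
    by case=> -[Np [Nq [_ ABpq]]].
  by rewrite -subset0 => -[p q] [[_ [_ [Cpq _]]] [_ [_ [nC _]]]].
have eqC w : G w -> card (pairs l r (~` C `&` A `*` B) w) =
    card (pairs l r (setT `&` A `*` B) w) - card (pairs l r (C `&` A `*` B) w) :> \bar R.
  move=> /fC/finite_card -/(_ R)[n nE].
  by rewrite decomp nE addeAC subee// add0e.
have mfC' : measurable_fun G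
    (fun w => card (pairs l r (~` C `&` A `*` B) w) : \bar R).
  apply: (eq_measurable_fun (fun w => card (pairs l r (setT `&` A `*` B) w) -
    card (pairs l r (C `&` A `*` B) w) : \bar R)).
    by move=> w; rewrite inE => /eqC ->.
  exact: emeasurable_funB.
have mGC D : measurable_fun G D -> measurable_fun (E `&` G) (D : _ -> \bar R).
  by apply: measurable_funS => //; have [] := conegligible_fin2.
split=> //.
have mmC : measurable (C `&` A `*` B) by exact: measurableI.
have mmC' : measurable (~` C `&` A `*` B).
  by apply: measurableI => //; exact: measurableC.
have fin1 : (m l \x m r) (C `&` A `*` B) \is a fin_num.
  rewrite ge0_fin_numE//; apply: le_lt_trans ABfin.
  by apply: le_measure; rewrite ?inE//; exact: subIsetr.
move: iT; under eq_integral do rewrite decomp.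
rewrite ge0_integralD//; do ?[exact: mGC|by move=> ? _; exact: card_ge0].
have mmD : (m l \x m r) (setT `&` A `*` B) =
    (m l \x m r) (C `&` A `*` B) + (m l \x m r) (~` C `&` A `*` B).
  rewrite (_ : setT `&` A `*` B = (C `&` A `*` B) `|` (~` C `&` A `*` B)); last first.
    by rewrite -setIUl setUCr.
  by rewrite measureU// setIACA setICr set0I.
have mm0 D : 0 <= (m l \x m r) D by exact: integral_ge0.
rewrite iC mmD; move: fin1 (mm0 (C `&` A `*` B)) (mm0 (~` C `&` A `*` B)).
move: ((m l \x m r) (C `&` A `*` B)) ((m l \x m r) (~` C `&` A `*` B)).
move=> x y xfin x0 y0; rewrite ge0_muleDr//.
have : P E * x \is a fin_num by exact: fin_numM.
move: (P E * x) => z zfin /(congr1 (fun y => y - z)).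
by rewrite addeAC subee// add0e => ->; rewrite addeAC subee// add0e.
Qed.

Let good_bigcup (F : nat -> set (X * X)) : (forall n, measurable (F n)) ->
  trivIset setT F -> (forall n, good (F n)) -> good (\bigcup_n F n).
Proof.
move=> mF tF gF; have [mG _] := conegligible_fin2.
have tF' : trivIset setT (fun n => F n `&` A `*` B).
  by move=> i j _ _ [z [[Fi _] [Fj _]]]; apply: (tF i j) => //; exists z.
have eqF w : card (pairs l r (\bigcup_n F n `&` A `*` B) w) =
    \sum_(n <oo) card (pairs l r (F n `&` A `*` B) w) :> \bar R.
  by rewrite setI_bigcupl pairs_bigcup card_bigcup//; exact: trivIset_pairs.
rewrite /good; split.
  under eq_fun do rewrite eqF.
  apply: ge0_emeasurable_sum => [k w _ _|k _]; first exact: card_ge0.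
  by have [] := gF k.
under eq_integral do rewrite eqF.
rewrite integral_nneseries//; last 2 first.
- by move=> n; have [mf _] := gF n; apply: measurable_funS mf.
- by move=> n w _; exact: card_ge0.
rewrite setI_bigcupl measure_bigcup//=; last first.
  by move=> n _; exact: measurableI.
have -> : P E = (fine (P E))%:E by rewrite fineK.
rewrite -nneseriesZl//; rewrite [RHS]eseries_mkcond.
by apply: eq_eseriesr => n _; rewrite mem_set// fineK//; have [] := gF n.
Qed.

(** On rectangles the number of pairs is a product of two counts, so independence gives the formula;
    the general case is a Dynkin argument. For equal types, sets of pairs can be handled this way
    only because [indepE] is demanded for subsets of [A] and of [B], which the applications keep
    apart. *)
Lemma pair_formula C : measurable C -> C `<=` A `*` B ->
  measurable_fun (finite_count l A `&` finite_count r B) (fun w => card (pairs l r C w) : \bar R) /\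
  \int[P]_(w in E `&` (finite_count l A `&` finite_count r B)) card (pairs l r C w) =
  P E * (m l \x m r) C.
Proof.
move=> mC CAB; suff : good C by rewrite /good (setIidl CAB).
move: mC; rewrite measurable_prod_measurableType.
pose rect := [set A1 `*` A2 | A1 in @measurable _ X & A2 in @measurable _ X].
apply: (@dynkin_induction _ _ rect good).
- exact: measurable_prod_measurableType.
- move=> _ _ [A1 mA1 [A2 mA2 <-]] [B1 mB1 [B2 mB2 <-]].
  exists (A1 `&` B1); first exact: measurableI.
  by exists (A2 `&` B2); [exact: measurableI|rewrite setXI].
- exact: good_setT.
- by move=> _ [A1 mA1 [A2 mA2 <-]]; exact: good_rect.
- exact: good_setC.
- exact: good_bigcup.
Qed.

End pair_formula.

End point_process.

(** * Pairs subject to an empty region that depends on the pair *)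

Section void_formula.
Local Open Scope ereal_scope.
Context {R : realType} {d} {Omega : measurableType d} (P : probability Omega R).
Context {dX} {X : measurableType dX} {S : choiceType}.
Variables (N : ty -> Omega -> set S) (hd : ty -> S -> X).
Variable m : ty -> {sigma_finite_measure set X -> \bar R}.
Hypotheses (law : poisson_law P N hd m) (indep : poisson_indep P N hd m).

Local Notation head_count := (@head_count R _ _ _ _ _ N hd).
Local Notation count_eq := (@count_eq R _ _ _ _ _ N hd).
Local Notation finite_mean := (finite_mean m).
Local Notation finite_count := (@finite_count R _ _ _ _ _ N hd).
Local Notation pairs := (pairs N hd).

Definition void (V : ty -> set X) (w : Omega) : Prop :=
  forall k, head_count k (V k) w = 0.

Lemma void_ev V : [set w | void V w] = count_eq ty1 (V ty1) 0 `&` count_eq ty2 (V ty2) 0.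
Proof.
apply/seteqP; split=> w /=; first by move=> vw; split; exact: vw.
by move=> [w1 w2] [].
Qed.

Definition mean_void (V : ty -> set X) : R :=
  (fine (m ty1 (V ty1)) + fine (m ty2 (V ty2)))%R.

Lemma mean_void_ge0 V : (0 <= mean_void V)%R.
Proof. by rewrite addr_ge0// fine_ge0. Qed.

Lemma measurable_void V : (forall k, finite_mean k (V k)) -> measurable [set w | void V w].
Proof.
move=> fV; rewrite void_ev; apply: measurableI; exact: (measurable_ev law).
Qed.

Lemma fm0 k : finite_mean k set0.
Proof. by split=> //; rewrite measure0. Qed.

Lemma ev0 k : count_eq k set0 0 = setT.
Proof.
apply/seteqP; split=> // w _.
have : card (N k w `&` hd k @^-1` set0) = 0 :> \bar R by rewrite preimage_set0 setI0 card0.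
by [].
Qed.

Lemma prob_void V : (forall k, finite_mean k (V k)) ->
  P [set w | void V w] = (expR (- mean_void V))%:E.
Proof.
move=> fV; rewrite void_ev.
(* Two empty sets, whose counts are always 0, pad the fourfold independence down to the two void
   counts. *)
have := indep4 indep 0%N 0%N 0%N 0%N (fV ty1) (fV ty2) (fm0 ty1) (fm0 ty1).
rewrite !ev0 !setIT probability_setT !mule1 => ->//; try by rewrite ?setI0.
by rewrite !(prob_ev law)// -EFinM /poisson_mass !expr0 !divr1 !mulr1 -expRD opprD.
Qed.

Variables (l r : ty) (A B : set X).
Hypotheses (fA : finite_mean l A) (fB : finite_mean r B) (sep : l = r -> A `&` B = set0).

(** Each head is sought outside the void region of its own type, and [sep] keeps the two heads in
    disjoint sets when the types agree, so the four sets of [indep4] are disjoint wherever they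
    share a type. *)
Lemma indep_void V A' B' i j : (forall k, finite_mean k (V k)) ->
  measurable A' -> A' `<=` A `\` V l -> measurable B' -> B' `<=` B `\` V r ->
  P ([set w | void V w] `&` count_eq l A' i `&` count_eq r B' j) =
  P [set w | void V w] * (P (count_eq l A' i) * P (count_eq r B' j)).
Proof.
move=> fV mA' sA' mB' sB'.
have fA' : finite_mean l A' by apply: fm_sub fA => // x /sA'[].
have fB' : finite_mean r B' by apply: fm_sub fB => // x /sB'[].
have := indep4 indep 0%N 0%N i j (fV ty1) (fV ty2) fA' fB'.
have dA k : k = l -> V k `&` A' = set0.
  by move=> ->; rewrite -subset0 => x [Vx /sA'[]].
have dB k : k = r -> V k `&` B' = set0.
  by move=> ->; rewrite -subset0 => x [Vx /sB'[]].
rewrite -void_ev => ->//; first last.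
- move=> lr; rewrite -subset0 -(sep lr) => x [/sA'[Ax _] /sB'[Bx _]]; by split.
- exact: dB.
- exact: dA.
- exact: dB.
- exact: dA.
rewrite -muleA; congr (_ * _).
rewrite prob_void// !(prob_ev law)// -EFinM.
by rewrite /poisson_mass !expr0 !divr1 !mulr1 -expRD opprD.
Qed.

Variables (C : set (X * X)) (mC : measurable C) (CAB : C `<=` A `*` B).
Variable idx : nat -> X * X -> nat.
Hypothesis midx : forall n j, measurable (idx n @^-1` [set j]).
Variable W : nat -> nat -> ty -> set X.
Hypothesis fW : forall n j k, finite_mean k (W n j k).
Hypothesis avoid : forall n z, C z ->
  ~ W n (idx n z) l z.1 /\ ~ W n (idx n z) r z.2.
Variables (Wl : X * X -> ty -> set X) (M : X * X -> R).
Hypothesis cvgM : forall z, C z -> mean_void (W n (idx n z)) @[n --> \oo] --> M z.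
Variables (H : set Omega) (mH : measurable H) (H0 : P (~` H) = 0).
Hypothesis conv : forall w z, H w -> C z ->
  \forall n \near \oo, void (W n (idx n z)) w <-> void (Wl z) w.

Definition hdp (pq : S * S) : X * X := (hd l pq.1, hd r pq.2).

Definition void_pairs (V : X * X -> ty -> set X) (w : Omega) : set (S * S) :=
  [set pq | pairs l r C w pq /\ void (V (hdp pq)) w].

Let G := finite_count l A `&` finite_count r B `&` H.

Let mG : measurable G.
Proof. by do 2 ?[apply: measurableI => //]; exact: (measurable_fin law). Qed.

Let G0 : P (~` G) = 0.
Proof.
by apply: conegligibleI => //; have [? ?] := conegligible_fin2 law fA fB.
Qed.

Let D n j := C `&` idx n @^-1` [set j].
Let mD n j : measurable (D n j). Proof. exact: measurableI. Qed.
Let tD n : trivIset setT (D n).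
Proof. by move=> i j _ _ [z [[_ /= <-] [_ /= <-]]]. Qed.
Let CD n : C = \bigcup_j D n j.
Proof.
by apply/seteqP; split=> [z Cz|z [j _ []]//]; exists (idx n z).
Qed.
Let hn n w : \bar R := card (void_pairs (fun z => W n (idx n z)) w).
Let Vd n j : set Omega := [set w | void (W n j) w].

Let hnE n w : hn n w =
  \sum_(j <oo) ((fun w => card (pairs l r (D n j) w) : \bar R) \_ (Vd n j)) w.
Proof.
rewrite /hn (_ : void_pairs _ w = \bigcup_j
    (if `[< Vd n j w >] then pairs l r (D n j) w else set0)); last first.
  apply/seteqP; split=> [pq [[Np [Nq Cpq]] vw]|pq [j _]].
    by exists (idx n (hdp pq)) => //; rewrite asboolT.
  case: ifPn => // /asboolP vw [Np [Nq [Cpq /= jE]]].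
  by split=> //; rewrite /hdp jE.
rewrite card_bigcup; last first.
  move=> i j _ _ [pq []]; case: ifPn => // _ [_ [_ Di]]; case: ifPn => // _ [_ [_ Dj]].
  by apply: (@tD n) => //; exists (hd l pq.1, hd r pq.2).
apply: eq_eseriesr => j _; rewrite patchE; case: ifPn => [/asboolP vw|/asboolP vw].
  by rewrite mem_set.
by rewrite memNset// card0.
Qed.

Let AW n j := A `\` W n j l.
Let BW n j := B `\` W n j r.

Let fAW n j : finite_mean l (AW n j).
Proof. by apply: fmI => //; apply: measurableC; case: (fW n j l). Qed.
Let fBW n j : finite_mean r (BW n j).
Proof. by apply: fmI => //; apply: measurableC; case: (fW n j r). Qed.

Let DAB n j : D n j `<=` AW n j `*` BW n j.
Proof.
move=> z [Cz /= jE]; have [Az Bz] := CAB Cz; have [nA nB] := @avoid n z Cz.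
by rewrite -jE; split.
Qed.

Let GAW n j : G `<=` finite_count l (AW n j) `&` finite_count r (BW n j).
Proof.
move=> w [[wA wB] _]; split.
  by apply: le_lt_trans wA; apply: le_card => p [Np [Ap _]].
by apply: le_lt_trans wB; apply: le_card => p [Np [Ap _]].
Qed.

Let pairD n j := @pair_formula R d Omega P dX X S N hd m law l r _ _ (Vd n j)
  (fAW n j) (fBW n j) (measurable_void (fW n j))
  (fun A' B' i k mA' sA' mB' sB' => indep_void i k (fW n j) mA' sA' mB' sB')
  (D n j) (mD n j) (@DAB n j).

Let mpD n j : measurable_fun G (fun w => card (pairs l r (D n j) w) : \bar R).
Proof.
have [mf _] := pairD n j; apply: measurable_funS mf; last exact: GAW.
by apply: measurableI; exact: (measurable_fin law).
Qed.

Let ipD n j : \int[P]_(w in G `&` Vd n j) card (pairs l r (D n j) w) =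
  (expR (- mean_void (W n j)))%:E * (m l \x m r) (D n j).
Proof.
have [mf iD] := pairD n j.
transitivity (P (Vd n j) * (m l \x m r) (D n j)); last first.
  by congr (_ * _); exact: prob_void.
have mV : measurable (Vd n j) by exact: measurable_void.
have mF : measurable (finite_count l (AW n j) `&` finite_count r (BW n j)).
  by apply: measurableI; exact: (measurable_fin law).
rewrite -iD [RHS](ge0_negligible_integral (measurableC mG) _ _ _ G0).
- congr (integral _ _ _); rewrite setDE setCK; apply/seteqP; split=> w.
    by move=> [Gw Vw]; split=> //; split=> //; exact: GAW.
  by move=> [[Vw _] Gw].
- exact: measurableI.
- exact: measurable_funS mf.
- by move=> w _; exact: card_ge0.
Qed.

Let mhn n : measurable_fun G (hn n).
Proof.
apply: (eq_measurable_fun (fun w => \sum_(j <oo)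
  ((fun w => card (pairs l r (D n j) w) : \bar R) \_ (Vd n j)) w)).
  by move=> w _; rewrite hnE.
apply: ge0_emeasurable_sum => [k w _ _|k _].
  by rewrite patchE; case: ifPn => // _; exact: card_ge0.
apply/(measurable_restrict _ _ mG); first exact: measurable_void.
by apply: measurable_funS (mpD n k) => //; exact: subIsetl.
Qed.

Let ihn n : \int[P]_(w in G) hn n w =
  \int[m l \x m r]_(z in C) (expR (- mean_void (W n (idx n z))))%:E.
Proof.
under eq_integral do rewrite hnE.
rewrite integral_nneseries//; last 2 first.
- move=> j; apply/(measurable_restrict _ _ mG); first exact: measurable_void.
  by apply: measurable_funS (mpD n j) => //; exact: subIsetl.
- by move=> j w _; rewrite patchE; case: ifPn => // _; exact: card_ge0.
have constD j : {in D n j, (fun z => (expR (- mean_void (W n (idx n z))))%:E) =1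
    cst (expR (- mean_void (W n j)))%:E}.
  by move=> z /set_mem[_ /= ->].
rewrite [X in \int[_]_(_ in X) _](CD n) ge0_integral_bigcup//; last first.
  apply/measurable_fun_bigcup => // j.
  by apply: (eq_measurable_fun (cst (expR (- mean_void (W n j)))%:E)) => // z /constD ->.
apply: eq_eseriesr => j _.
rewrite -integral_mkcondr ipD (eq_integral (cst (expR (- mean_void (W n j)))%:E)) //.
by rewrite integral_cst.
Qed.

Let hlim w : \bar R := card (void_pairs Wl w).

(** On [G] only finitely many pairs have their heads in [C]. For large [n] the approximate condition
    is decided correctly for all of them at once, so the sequence is eventually constant. *)
Let hn_cvg w : G w -> hn n w @[n --> \oo] --> hlim w.
Proof.
move=> [[wA wB] wH]; have /finite_fsetP[F FE] := finite_pairs CAB wA wB.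
apply: cvg_near_cst.
have : \forall n \near \oo, forall pq, pq \in F ->
    void (W n (idx n (hdp pq))) w <-> void (Wl (hdp pq)) w.
  have := @filter_bigI _ _ F (fun pq => [set n | void (W n (idx n (hdp pq))) w <->
    void (Wl (hdp pq)) w]) \oo _.
  move=> /(_ _)[].
    by move=> pq pqF; apply: conv => //; have : [set` F] pq by []; rewrite -FE => -[_ []].
  by move=> n0 _ h; exists n0 => // n /h.
apply: filterS => n Hn; rewrite /hn /hlim; congr card.
apply/seteqP; split=> pq [Cpq vw]; split=> //; apply/Hn => //.
  by have : pairs l r C w pq by []; rewrite FE.
by have : pairs l r C w pq by []; rewrite FE.
Qed.

Let CABfin : (m l \x m r) C < +oo.
Proof.
case: fA => mA Ao; case: fB => mB Bo.
apply: (@le_lt_trans _ _ ((m l \x m r) (A `*` B))).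
  by apply: le_measure; rewrite ?inE//; exact: measurableX.
by rewrite product_measure1E// lte_mul_pinfty// ge0_fin_numE.
Qed.

Let pairC := @pair_formula R d Omega P dX X S N hd m law l r _ _ setT fA fB
  measurableT.

(* On [C] the random requirement [void (Wl z)] is a limit of requirements that
   depend on [z] only through the countably valued [idx n z]; for each value the
   pairs are independent of the void event, which lies off their two heads. *)
Theorem void_formula :
  [/\ measurable G, P (~` G) = 0,
     measurable_fun G (fun w => card (void_pairs Wl w) : \bar R),
     measurable_fun G (fun w => card (pairs l r C w) : \bar R) /\
     \int[P]_(w in G) card (pairs l r C w) = (m l \x m r) C &
     measurable_fun C (fun z => (expR (- M z))%:E) /\
     \int[P]_(w in G) card (void_pairs Wl w) =
     \int[m l \x m r]_(z in C) (expR (- M z))%:E].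
Proof.
(* The empty region is always void, so independence without a void condition is the case
   [fun=> set0] of [indep_void]. *)
have indT A' B' i j : measurable A' -> A' `<=` A -> measurable B' -> B' `<=` B ->
  P (setT `&` count_eq l A' i `&` count_eq r B' j) =
  P setT * (P (count_eq l A' i) * P (count_eq r B' j)).
  move=> mA' sA' mB' sB'.
  have := @indep_void (fun=> set0) A' B' i j fm0 mA' _ mB'.
  have -> : [set w | void (fun=> set0) w] = setT.
    by rewrite void_ev !ev0 setIT.
  by rewrite !setD0; apply.
have [mf0 if0] := pairC indT mC CAB.
have mf : measurable_fun G (fun w => card (pairs l r C w) : \bar R).
  apply: measurable_funS mf0; last by move=> w [].
  by apply: measurableI; exact: (measurable_fin law).
have mlim : measurable_fun G hlim.
  by apply: (emeasurable_fun_cvg hn) => // w Gw; exact: hn_cvg.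
have mMn n : measurable_fun C (fun z => (expR (- mean_void (W n (idx n z))))%:E).
  rewrite [X in measurable_fun X](CD n); apply/measurable_fun_bigcup => // j.
  apply: (eq_measurable_fun (cst (expR (- mean_void (W n j)))%:E)) => // z.
  by move=> /set_mem[_ /= ->].
have cM z : C z -> (expR (- mean_void (W n (idx n z))))%:E @[n --> \oo] -->
    (expR (- M z))%:E.
  move=> Cz; apply: cvg_EFin; first exact: nearW.
  apply: continuous_cvg; first exact: continuous_expR.
  by apply: cvgN; exact: cvgM.
have mM : measurable_fun C (fun z => (expR (- M z))%:E).
  by apply: (emeasurable_fun_cvg (fun n z => (expR (- mean_void (W n (idx n z))))%:E)).
have iGE : \int[P]_(w in G) card (pairs l r C w) = (m l \x m r) C.
  have mF : measurable (finite_count l A `&` finite_count r B).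
    by apply: measurableI; exact: (measurable_fin law).
  move: if0; rewrite probability_setT mul1e => <-; rewrite setTI.
  rewrite [RHS](ge0_negligible_integral (measurableC mG) mF mf0 _ G0).
    by congr (integral _ _ _); rewrite setDE setCK; apply/seteqP; split=> w; [move=> [[? ?] ?]|move=> []].
  by move=> w _; exact: card_ge0.
have iG : \int[P]_(w in G) card (pairs l r C w) < +oo by rewrite iGE.
have igP : P.-integrable G (fun w => card (pairs l r C w) : \bar R).
  apply/integrableP; split=> //.
  by under eq_integral do rewrite gee0_abs ?card_ge0//.
split=> //; split=> //.
have hb1 w n : G w -> `|hn n w| <= card (pairs l r C w).
  move=> _; rewrite gee0_abs ?card_ge0//.
  by apply: le_card => pq [].
have hb2 z n : C z -> `|(expR (- mean_void (W n (idx n z))))%:E| <= cst 1 z.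
  move=> _; rewrite gee0_abs ?lee_fin ?expR_ge0//.
  by rewrite -expR0 ler_expR oppr_le0 mean_void_ge0.
(* The number of all pairs in [C] dominates; its mean is the measure of [C], finite because [A] and
   [B] have finite mean. On the side of the means the bound is the constant 1 on the same finite
   measure space. *)
have [_ _ cv1] := @dominated_convergence _ _ _ P G mG hn hlim
  (fun w => card (pairs l r C w)) mhn mlim (aeW _ hn_cvg) igP (aeW _ hb1).
have ig1 : (m l \x m r).-integrable C (cst 1).
  apply/integrableP; split=> //; under eq_integral do rewrite /= normr1.
  by rewrite integral_cst// mul1e.
have [_ _ cv2] := @dominated_convergence _ _ _ (m l \x m r) C mC
  (fun n z => (expR (- mean_void (W n (idx n z))))%:E) (fun z => (expR (- M z))%:E)
  (cst 1) mMn mM (aeW _ cM) ig1 (aeW _ hb2).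
apply: cvg_unique cv1 _ => //.
by rewrite (_ : [sequence _]_n = [sequence \int[m l \x m r]_(z in C)
   (expR (- mean_void (W n (idx n z))))%:E]_n)//; apply/funext => n /=; rewrite ihn.
Qed.

(** When [M] vanishes, the pairs that satisfy the void condition have the same finite mean number as
    all pairs in [C]. The number of remaining pairs is nonnegative with mean zero, hence almost
    surely zero. *)
Corollary void_formula_null : (forall z, C z -> M z = 0%R) ->
  P.-negligible [set w | exists2 pq, pairs l r C w pq & ~ void (Wl (hdp pq)) w].
Proof.
move=> M0; have [_ _ mv [mp ip] [_ iv]] := void_formula.
pose bad w : \bar R := card (pairs l r C w `&` ~` void_pairs Wl w).
have decomp w : card (pairs l r C w) = card (void_pairs Wl w) + bad w :> \bar R.
  rewrite -cardU; last by rewrite setICA setICr setI0.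
  congr card; rewrite setUIr setUCr setIT.
  by apply/esym/setUidPr => pq [].
have finG w : G w -> finite_set (void_pairs Wl w).
  move=> [[wA wB] _]; apply: sub_finite_set (finite_pairs CAB wA wB).
  by move=> pq [].
have badE w : G w -> bad w = card (pairs l r C w) - card (void_pairs Wl w).
  by move=> /finG/finite_card-/(_ R)[n nE]; rewrite decomp nE addeAC subee// add0e.
have mbad : measurable_fun G bad.
  apply: (eq_measurable_fun (fun w =>
      card (pairs l r C w) - card (void_pairs Wl w) : \bar R)).
    by move=> w /set_mem/badE ->.
  exact: emeasurable_funB.
have ibad : \int[P]_(w in G) `|bad w| = 0.
  under eq_integral do rewrite gee0_abs ?card_ge0//.
  have : \int[P]_(w in G) card (pairs l r C w) =
      \int[P]_(w in G) card (void_pairs Wl w) + \int[P]_(w in G) bad w.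
    under eq_integral do rewrite decomp.
    by rewrite ge0_integralD// => w _; exact: card_ge0.
  rewrite ip iv (_ : \int[_]_(z in C) _ = (m l \x m r) C); last first.
    rewrite (eq_integral (cst 1)) ?integral_cst ?mul1e// => z /set_mem Cz.
    by rewrite M0// oppr0 expR0.
  have Cfin : (m l \x m r) C \is a fin_num by rewrite ge0_fin_numE.
  move: ((m l \x m r) C) Cfin => x xfin /(congr1 (fun y => y - x)).
  by rewrite subee// addeAC subee// add0e => <-.
have /(ae_eq_integral_abs P mG mbad) [Z [mZ Z0 subZ]] := ibad.
apply: (@negligibleS _ _ _ P (~` G `|` Z)).
  move=> w [pq pqC nv]; have [Gw|] := pselect (G w); last by left.
  right; apply: subZ => /= /(_ Gw) /card_eq0.
  by rewrite -subset0 => /(_ pq); apply; split=> // -[].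
apply: negligibleU; apply/negligibleP => //; exact: measurableC.
Qed.

End void_formula.

(** * Lebesgue measure on the half-plane of heads *)

Section affine_substitution.
Context {R : realType}.
Variables (a b : R).

Definition affine (x : measurableTypeR R) : measurableTypeR R := a * x + b.

Lemma measurable_affine : measurable_fun setT affine.
Proof. by apply: measurable_funD => //; exact: measurable_funM. Qed.

HB.instance Definition _ := isMeasurableFun.Build _ _ _ _ affine measurable_affine.

Local Open Scope ereal_scope.
Local Notation mu := (@lebesgue_measure R).

Lemma affine_preimage_itv (x y : R) : a != 0%R ->
  mu (affine @^-1` `]x, y]) = (`|a|^-1)%:E * mu `]x, y].
Proof.
move=> a0; have [a_gt0|a_lt0] : (0 < a)%R \/ (a < 0)%R.
  by apply/orP; rewrite -neq_lt eq_sym.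
- rewrite (_ : _ @^-1` _ = `](x - b) / a, (y - b) / a]%classic%R); last first.
    apply/seteqP; split=> z /=; rewrite !in_itv/= /affine.
      by rewrite ltr_pdivrMr// ler_pdivlMr// ltrBlDr lerBrDr (mulrC z).
    by rewrite ltr_pdivrMr// ler_pdivlMr// ltrBlDr lerBrDr (mulrC z).
  rewrite !lebesgue_measure_itv/= !lte_fin ltr_pM2r ?invr_gt0// ltrD2r.
  case: ifPn => _; last by rewrite mule0.
  rewrite -EFinD -EFinM gtr0_norm//; congr EFin.
  by field.
(* A negative slope moves the closed end of the interval to the other side, which does not affect
   its length. *)
- rewrite (_ : _ @^-1` _ = `[(y - b) / a, (x - b) / a[%classic%R); last first.
    apply/seteqP; split=> z /=; rewrite !in_itv/= /affine andbC.
      by rewrite ltr_ndivlMr// ler_ndivrMr// ltrBlDr lerBrDr (mulrC z).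
    by rewrite ltr_ndivlMr// ler_ndivrMr// ltrBlDr lerBrDr (mulrC z).
  rewrite !lebesgue_measure_itv/= !lte_fin ltr_nM2r ?invr_lt0// ltrD2r.
  case: ifPn => _; last by rewrite mule0.
  rewrite -EFinD -EFinM ltr0_norm//; congr EFin.
  by field.
Qed.

(** The image of Lebesgue measure under the map, multiplied by [|a|], agrees with Lebesgue measure
    on half-open intervals and so equals it. *)
Lemma ge0_integral_affine (f : R -> \bar R) : a != 0%R ->
  measurable_fun setT f -> (forall x, 0 <= f x) ->
  \int[mu]_x f (a * x + b)%R = (`|a|^-1)%:E * \int[mu]_x f x.
Proof.
move=> a0 mf f0.
have na0 : (0 <= `|a|)%R by [].
pose pf : {measure set (measurableTypeR R) -> \bar R} :=
  measure_function_pushforward__canonical__measure_function_Measure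
    mu measurable_affine.
pose nu := mscale (NngNum na0) pf.
have nuE A : measurable A -> mu A = nu A.
  apply: lebesgue_measure_unique => _ [[x y] _ <-].
  transitivity (`|a|%:E * mu (affine @^-1` `]x, y])); last by [].
  rewrite affine_preimage_itv// muleA -EFinM.
  by rewrite mulfV ?mul1e// normr_eq0.
rewrite [in RHS](eq_measure_integral nu); last by move=> A mA _; exact: nuE.
rewrite ge0_integral_mscale//= muleA -EFinM mulVf ?normr_eq0// mul1e.
by rewrite ge0_integral_pushforward//= ?preimage_setT//; exact: measurable_affine.
Qed.

End affine_substitution.

Section plane.
Context {R : realType}.
Local Open Scope ereal_scope.
Local Notation mu := (@lebesgue_measure R).

Lemma measurable_line (f : R * R -> \bar R) (p q : R -> R) :
  measurable_fun setT f -> measurable_fun setT p -> measurable_fun setT q ->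
  measurable_fun setT (fun x => f (p x, q x)).
Proof.
move=> mf mp mq; apply: (measurableT_comp mf).
exact: measurable_fun_pair.
Qed.

Lemma measurable_plane (f : R * R -> \bar R) (p q : R * R -> R) :
  measurable_fun setT f -> measurable_fun setT p -> measurable_fun setT q ->
  measurable_fun setT (fun x => f (p x, q x)).
Proof.
move=> mf mp mq; apply: (measurableT_comp mf).
exact: measurable_fun_pair.
Qed.

Lemma measurable_integral_snd (f : R * R -> \bar R) : measurable_fun setT f ->
  (forall z, 0 <= f z) -> measurable_fun setT (fun x => \int[mu]_y f (x, y)).
Proof. by move=> mf f0; exact: (@measurable_fun_fubini_tonelli_F _ _ _ _ _ mu f). Qed.

Lemma measurable_integral_fst (f : R * R -> \bar R) : measurable_fun setT f ->
  (forall z, 0 <= f z) -> measurable_fun setT (fun y => \int[mu]_x f (x, y)).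
Proof. by move=> mf f0; exact: (@measurable_fun_fubini_tonelli_G _ _ _ _ _ mu f). Qed.

Lemma integral_swap (f : R * R -> \bar R) : measurable_fun setT f ->
  (forall z, 0 <= f z) ->
  \int[mu]_x \int[mu]_y f (x, y) = \int[mu]_y \int[mu]_x f (x, y).
Proof. by move=> mf f0; exact: (@fubini_tonelli _ _ _ _ _ mu mu f). Qed.

(** Expresses the second rotated coordinate through the first one and [y], so that a substitution in
    [x] at fixed [y] leaves an affine function of both variables. *)
Lemma rotation_inverse (c s x y : R) : (c != 0 -> c ^+ 2 + s ^+ 2 = 1 ->
  - x * s + y * c = - (s / c) * (c * x + y * s) + c^-1 * y)%R.
Proof.
move=> c0 cs; apply: (mulfI c0).
have -> : (c * (- (s / c) * (c * x + y * s) + c^-1 * y) =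
  - s * (c * x + y * s) + y)%R by field.
by rewrite -[X in (_ = _ + X)%R]mulr1 -cs; ring.
Qed.

(** For [c != 0] the rotation is a succession of two one-variable affine substitutions, with factors
    [|c|^-1] and [|c|] that cancel. For [c = 0] it exchanges the coordinates up to sign. *)
Lemma ge0_integral_rotation (f : R * R -> \bar R) (c s : R) :
  (c ^+ 2 + s ^+ 2 = 1)%R -> measurable_fun setT f -> (forall z, 0 <= f z) ->
  \int[mu]_x \int[mu]_y f (x * c + y * s, - x * s + y * c)%R =
  \int[mu]_x \int[mu]_y f (x, y).
Proof.
move=> cs mf f0.
have ml (p q : R * R -> R) : measurable_fun setT p -> measurable_fun setT q ->
  measurable_fun setT (fun z : R * R => f (p z, q z)) by exact: measurable_plane.
have mfst : measurable_fun setT (fun z : R * R => z.1) by exact: measurable_fst.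
have msnd : measurable_fun setT (fun z : R * R => z.2) by exact: measurable_snd.
have [c0|c0] := eqVneq c 0%R.
  have s0 : s != 0%R.
    by apply/eqP => s0; move: cs; rewrite c0 s0 expr0n addr0 => /eqP; rewrite eq_sym oner_eq0.
  have s1 : (`|s| = 1)%R.
    by apply/eqP; rewrite -(@eqrXn2 _ 2)// expr1n real_normK ?num_real// -cs c0 expr0n add0r.
  transitivity (\int[mu]_x \int[mu]_y f (y, - s * x + 0)%R).
    apply: eq_integral => x _.
    transitivity (\int[mu]_y (fun y => f (y, - s * x + 0)%R) (s * y + 0)%R).
      by apply: eq_integral => y _; congr f; rewrite c0; congr pair; ring.
    rewrite (ge0_integral_affine 0 s0 (f := fun y => f (y, - s * x + 0)%R))//.
      by rewrite s1 invr1 mul1e.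
    by apply: measurable_line.
  rewrite (ge0_integral_affine (a := (- s)%R) 0 _
    (f := fun x => \int[mu]_y f (y, x)))//; last 3 first.
  - by rewrite oppr_eq0.
  - exact: measurable_integral_fst.
  - by move=> x; exact: integral_ge0.
  by rewrite normrN s1 invr1 mul1e -(integral_swap (f := f)).
transitivity (\int[mu]_y ((`|c|^-1)%:E * \int[mu]_x f (x, - (s / c) * x + c^-1 * y)%R)).
  have /= -> // := @integral_swap
      (fun z : R * R => f (z.1 * c + z.2 * s, - z.1 * s + z.2 * c)%R); last first.
    apply: ml; apply: measurable_funD; apply: measurable_funM => //.
    exact: measurable_funN.
  apply: eq_integral => y _.
  rewrite -(ge0_integral_affine (y * s)%R c0)//; last first.
    by apply: measurable_line => //; apply: measurable_funD => //; exact: measurable_funM.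
  apply: eq_integral => x _; congr f; congr pair; first by rewrite mulrC.
  exact: rotation_inverse.
have mg : measurable_fun setT
    (fun z : R * R => f (z.2, - (s / c) * z.2 + c^-1 * z.1)%R).
  apply: ml => //; apply: measurable_funD; exact: measurable_funM.
rewrite ge0_integralZl//; last 2 first.
- exact: (measurable_integral_snd (f := fun z : R * R => f (z.2, - (s / c) * z.2 + c^-1 * z.1)%R)).
- by move=> y _; exact: integral_ge0.
have /= -> // := @integral_swap
  (fun z : R * R => f (z.2, - (s / c) * z.2 + c^-1 * z.1)%R) mg.
rewrite -ge0_integralZl//; last 2 first.
- exact: (measurable_integral_fst (f := fun z : R * R => f (z.2, - (s / c) * z.2 + c^-1 * z.1)%R)).
- by move=> y _; exact: integral_ge0.
apply: eq_integral => x _.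
transitivity ((`|c|^-1)%:E * \int[mu]_y (fun y => f (x, y)) (c^-1 * y + - (s / c) * x)%R).
  by congr (_ * _); apply: eq_integral => y _; rewrite addrC.
rewrite (@ge0_integral_affine _ _ _ (fun y => f (x, y))) ?invr_eq0//; last first.
  exact: measurable_line.
by rewrite muleA -EFinM normfV invrK mulVf ?mul1e// normr_eq0.
Qed.

End plane.

Section sigma_finite_product.
Local Open Scope ereal_scope.
Context d1 d2 (T1 : measurableType d1) (T2 : measurableType d2) (R : realType).
Variable m1 : {sigma_finite_measure set T1 -> \bar R}.
Variable m2 : {sigma_finite_measure set T2 -> \bar R}.

(* The sigma-finite instance attached to [\x] in the library is shadowed by the
   one for products of subprobabilities. *)
Definition sigma_prod : set (T1 * T2)%type -> \bar R := m1 \x m2.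

HB.instance Definition _ := Measure.on sigma_prod.

Let sigma_prod_sigma_finite : sigma_finite setT sigma_prod.
Proof.
have /sigma_finiteP[F [TF ndF Foo]] := sigma_finiteT m1.
have /sigma_finiteP[G [TG ndG Goo]] := sigma_finiteT m2.
exists (fun n => F n `*` G n).
  apply/seteqP; split=> // -[x y] _.
  have [[i _ Fx] [j _ Gy]] : (\bigcup_i F i) x /\ (\bigcup_j G j) y.
    by rewrite -TF -TG.
  exists (maxn i j) => //; split => /=.
    by move: x Fx; apply/subsetPset/ndF/leq_maxl.
  by move: y Gy; apply/subsetPset/ndG/leq_maxr.
move=> k; have [? ?] := Foo k; have [? ?] := Goo k.
split; first exact: measurableX.
by rewrite /sigma_prod product_measure1E// lte_mul_pinfty// ge0_fin_numE.
Qed.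

HB.instance Definition _ := Measure_isSigmaFinite.Build _ _ _ sigma_prod
  sigma_prod_sigma_finite.

End sigma_finite_product.

Section half_lebesgue.
Context {R : realType}.
Local Open Scope ereal_scope.
Local Notation mu := (@lebesgue_measure R).

Definition half : set (measurableTypeR R) := `[0%R, +oo[%classic.

Lemma measurable_half : measurable half. Proof. exact: measurable_itv. Qed.

Variable c : {nonneg R}.

Definition half_leb : set (measurableTypeR R) -> \bar R :=
  mscale c (mrestr mu measurable_half).

HB.instance Definition _ := Measure.on half_leb.

Let half_leb_sigma_finite : sigma_finite setT half_leb.
Proof.
have /sigma_finiteP[F [TF _ Foo]] := sigma_finiteT mu.
exists F; first by rewrite TF.
move=> k; have [mF Fk] := Foo k; split=> //.
rewrite /half_leb /mscale/= /mrestr lte_mul_pinfty//.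
rewrite (le_lt_trans _ Fk)//; apply: le_measure; rewrite ?inE//.
by apply: measurableI => //; exact: measurable_half.
Qed.

HB.instance Definition _ := Measure_isSigmaFinite.Build _ _ _ half_leb half_leb_sigma_finite.

Lemma ge0_integral_half_leb (f : R -> \bar R) : measurable_fun setT f ->
  (forall x, 0 <= f x) ->
  \int[half_leb]_x f x = c%:num%:E * \int[mu]_(x in half) f x.
Proof.
move=> mf f0; rewrite /half_leb ge0_integral_mscale//; congr (_ * _).
rewrite (ge0_negligible_integral (measurableC measurable_half) measurableT)//=.
- rewrite setTD setCK; apply: eq_measure_integral => A mA AH.
  by rewrite /= /mrestr (setIidl AH).
- by rewrite /mrestr setICl.
Qed.

(** This is [c] times area on the upper half-plane; the constant is carried by the height factor. *)
Definition head_mean :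
    {sigma_finite_measure set (measurableTypeR R * measurableTypeR R)%type -> \bar R} :=
  sigma_prod mu half_leb.

Lemma ge0_integral_head_mean (f : R * R -> \bar R) : measurable_fun setT f ->
  (forall z, 0 <= f z) ->
  \int[head_mean]_z f z = c%:num%:E * \int[mu]_x \int[mu]_(y in half) f (x, y).
Proof.
move=> mf f0; rewrite [LHS](@fubini_tonelli1 _ _ _ _ R mu half_leb f)// /fubini_F.
transitivity (\int[mu]_x (c%:num%:E * \int[mu]_(y in half) f (x, y))).
  apply: eq_integral => x _; rewrite ge0_integral_half_leb//.
  by apply: (measurableT_comp mf); exact: measurable_pair1.
rewrite ge0_integralZl//.
- have mg : measurable_fun setT ((f \_ (setT `*` half)) : R * R -> \bar R).
    apply/(measurable_restrict _ _ measurableT).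
      exact: (measurableX measurableT measurable_half).
    exact: measurable_funTS.
  apply: eq_measurable_fun (measurable_integral_snd mg _); last first.
    by move=> z; rewrite patchE; case: ifPn.
  move=> x _; rewrite [RHS]integral_mkcond; apply: eq_integral => y _.
  rewrite !patchE; congr (if _ then _ else _).
  by apply/idP/idP => /set_mem h; apply/mem_set => //; case: h.
- by move=> x _; apply: integral_ge0.
Qed.

Lemma ge0_integral_even (f : R -> \bar R) : measurable_fun setT f ->
  (forall x, 0 <= f x) ->
  \int[mu]_x f `|x|%R = 2%:E * \int[mu]_(x in half) f x.
Proof.
move=> mf f0.
have mfa : measurable_fun setT (fun x : R => f `|x|%R).
  by apply: (measurableT_comp mf); exact: normr_measurable.
rewrite -(setUv half) ge0_integral_setU//=; last 4 first.
- exact: measurable_half.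
- by apply: measurableC; exact: measurable_half.
- by rewrite setUv.
- exact/disj_setPCl.
rewrite mule_natl mule2n; congr (_ + _).
  apply: eq_integral => x; rewrite inE /half /= in_itv/= andbT => x0.
  by rewrite ger0_norm.
rewrite /half setCitvr integral_itv_bndo_bndc; last exact: measurable_funTS.
rewrite [RHS]ge0_integration_by_substitution0//.
apply: eq_integral => x; rewrite inE/= in_itv/= => x0.
by rewrite ler0_norm.
Qed.

End half_lebesgue.

(** * From positions and directions to heads *)

Section head.
Context {R : realType}.
Local Notation mu := (@lebesgue_measure R).

(** The time at which the position is orthogonal to the direction of travel, and the distance from
    the origin to the line of travel. *)
Definition head (v : R) (p : pt R) : R * R :=
  (- (p.1.1 * cos p.2 + p.1.2 * sin p.2) / v,
   `|- p.1.1 * sin p.2 + p.1.2 * cos p.2|).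

Definition bird (v : R) (z : R * R) (t : R) : R :=
  Num.sqrt (v ^+ 2 * (t - z.1) ^+ 2 + z.2 ^+ 2).

Lemma pdist_head v p t : v != 0 -> pdist v p t = bird v (head v p) t.
Proof.
move=> v0; rewrite /pdist /bird /head/=; congr Num.sqrt.
rewrite real_normK ?num_real// -exprMn.
move: (cos2Dsin2 p.2); move: (cos p.2) (sin p.2) => c s cs.
set x := p.1.1; set y := p.1.2.
have -> : v * (t - - (x * c + y * s) / v) = v * t + (x * c + y * s) by field.
have -> : (x + v * t * c) ^+ 2 + (y + v * t * s) ^+ 2 =
  x ^+ 2 + y ^+ 2 + 2 * (v * t) * (x * c + y * s) + (v * t) ^+ 2 * (c ^+ 2 + s ^+ 2).
  by ring.
rewrite cs -[X in X + _ + _ + _]mulr1 -[X in _ + X + _ + _]mulr1 -cs.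
(* The two sides differ by [(x ^+ 2 + y ^+ 2) * (1 - (c ^+ 2 + s ^+ 2))]. *)
by rewrite cs; apply/eqP; rewrite -subr_eq0; apply/eqP;
  transitivity ((x ^+ 2 + y ^+ 2) * (1 - (c ^+ 2 + s ^+ 2))); [ring|rewrite cs; ring].
Qed.

Lemma measurable_head v : measurable_fun setT (head v).
Proof.
have mx : measurable_fun setT (fun p : pt R => p.1.1).
  by apply: measurableT_comp => //; exact: measurable_fst.
have my : measurable_fun setT (fun p : pt R => p.1.2).
  by apply: measurableT_comp => //; exact: measurable_snd.
have mc : measurable_fun setT (fun p : pt R => cos p.2).
  apply: measurableT_comp; last exact: measurable_snd.
  by apply: continuous_measurable_fun; exact: continuous_cos.
have ms : measurable_fun setT (fun p : pt R => sin p.2).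
  apply: measurableT_comp; last exact: measurable_snd.
  by apply: continuous_measurable_fun; exact: continuous_sin.
apply: measurable_fun_pair.
  apply: measurable_funM => //; apply: measurable_funN.
  by apply: measurable_funD; exact: measurable_funM.
apply: measurableT_comp; first exact: normr_measurable.
apply: measurable_funD; apply: measurable_funM => //; exact: measurable_funN.
Qed.

Local Open Scope ereal_scope.

(** For a fixed angle, a rotation passes to the coordinates along and across the direction of
    travel. Measuring the first as a time contributes [v], and the absolute value folds the second
    onto the half-line, which contributes 2. The result is the same for every angle, so the angles
    only contribute [2 * pi]. *)
Lemma leb3_head v (A : set (R * R)) : (0 < v)%R -> measurable A ->
  leb3 (head v @^-1` A `&` [set p : pt R | (0 <= p.2 < 2 * pi)%R]) =
  (2 * pi * (2 * v))%:E * \int[mu]_x \int[mu]_(y in half) (\1_A (x, y))%:E.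
Proof.
move=> v0 mA.
pose I := [set th : R | (0 <= th < 2 * pi)%R].
have mI : measurable I.
  by rewrite (_ : I = `[0%R, (2 * pi)%R[%classic).
pose D := head v @^-1` A `&` [set p : pt R | (0 <= p.2 < 2 * pi)%R].
have mD : measurable D.
  apply: measurableI; first by rewrite -[X in measurable X]setTI; exact: measurable_head.
  rewrite (_ : [set _ | _] = setT `&` snd @^-1` I); last by rewrite setTI.
  exact: measurable_snd.
have mfA : measurable_fun setT (fun z => (\1_A z)%:E : \bar R).
  by apply/measurable_EFinP; exact: measurable_indic.
transitivity (\int[(mu \x mu) \x mu]_p (\1_D p)%:E).
  by rewrite integral_indic// setIT.
have mfD : measurable_fun setT (fun z => (\1_D z)%:E : \bar R).
  by apply/measurable_EFinP; exact: measurable_indic.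
rewrite [LHS](@fubini_tonelli2 _ _ _ _ R (sigma_prod mu mu) mu)//.
rewrite /fubini_G.
have muI : mu I = (2 * pi)%:E.
  transitivity (mu `[0%R, (2 * pi)%R[); first by [].
  by rewrite lebesgue_measure_itv/= lte_fin mulr_gt0 ?pi_gt0// oppr0 adde0.
have mfI : measurable_fun setT (fun y => (\1_I y)%:E : \bar R).
  by apply/measurable_EFinP; exact: measurable_indic.
have int_I k : 0 <= k -> \int[mu]_y ((\1_I y)%:E * k) = (2 * pi)%:E * k.
  move=> k0; rewrite (ge0_integralZr mu measurableT mfI _ k0); last by [].
  by rewrite (integral_indic mu measurableT mI) setIT; congr (_ * _); exact: muI.
pose K := \int[mu]_x \int[mu]_y (\1_A (- x / v, `|y|)%R)%:E.
have mg : measurable_fun setT (fun z : R * R => (\1_A (- z.1 / v, `|z.2|)%R)%:E : \bar R).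
  apply: (@measurable_plane _ _ (fun z : R * R => (- z.1 / v)%R)
    (fun z : R * R => `|z.2|%R) mfA) => //.
    by apply: measurable_funM => //; apply: measurable_funN; exact: measurable_fst.
  by apply: measurableT_comp; [exact: normr_measurable|exact: measurable_snd].
transitivity (\int[mu]_y ((\1_I y)%:E * K)).
  apply: eq_integral => th _.
  transitivity (\int[sigma_prod mu mu]_x ((\1_I th)%:E * (\1_A (head v (x, th)))%:E)).
    apply: eq_integral => x _; rewrite -EFinM; congr EFin.
    rewrite !indicE -natrM mulnb; congr (_%:R); congr nat_of_bool.
    apply/idP/andP => [/set_mem[hA hI]|[/set_mem hI /set_mem hA]].
      by split; apply/mem_set.
    by apply/mem_set.
  have mh : measurable_fun setT (fun x : R * R => (\1_A (head v (x, th)))%:E : \bar R).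
    apply: (measurableT_comp mfA); apply: (measurableT_comp (measurable_head v)).
    exact: measurable_pair2.
  rewrite ge0_integralZl//; congr (_ * _).
  have h0 : forall x : R * R, 0 <= (\1_A (head v (x, th)))%:E :> \bar R by [].
  apply: (etrans (@fubini_tonelli1 _ _ _ _ R mu mu _ mh h0)); rewrite /fubini_F /K.
  rewrite -(@ge0_integral_rotation _ (fun z => (\1_A (- z.1 / v, `|z.2|)%R)%:E)
    (cos th) (sin th))//.
  exact: cos2Dsin2.
have K0 : 0 <= K by apply: integral_ge0 => x _; apply: integral_ge0.
rewrite (int_I _ K0).
rewrite [in RHS]EFinM -muleA; congr (_ * _).
have -> : K = \int[mu]_x (2%:E * \int[mu]_(y in half) (\1_A (- x / v, y)%R)%:E).
  apply: eq_integral => x _.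
  rewrite (@ge0_integral_even _ (fun y => (\1_A (- x / v, y)%R)%:E))//.
  exact: (measurable_line mfA).
have mH : measurable_fun setT (fun x : R => \int[mu]_(y in half) (\1_A (x, y)%R)%:E).
  have mh : measurable_fun setT (((fun z => (\1_A z)%:E) \_ (setT `*` half)) : R * R -> \bar R).
    apply/(measurable_restrict _ _ measurableT).
      exact: (measurableX measurableT measurable_half).
    exact: measurable_funTS.
  apply: eq_measurable_fun (measurable_integral_snd mh _); last first.
    by move=> z; rewrite patchE; case: ifPn.
  move=> x _; rewrite [RHS]integral_mkcond; apply: eq_integral => y _.
  rewrite !patchE; congr (if _ then _ else _).
  by apply/idP/idP => /set_mem h; apply/mem_set => //; case: h.
transitivity (\int[mu]_x (fun x => 2%:E * \int[mu]_(y in half) (\1_A (x, y)%R)%:E)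
   (- v^-1 * x + 0)%R).
  by apply: eq_integral => x _; rewrite addr0 mulNr mulrC mulNr.
rewrite (@ge0_integral_affine _ (- v^-1)%R 0%R
  (fun x => 2%:E * \int[mu]_(y in half) (\1_A (x, y)%R)%:E))//.
- rewrite ge0_integralZl//; last by move=> x _; exact: integral_ge0.
  by rewrite muleA -EFinM normrN normfV invrK gtr0_norm// mulrC.
- by rewrite oppr_eq0 invr_eq0 gt_eqF.
- exact: measurable_funeM.
- by move=> x; rewrite mule_ge0//; exact: integral_ge0.
Qed.

End head.

(** * Area of the set of heads whose bird is low at a given time *)

Section half_disc.
Context {R : realType}.
Local Notation mu := (@lebesgue_measure R).

Lemma derivable_oo_LRcontinuousT (F : R -> R) (a b : R) : a < b ->
  (forall x, derivable F x 1) -> derivable_oo_LRcontinuous F a b.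
Proof.
move=> ab dF; have cF : continuous F.
  by move=> x; apply: differentiable_continuous; apply/derivable1_diffP.
split.
- by move=> x _; exact: dF.
- exact: cvg_at_right_filter (cF a).
- exact: cvg_at_left_filter (cF b).
Qed.

Lemma integral_half_circle (r : R) : 0 <= r ->
  (\int[mu]_x (Num.sqrt (r ^+ 2 - x ^+ 2))%:E = (pi * r ^+ 2 / 2)%:E)%E.
Proof.
rewrite le_eqVlt => /predU1P[<-|r0].
  rewrite expr0n/= mulr0 mul0r; apply: integral0_eq => x _.
  by rewrite ler0_sqrtr// sub0r oppr_le0 sqr_ge0.
(* [Num.sqrt] is 0 at negative arguments, so the integral over the line is one over [[-r, r]], where
   the substitution [r * sin x] applies. *)
transitivity (\int[mu]_(x in `[(- r)%R, r]) (Num.sqrt (r ^+ 2 - x ^+ 2))%:E)%E.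
  rewrite [RHS]integral_mkcond; apply: eq_integral => x _.
  rewrite patchE; case: ifPn => // /negP xr; congr EFin.
  apply: ler0_sqrtr; rewrite subr_le0 leNgt; apply/negP => h; apply: xr.
  rewrite inE/= in_itv/= -ler_norml -ler_sqr ?nnegrE// ?(ltW r0)//.
  by rewrite real_normK ?num_real// ltW.
pose F (x : R) := r * sin x.
have p0 : 0 < pi / 2 :> R by rewrite divr_gt0// pi_gt0.
have pp : - (pi / 2) < pi / 2 :> R by rewrite gtrN.
have dF (x : R) : is_derive x 1 F (r * cos x).
  by apply: is_deriveZ.
have F'E : derive1 F = (fun x => r * cos x).
  by apply/funext => x; rewrite derive1E; have [_ ->] := dF x.
have cF' : continuous (fun x : R => r * cos x).
  by move=> x; apply: cvgMr; exact: continuous_cos.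
have -> : `[- r, r]%classic = `[F (- (pi / 2)), F (pi / 2)]%classic :> set R.
  by rewrite /F sinN sin_pihalf mulrN mulr1.
rewrite integration_by_substitution_increasing//; last 7 first.
- exact: ltW.
- move=> x y xp yp xy; rewrite /F ltr_pM2l// ltr_sin//.
- by rewrite F'E => x _; exact: cF'.
- by rewrite F'E; apply/cvg_ex; eexists; apply: cvg_at_right_filter; exact: cF'.
- by rewrite F'E; apply/cvg_ex; eexists; apply: cvg_at_left_filter; exact: cF'.
- apply: derivable_oo_LRcontinuousT => // x.
- apply: continuous_subspaceT => x.
  apply: continuous_comp; last exact: sqrt_continuous.
  by apply: cvgB; [exact: cvg_cst|exact: exprn_continuous].
(* The antiderivative of [r ^+ 2 * cos x ^+ 2], the integrand after the substitution. *)
pose G (x : R) := r ^+ 2 / 2 * (x + sin x * cos x).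
have dG (x : R) : is_derive x 1 G (r ^+ 2 * cos x ^+ 2).
  apply: is_derive_eq.
  rewrite /GRing.scale/= -[X in X + _](cos2Dsin2 x).
  by field.
transitivity (\int[mu]_(x in `[(- (pi / 2))%R, (pi / 2)%R]) (r ^+ 2 * cos x ^+ 2)%:E)%E.
  apply: eq_integral => x; rewrite inE/= in_itv/= => xp; congr EFin.
  rewrite F'E; transitivity (Num.sqrt (r ^+ 2 - (r * sin x) ^+ 2) * (r * cos x)); first by [].
  rewrite exprMn -[X in X - _]mulr1 -mulrBr.
  have -> : 1 - sin x ^+ 2 = cos x ^+ 2 by rewrite -(cos2Dsin2 x) addrK.
  rewrite -exprMn sqrtr_sqr ger0_norm; first by ring.
  by rewrite mulr_ge0 ?(ltW r0)// cos_ge0_pihalf.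
rewrite (@continuous_FTC2 _ _ G)//.
- rewrite -EFinB /G sinN cosN sin_pihalf cos_pihalf; congr EFin.
  by field.
- apply: continuous_subspaceT => x; apply: cvgMr.
  by apply: (@continuous_comp _ _ _ cos (fun x => x ^+ 2)); [exact: continuous_cos|exact: exprn_continuous].
- by apply: derivable_oo_LRcontinuousT => // x.
- by move=> x _; rewrite derive1E; have [_ ->] := dG x.
Qed.

End half_disc.

Section disc.
Context {R : realType}.
Local Notation mu := (@lebesgue_measure R).
Variables (v : R) (v0 : 0 < v).

Lemma measurable_sqrtr : measurable_fun setT (@Num.sqrt R).
Proof. by apply: continuous_measurable_fun; exact: sqrt_continuous. Qed.

Definition disc (t r : R) : set (R * R) := [set z | bird v z t < r].

Lemma bird_ge0 z t : 0 <= bird v z t. Proof. exact: sqrtr_ge0. Qed.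

Lemma measurable_bird (t : R) : measurable_fun setT (fun z => bird v z t).
Proof.
apply: (measurableT_comp measurable_sqrtr).
apply: measurable_funD; last first.
  by apply: measurable_funX; exact: measurable_snd.
apply: measurable_funM => //; apply: measurable_funX.
by apply: measurable_funB => //; exact: measurable_fst.
Qed.

Lemma measurable_disc t r : measurable (disc t r).
Proof.
rewrite /disc (_ : [set _ | _] = setT `&` (fun z => bird v z t) @^-1` `]-oo, r[).
  by apply: measurable_bird => //; exact: measurable_itv.
by apply/seteqP; split=> z /=; rewrite in_itv//= => -[].
Qed.

Lemma disc0 t r : r <= 0 -> disc t r = set0.
Proof.
move=> r0; rewrite -subset0 => z; rewrite /disc/= => zr.
by have := le_lt_trans (bird_ge0 z t) (lt_le_trans zr r0); rewrite ltxx.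
Qed.

Lemma bird_ltE (r : R) z t : 0 <= r ->
  (bird v z t < r) = (v ^+ 2 * (t - z.1) ^+ 2 + z.2 ^+ 2 < r ^+ 2).
Proof.
move=> r0; have b0 : 0 <= v ^+ 2 * (t - z.1) ^+ 2 + z.2 ^+ 2.
  by apply: addr_ge0; [apply: mulr_ge0|]; exact: sqr_ge0.
by rewrite -[in RHS](sqr_sqrtr b0) ltr_sqr ?nnegrE// sqrtr_ge0.
Qed.

Lemma lt_sqrtE (y s : R) : 0 <= y -> (y < Num.sqrt s) = (y ^+ 2 < s).
Proof.
move=> y0; have [s0|s0] := leP s 0.
  rewrite ler0_sqrtr// ltNge y0/=; apply/esym/negbTE; rewrite -leNgt.
  exact: le_trans s0 (sqr_ge0 _).
by rewrite -[in RHS](sqr_sqrtr (ltW s0)) ltr_sqr ?nnegrE ?sqrtr_ge0.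
Qed.

Lemma head_mean_disc (c : {nonneg R}) t r :
  head_mean c (disc t r) = (c%:num * (pi * (Num.max r 0) ^+ 2 / (2 * v)))%:E.
Proof.
have [r0|r0] := leP r 0.
  by rewrite disc0// measure0 expr0n/= mulr0 mul0r mulr0.
have r0' := ltW r0.
transitivity (\int[head_mean c]_z (\1_(disc t r) z)%:E)%E.
  by rewrite integral_indic// ?setIT//; exact: measurable_disc.
rewrite ge0_integral_head_mean//; last first.
  by apply/measurable_EFinP; apply: measurable_indic; exact: measurable_disc.
rewrite EFinM; congr (_ * _)%E.
transitivity (\int[mu]_x (fun x => (Num.sqrt (r ^+ 2 - x ^+ 2))%:E) (v * x + - (v * t))%R)%E.
  apply: eq_integral => x _.
  transitivity (\int[mu]_(y in half) (\1_[set y | disc t r (x, y)] y)%:E)%E.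
    by apply: eq_integral => y _; rewrite !indicE.
  set s := Num.sqrt (r ^+ 2 - (v * x - v * t) ^+ 2).
  have sE : [set y | disc t r (x, y)] `&` half = `[0%R, s[%classic.
    apply/seteqP; split=> y; rewrite /half /= !in_itv/= ?andbT.
      move=> [+ y0]; rewrite /disc/= bird_ltE//= y0/= lt_sqrtE//.
      by rewrite -mulrBr exprMn ltrBrDr addrC -[(t - x) ^+ 2]sqrrN opprB.
    move=> /andP[y0]; rewrite lt_sqrtE// /disc/= bird_ltE//=.
    by rewrite -mulrBr exprMn ltrBrDr addrC -[(t - x) ^+ 2]sqrrN opprB.
  rewrite integral_indic//=; last 2 first.
  - exact: measurable_half.
  - rewrite -[X in measurable X]setTI.
    apply: (measurable_pair1 x measurableT); exact: measurable_disc.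
  rewrite [X in mu X = _]sE lebesgue_measure_itv/= lte_fin oppr0 adde0.
  by case: ifPn => //; rewrite -leNgt => s0; congr EFin; apply/le_anti; rewrite s0 sqrtr_ge0.
rewrite (@ge0_integral_affine _ _ _ (fun x => (Num.sqrt (r ^+ 2 - x ^+ 2))%:E)).
- rewrite integral_half_circle// -EFinM; congr EFin.
  by rewrite gtr0_norm//; field; rewrite gt_eqF.
- by rewrite gt_eqF.
- apply/measurable_EFinP; apply: (measurableT_comp measurable_sqrtr).
  by apply: measurable_funB => //; exact: measurable_funX.
- by move=> x; rewrite lee_fin sqrtr_ge0.
Qed.

End disc.

Section head_law.
Context {R : realType} {d} {Omega : measurableType d}.
Variables (P : probability Omega R) (N : ty -> Omega -> set (pt R)).
Variables (lam1 lam2 v1 v2 : R).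
Hypotheses (lam10 : 0 < lam1) (lam20 : 0 < lam2) (v20 : 0 < v2) (v21 : v2 < v1).
Hypothesis PPP : two_type_PPP P N lam1 lam2.

Definition sp (l : ty) : R := speed v1 v2 l.
Definition lm (l : ty) : R := rate lam1 lam2 l.

Lemma sp_gt0 l : 0 < sp l.
Proof. by case: l => //=; exact: lt_trans v20 v21. Qed.

Lemma lm_gt0 l : 0 < lm l. Proof. by case: l. Qed.

Lemma head_rate_ge0 l : 0 <= 2 * lm l * sp l.
Proof. by rewrite !mulr_ge0// ltW// ?lm_gt0// sp_gt0. Qed.

Definition head_rate l : {nonneg R} := NngNum (head_rate_ge0 l).

Definition head_intensity l := head_mean (head_rate l).
Definition station_head l (p : pt R) : measurableTypeR R * measurableTypeR R := head (sp l) p.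

Lemma measurable_hds l (A : set (R * R)) : measurable A -> measurable (station_head l @^-1` A).
Proof.
by move=> mA; rewrite -[X in measurable X]setTI; exact: (measurable_head (sp l)).
Qed.

Lemma mean_measure_head l (A : set (R * R)) : measurable A ->
  mean_measure lam1 lam2 l (station_head l @^-1` A) = head_intensity l A.
Proof.
move=> mA; rewrite /mean_measure leb3_head ?sp_gt0//.
transitivity (\int[head_intensity l]_z (\1_A z)%:E)%E; last by rewrite integral_indic// setIT.
rewrite [RHS]ge0_integral_head_mean//=; last first.
  by apply/measurable_EFinP; exact: measurable_indic.
rewrite muleA -EFinM; congr (_%:E * _)%E.
have p0 : pi != 0 :> R by rewrite gt_eqF// pi_gt0.
by rewrite -/(lm l); move: (pi : R) p0 => q q0; field.
Qed.

Lemma head_poisson_law : poisson_law P N station_head head_intensity.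
Proof.
move=> l A k [mA fA]; case: PPP => law _.
rewrite -mean_measure_head//.
by apply: law; [exact: measurable_hds|rewrite mean_measure_head].
Qed.

Lemma head_poisson_indep : poisson_indep P N station_head head_intensity.
Proof.
move=> n l B K fB dB; case: PPP => _ ind.
apply: (ind n l (fun i => station_head (l i) @^-1` B i) K).
- move=> i; have [mB Bo] := fB i.
  by split; [exact: measurable_hds|rewrite mean_measure_head].
- move=> i j ij lij; rewrite lij -preimage_setI dB//.
Qed.

End head_law.

(** * Void probabilities of discs *)

Section grid.
Context {R : realType}.

Lemma measurable_inv : measurable_fun setT (fun x : R => x^-1).
Proof.
rewrite -(setvU [set 0 : R]); apply/measurable_funU => //.
  by apply: measurableC; exact: measurable_set1.
split; last exact: measurable_fun_set1.
apply: open_continuous_measurable_fun.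
  by apply: closed_openC; exact: closed_eq.
by move=> x; rewrite inE/= => /eqP x0; exact: inv_continuous.
Qed.

Definition step (n : nat) : R := (2 ^+ n)^-1.

Lemma step_gt0 n : 0 < step n.
Proof. by rewrite invr_gt0 exprn_gt0. Qed.

Lemma cvg_step : step n @[n --> \oo] --> (0 : R).
Proof.
rewrite (_ : step = fun n => (2^-1) ^+ n); last by apply/funext => n; rewrite /step exprVn.
by apply: cvg_expr; rewrite ger0_norm// invf_lt1// ltr1n.
Qed.

Definition cell (n : nat) (x : R) : int := Num.floor (2 ^+ n * x).

Lemma cell_le n x : (cell n x)%:~R * step n <= x.
Proof.
by rewrite /step ler_pdivrMr ?exprn_gt0// mulrC; exact: floor_le.
Qed.

Lemma cell_gt n x : x < (cell n x)%:~R * step n + step n.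
Proof.
rewrite -[X in _ < _ + X]mul1r -mulrDl /step ltr_pdivlMr ?exprn_gt0// mulrC.
by rewrite -[1]/(1%:~R) -intrD; exact: floorD1_gt.
Qed.

Lemma measurable_cell (d : measure_display) (T : measurableType d) (f : T -> R) n a :
  measurable_fun setT f -> measurable [set x | cell n (f x) = a].
Proof.
move=> mf; rewrite (_ : [set _ | _] = setT `&` f @^-1` `[a%:~R * step n, a%:~R * step n + step n[).
  by apply: mf => //; exact: measurable_itv.
rewrite setTI; apply/seteqP; split=> x /=; rewrite in_itv/=.
  by move=> <-; rewrite cell_le cell_gt.
rewrite /step ler_pdivrMr ?exprn_gt0// -{2}(mul1r (2 ^+ n)^-1) -mulrDl.
rewrite ltr_pdivlMr ?exprn_gt0// => /andP[h1 h2].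
by apply: floor_def; rewrite mulrC intrD h1.
Qed.

(** The pair of grid indices is coded by one natural number because the approximating regions are
    summed as a series over their index. *)
Definition cells (n : nat) (x y : R) : nat := choice.pickle (cell n x, cell n y).

(** A number that codes no pair is sent to [(0, 0)], so that a region of finite mean is attached to
    every index. *)
Definition uncells (j : nat) : int * int := odflt (0, 0) (choice.unpickle j).

Lemma cellsK n x y : uncells (cells n x y) = (cell n x, cell n y).
Proof. by rewrite /uncells choice.pickleK. Qed.

Lemma measurable_cells (d : measure_display) (T : measurableType d) (f g : T -> R) n j :
  measurable_fun setT f -> measurable_fun setT g ->
  measurable ((fun x => cells n (f x) (g x)) @^-1` [set j]).
Proof.
move=> mf mg; case E : (choice.unpickle j : option (int * int)) => [[a b]|].
- have [pj|pj] := eqVneq (choice.pickle (a, b)) j; last first.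
    rewrite (_ : _ @^-1` _ = set0)//; rewrite -subset0 => x /= xj.
    by move: E pj; rewrite -xj /cells choice.pickleK => -[<- <-]; rewrite eqxx.
  rewrite (_ : _ @^-1` _ = [set x | cell n (f x) = a] `&` [set x | cell n (g x) = b]).
    by apply: measurableI; exact: measurable_cell.
  apply/seteqP; split=> x /=.
    by move=> xj; move: E; rewrite -xj /cells choice.pickleK => -[<- <-].
  by move=> [fa gb]; rewrite /cells fa gb.
- rewrite (_ : _ @^-1` _ = set0)//; rewrite -subset0 => x /= xj.
  by move: E; rewrite -xj /cells choice.pickleK.
Qed.

End grid.

Lemma negligible_bigcup_count d (T : measurableType d) (R : realType)
    (mu : {measure set T -> \bar R}) (I : countType) (F : I -> set T) :
  (forall i, mu.-negligible (F i)) -> mu.-negligible (\bigcup_i F i).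
Proof.
move=> nF; apply: (@negligibleS _ _ _ mu
  (\bigcup_n (if choice.unpickle n is Some i then F i else set0))).
  by move=> x [i _ Fx]; exists (choice.pickle i) => //; rewrite choice.pickleK.
apply: negligible_bigcup => n; case: (choice.unpickle n) => [i|].
  exact: nF.
exact: negligible_set0.
Qed.

Section bird_continuity.
Context {R : realType}.
Implicit Types (v t s : R) (z : R * R).

(** A station of speed [v] changes its distance to the origin by at most [v] times the elapsed time.
    In these coordinates it is the triangle inequality for a Euclidean norm, hence Cauchy-Schwarz in
    the step [be]. *)
Lemma bird_lipschitz v z t s : 0 < v -> bird v z t <= bird v z s + v * `|t - s|.
Proof.
move=> v0; set b := bird v z s; set e := v * `|t - s|.
have b0 : 0 <= b by exact: bird_ge0.
have e0 : 0 <= e by rewrite mulr_ge0// ltW.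
rewrite -(@ger0_norm _ (b + e)) ?addr_ge0// -sqrtr_sqr /bird ler_sqrt ?sqr_ge0//.
have h0 : 0 <= v ^+ 2 * (s - z.1) ^+ 2 + z.2 ^+ 2.
  by apply: addr_ge0; [apply: mulr_ge0|]; exact: sqr_ge0.
have bE : b ^+ 2 = v ^+ 2 * (s - z.1) ^+ 2 + z.2 ^+ 2 by rewrite sqr_sqrtr.
have eE : e ^+ 2 = v ^+ 2 * (t - s) ^+ 2 by rewrite exprMn real_normK ?num_real.
have be : v ^+ 2 * ((s - z.1) * (t - s)) <= b * e.
  apply: (le_trans (ler_norm _)).
  rewrite -ler_sqr ?nnegrE ?normr_ge0 ?(mulr_ge0 b0 e0)// real_normK ?num_real//.
  rewrite [in leRHS]exprMn bE eE.
  rewrite (_ : (v ^+ 2 * ((s - z.1) * (t - s))) ^+ 2 =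
    v ^+ 2 * (s - z.1) ^+ 2 * (v ^+ 2 * (t - s) ^+ 2)); last by ring.
  apply: ler_wpM2r; first by rewrite mulr_ge0// sqr_ge0.
  by rewrite lerDl sqr_ge0.
have -> : v ^+ 2 * (t - z.1) ^+ 2 + z.2 ^+ 2 =
  b ^+ 2 + e ^+ 2 + 2 * (v ^+ 2 * ((s - z.1) * (t - s))) by rewrite bE eE; ring.
have -> : (b + e) ^+ 2 = b ^+ 2 + e ^+ 2 + 2 * (b * e) by ring.
by rewrite lerD2l ler_pM2l.
Qed.

Lemma bird_dist v z t s : 0 < v -> `|bird v z t - bird v z s| <= v * `|t - s|.
Proof.
move=> v0; rewrite ler_norml; apply/andP; split.
  by rewrite lerNl opprB lerBlDr addrC distrC bird_lipschitz.
by rewrite lerBlDr addrC bird_lipschitz.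
Qed.

End bird_continuity.

Section disc_void.
Context {R : realType} {d} {Omega : measurableType d}.
Variables (P : probability Omega R) (N : ty -> Omega -> set (pt R)).
Variables (lam1 lam2 v1 v2 : R).
Hypotheses (lam10 : 0 < lam1) (lam20 : 0 < lam2) (v20 : 0 < v2) (v21 : v2 < v1).
Hypothesis PPP : two_type_PPP P N lam1 lam2.

Local Notation X := (measurableTypeR R * measurableTypeR R)%type.
Local Notation hd := (@station_head R v1 v2).
Local Notation m := (head_intensity lam10 lam20 v20 v21).
Local Notation sp := (sp v1 v2).
Local Notation lam := (lam1 + lam2).
Local Notation void := (@void R _ _ _ _ _ N hd).
Local Notation void_pairs := (@void_pairs R _ _ _ _ _ N hd).
Local Notation head_count := (@head_count R _ _ _ _ _ N hd).

Let law : poisson_law P N hd m. Proof. exact: head_poisson_law. Qed.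
Let ind : poisson_indep P N hd m. Proof. exact: head_poisson_indep. Qed.

Let sp_pos l : 0 < sp l. Proof. exact: sp_gt0. Qed.

Lemma sp_le l : sp l <= v1. Proof. by case: l => //=; exact: ltW. Qed.

Lemma void_cnt V w : void V w <-> forall k p, N k w p -> ~ V k (hd k p).
Proof.
split=> [vV k p Np Vp|vV k]; last first.
  by apply/card_eq0; rewrite -subset0 => p [Np Vp]; exact: (vV k p Np Vp).
have /card_eq0 := vV k; rewrite -subset0 => /(_ p); apply; by split.
Qed.

Lemma fm_disc k t r : finite_mean m k (disc (sp k) t r).
Proof.
split; first exact: measurable_disc.
by rewrite [X in (X < _)%E]head_mean_disc ?sp_pos// ltry.
Qed.

(** Heads of type [k] have rate [2 * lm k * sp k] and the half ellipse has area
    [pi * r ^+ 2 / (2 * sp k)]: the speeds cancel, and only the total rate of stations remains. *)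
Lemma mean_void_disc t r :
  mean_void m (fun k => disc (sp k) t r) = lam * pi * (Num.max r 0) ^+ 2.
Proof.
rewrite /mean_void !head_mean_disc ?sp_pos//=.
have h (l x : R) : x != 0 -> 2 * l * x * (pi * (Num.max r 0) ^+ 2 / (2 * x)) =
    l * pi * (Num.max r 0) ^+ 2 by move=> x0; field.
have v10 : v1 != 0 by rewrite gt_eqF// (lt_trans v20).
have v20' : v2 != 0 by rewrite gt_eqF.
by rewrite (h lam1 v1 v10) (h lam2 v2 v20') !mulrDl.
Qed.

Section one_piece.
Variables (l r : ty) (A B : set X).
Hypotheses (fA : finite_mean m l A) (fB : finite_mean m r B) (sep : l = r -> A `&` B = set0).
Variables (C : set (X * X)) (mC : measurable C) (CAB : C `<=` A `*` B).
Variable tau : X * X -> R.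
Hypothesis mtau : measurable_fun setT tau.
Hypothesis meet : forall z, C z ->
  bird (sp l) z.1 (tau z) = bird (sp r) z.2 (tau z).

Definition meet_height (l : ty) (tau : X * X -> R) (z : X * X) : R :=
  bird (sp l) z.1 (tau z).
Definition closer (l : ty) (tau : X * X -> R) (z : X * X) (k : ty) : set X :=
  disc (sp k) (tau z) (meet_height l tau z).

Lemma measurable_meet_height : measurable_fun setT (meet_height l tau).
Proof.
apply: (measurableT_comp measurable_sqrtr); apply: measurable_funD.
  apply: measurable_funM => //; apply: measurable_funX.
  apply: measurable_funB => //; apply: (measurableT_comp measurable_fst).
  exact: measurable_fst.
apply: measurable_funX; apply: (measurableT_comp measurable_snd).
exact: measurable_fst.
Qed.

Let rho := meet_height l tau.
Let idx n (z : X * X) := cells n (tau z) (rho z).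
(* The radius is shrunk so that, birds being Lipschitz, the disc around the grid
   point stays inside [closer l tau z]. *)
Let rad n (b : int) : R := b%:~R * step n - (v1 + 1) * step n.
Let W n j (k : ty) : set X :=
  disc (sp k) ((uncells j).1%:~R * step n) (rad n (uncells j).2).

Let rho_ge0 z : 0 <= rho z. Proof. exact: bird_ge0. Qed.

Let cell_dist n (x : R) : `|x - (cell n x)%:~R * step n| <= step n.
Proof.
rewrite ger0_norm ?subr_ge0 ?cell_le// lerBlDl.
by apply/ltW; exact: cell_gt.
Qed.

Let W_sub n z k : W n (idx n z) k `<=` closer l tau z k.
Proof.
move=> u; rewrite /W /idx cellsK /closer /disc /= => h.
apply: (le_lt_trans (@bird_lipschitz _ _ _ _ ((cell n (tau z))%:~R * step n) (sp_pos k))).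
have := cell_le n (rho z).
have : sp k * `|tau z - (cell n (tau z))%:~R * step n| <= v1 * step n.
  apply: ler_pM => //; [exact/ltW/sp_pos|exact: sp_le].
move: h; rewrite /rad -/(rho z); have := step_gt0 (R := R) n; lra.
Qed.

(** The constant adds up the losses: [v1] for rounding the time, [v1 + 1] for the shrinking in
    [rad], and 1 for rounding the radius. *)
Let W_sup n z k u : bird (sp k) u (tau z) + (2 * v1 + 2) * step n < rho z ->
  W n (idx n z) k u.
Proof.
move=> h; rewrite /W /idx cellsK /disc /=.
apply: (le_lt_trans (@bird_lipschitz _ _ _ _ (tau z) (sp_pos k))).
have := cell_gt n (rho z).
have : sp k * `|(cell n (tau z))%:~R * step n - tau z| <= v1 * step n.
  rewrite distrC; apply: ler_pM => //; [exact/ltW/sp_pos|exact: sp_le].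
move: h; rewrite /rad; have := step_gt0 (R := R) n; lra.
Qed.

Let cvg_rad z : Num.max (rad n (cell n (rho z))) 0 @[n --> \oo] --> rho z.
Proof.
apply: (@squeeze_cvgr _ _ _ _ (fun n => rho z - (v1 + 2) * step n) (fun=> rho z)).
- near=> n; apply/andP; split.
    rewrite le_max; apply/orP; left; rewrite /rad.
    have := cell_gt n (rho z); have := step_gt0 (R := R) n; lra.
  rewrite ge_max rho_ge0 andbT /rad.
  have := cell_le n (rho z); have := step_gt0 (R := R) n.
  have := lt_trans v20 v21; nra.
- rewrite -[X in _ --> X]subr0; apply: cvgB; first exact: cvg_cst.
  by rewrite -[X in _ --> X](mulr0 (v1 + 2)); apply: cvgMr; exact: cvg_step.
- exact: cvg_cst.
Unshelve. all: by end_near. Qed.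

Lemma disc_void_formula : exists G : set Omega,
  [/\ measurable G, P (~` G) = 0%E,
     measurable_fun G (fun w => card (void_pairs l r C (closer l tau) w) : \bar R),
     measurable_fun C (fun z => (expR (- (lam * pi * (rho z) ^+ 2)))%:E) &
     (\int[P]_(w in G) card (void_pairs l r C (closer l tau) w) =
     \int[m l \x m r]_(z in C) (expR (- (lam * pi * (rho z) ^+ 2)))%:E)%E].
Proof.
have midx n j : measurable (idx n @^-1` [set j]).
  by apply: measurable_cells => //; exact: measurable_meet_height.
have fW n j k : finite_mean m k (W n j k) by exact: fm_disc.
have avoid n z : C z -> ~ W n (idx n z) l z.1 /\ ~ W n (idx n z) r z.2.
  move=> Cz; split=> /W_sub; rewrite /closer /disc/= ?meet// /meet_height.
    by rewrite meet// ltxx.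
  by rewrite meet// ltxx.
have cvgM z : C z -> mean_void m (W n (idx n z)) @[n --> \oo] --> lam * pi * (rho z) ^+ 2.
  move=> Cz; rewrite (_ : (fun n => _) =
    fun n => lam * pi * (Num.max (rad n (cell n (rho z))) 0) ^+ 2).
    apply: cvgMr; have h := @cvg_rad z; exact: (cvgM h h).
  apply/funext => n; rewrite /W /idx cellsK /=; exact: mean_void_disc.
(* The shrunk discs lie inside the true one, so only a station inside the true disc can make a
   difference. The true disc is given by a strict inequality, so such a station lies in the shrunk
   discs for all large [n]; a single witness suffices and no finiteness is used. *)
have conv w z : setT w -> C z ->
    \forall n \near \oo, void (W n (idx n z)) w <-> void (closer l tau z) w.
  move=> _ Cz; have [vz|nvz] := pselect (void (closer l tau z) w).
    apply: nearW => n; split=> // _; apply/void_cnt => k p Np /W_sub.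
    by move/void_cnt : vz; apply.
  have [k [p [Np cp]]] : exists k p, N k w p /\ closer l tau z k (hd k p).
    apply: contrapT => nex; apply: nvz; apply/void_cnt => k p Np cp.
    by apply: nex; exists k, p.
  have d0 : 0 < rho z - bird (sp k) (hd k p) (tau z) by rewrite subr_gt0.
  have c0 : 0 < 2 * v1 + 2 by have := lt_trans v20 v21; lra.
  move/cvgrPdist_lt: (@cvg_step R) => /(_ _ (divr_gt0 d0 c0)).
  apply: filterS => n; rewrite sub0r normrN (ger0_norm (ltW (step_gt0 n))) => h.
  split=> // /void_cnt /(_ k p Np) []; apply: W_sup.
  by rewrite addrC -ltrBrDr mulrC -ltr_pdivlMr.
have T0 : P (~` setT) = 0%E by rewrite setCT measure0.
have [mG G0 mv _ [mM iv]] := void_formula law ind fA fB sep mC CAB midx fW avoid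
  cvgM (H := setT) measurableT T0 conv.
by eexists; split; [exact: mG|exact: G0|exact: mv|exact: mM|exact: iv].
Qed.

End one_piece.

(** Both sides are countably additive in [C], so [C] may be cut along a disjoint refinement of
    products of sets of finite mean. For equal types the two factors of each product are disjoint,
    which is where independence of the two heads comes from. *)
Lemma disc_void_formula_cover (l r : ty) (A B : nat -> set X) (C : set (X * X))
    (tau : X * X -> R) :
  (forall i, finite_mean m l (A i)) -> (forall i, finite_mean m r (B i)) ->
  (forall i, l = r -> A i `&` B i = set0) ->
  measurable C -> C `<=` \bigcup_i (A i `*` B i) -> measurable_fun setT tau ->
  (forall z, C z -> bird (sp l) z.1 (tau z) = bird (sp r) z.2 (tau z)) ->
  exists G : set Omega,
  [/\ measurable G, P (~` G) = 0%E,
     measurable_fun G (fun w => card (void_pairs l r C (closer l tau) w) : \bar R) &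
     (\int[P]_(w in G) card (void_pairs l r C (closer l tau) w) =
     \int[m l \x m r]_(z in C)
       (expR (- (lam * pi * (meet_height l tau z) ^+ 2)))%:E)%E].
Proof.
move=> fA fB sep mC CAB mtau meet.
pose D i := C `&` seqDU (fun i => A i `*` B i) i.
have mAB i : measurable (A i `*` B i).
  by apply: measurableX; [case: (fA i)|case: (fB i)].
have mseq i : measurable (seqDU (fun i => A i `*` B i) i).
  by apply: measurableD => //; exact: bigsetU_measurable.
have mD i : measurable (D i) by exact: measurableI.
have DAB i : D i `<=` A i `*` B i by move=> z [_ []].
have tD : trivIset setT D by exact/trivIset_setIl/trivIset_seqDU.
have CD : C = \bigcup_i D i.
  by rewrite -setI_bigcupr -seqDU_bigcup_eq; apply/esym/setIidPl.
have hD i := disc_void_formula (fA i) (fB i) (@sep i) (mD i) (DAB i) mtau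
  (fun z (Dz : D i z) => meet z Dz.1).
have [G hG] := choice hD.
have [mG G0] : measurable (\bigcap_i G i) /\ P (~` \bigcap_i G i) = 0%E.
  by apply: conegligible_bigcap => i; case: (hG i).
have vE w : (card (void_pairs l r C (closer l tau) w) =
    \sum_(i <oo) card (void_pairs l r (D i) (closer l tau) w) :> \bar R)%E.
  rewrite -card_bigcup; last first.
    move=> i j _ _ [pq [[[_ [_ Di]] _] [[_ [_ Dj]] _]]].
    by apply: (tD i j) => //; exists (hd l pq.1, hd r pq.2).
  congr card; rewrite [X in void_pairs l r X _ _ = _]CD; apply/seteqP; split=> pq.
    by move=> [[Np [Nq [i _ Di]]] vw]; exists i.
  by move=> [i _ [[Np [Nq Di]] vw]]; split=> //; split=> //; split=> //; exists i.
exists (\bigcap_i G i); split=> //.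
  apply: (eq_measurable_fun (fun w =>
      \sum_(i <oo) card (void_pairs l r (D i) (closer l tau) w))%E).
    by move=> w _; exact/esym/vE.
  apply: ge0_emeasurable_sum => [k w _ _|k _]; first exact: card_ge0.
  have [mGk _ mf _ _] := hG k; apply: measurable_funS mf => //.
  by move=> w /(_ k); apply.
transitivity (\int[P]_(w in \bigcap_i G i)
    \sum_(i <oo) card (void_pairs l r (D i) (closer l tau) w))%E.
  by apply: eq_integral => w _; exact: vE.
rewrite integral_nneseries//; last 2 first.
- move=> k; have [mGk _ mf _ _] := hG k; apply: measurable_funS mf => //.
  by move=> w /(_ k); apply.
- by move=> k w _; exact: card_ge0.
rewrite [X in (\int[_]_(_ in X) _)%E]CD ge0_integral_bigcup//; last first.
  apply/measurable_fun_bigcup => // i.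
  by have [_ _ _ mM _] := hG i.
apply: eq_eseriesr => i _; have [mGi Gi0 mf mM <-] := hG i.
rewrite [RHS](ge0_negligible_integral (measurableC mG) mGi mf _ G0).
  congr (integral _ _ _); rewrite setDE setCK; apply/seteqP; split=> w.
    by move=> h; split=> //; exact: h.
  by move=> [].
by move=> w _; exact: card_ge0.
Qed.

End disc_void.

(** * Almost sure absence of coincidences *)

Section same_speed.
Context {R : realType}.
Variables (v : R) (v0 : 0 < v).

(* Meaningful only when the two head times differ. *)
Definition same_time (z : (R * R) * (R * R)) : R :=
  (z.1.1 + z.2.1) / 2 + (z.2.2 ^+ 2 - z.1.2 ^+ 2) / (2 * v ^+ 2 * (z.2.1 - z.1.1)).

Lemma bird_eqE (v' : R) (z z' : R * R) (t : R) :
  (bird v z t = bird v' z' t) <->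
  (v ^+ 2 * (t - z.1) ^+ 2 + z.2 ^+ 2 = v' ^+ 2 * (t - z'.1) ^+ 2 + z'.2 ^+ 2).
Proof.
have b0 (u : R) (x : R * R) : 0 <= u ^+ 2 * (t - x.1) ^+ 2 + x.2 ^+ 2.
  by apply: addr_ge0; [apply: mulr_ge0|]; exact: sqr_ge0.
split=> [/(congr1 (fun x => x ^+ 2))|h]; first by rewrite /bird !sqr_sqrtr.
by rewrite /bird h.
Qed.

(** With equal speeds the terms in [t ^+ 2] cancel and the equation is linear in [t], with a slope
    proportional to [z'.1 - z.1]. *)
Lemma same_meetP (z z' : R * R) (t : R) : z.1 != z'.1 ->
  (bird v z t = bird v z' t) <-> (t = same_time (z, z')).
Proof.
move=> zz; have d0 : z'.1 - z.1 != 0 by rewrite subr_eq0 eq_sym.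
have v0' : v != 0 by rewrite gt_eqF.
rewrite bird_eqE; rewrite /same_time/=; split=> h.
  apply: (mulfI (mulf_neq0 (mulf_neq0 (lt0r_neq0 (ltr0Sn R 1)) (expf_neq0 2 v0')) d0)).
  rewrite [RHS]mulrDr.
  have -> : 2 * v ^+ 2 * (z'.1 - z.1) * ((z'.2 ^+ 2 - z.2 ^+ 2) / (2 * v ^+ 2 * (z'.1 - z.1))) =
    z'.2 ^+ 2 - z.2 ^+ 2 by field; apply/andP.
  have -> : 2 * v ^+ 2 * (z'.1 - z.1) * ((z.1 + z'.1) / 2) = v ^+ 2 * (z'.1 ^+ 2 - z.1 ^+ 2).
    by field.
  have -> : z'.2 ^+ 2 - z.2 ^+ 2 = v ^+ 2 * (t - z.1) ^+ 2 - v ^+ 2 * (t - z'.1) ^+ 2 by lra.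
  by ring.
by rewrite h; field; apply/andP.
Qed.

Lemma measurable_same_time : measurable_fun setT same_time.
Proof.
have m11 : measurable_fun setT (fun z : (R * R) * (R * R) => z.1.1).
  exact: measurableT_comp measurable_fst measurable_fst.
have m12 : measurable_fun setT (fun z : (R * R) * (R * R) => z.1.2).
  exact: measurableT_comp measurable_snd measurable_fst.
have m21 : measurable_fun setT (fun z : (R * R) * (R * R) => z.2.1).
  exact: measurableT_comp measurable_fst measurable_snd.
have m22 : measurable_fun setT (fun z : (R * R) * (R * R) => z.2.2).
  exact: measurableT_comp measurable_snd measurable_snd.
apply: measurable_funD.
  by apply: measurable_funM => //; exact: measurable_funD.
apply: measurable_funM.
  by apply: measurable_funB; exact: measurable_funX.
apply: (measurableT_comp measurable_inv); apply: measurable_funM => //.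
exact: measurable_funB.
Qed.

End same_speed.

Lemma ereal_le_harmonic_eq0 (R : realType) (x : \bar R) (c : R) : (0 <= x)%E ->
  (forall n : nat, (x <= (c / n.+1%:R)%:E)%E) -> x = 0%E.
Proof.
move=> x0 h; apply/eqP; rewrite eq_le x0 andbT.
case: x x0 h => [x|_ /(_ 0%N)|//]; last by rewrite leye_eq.
rewrite !lee_fin => x0 h; rewrite leNgt; apply/negP => xp.
have := h (Num.truncn (c / x)); rewrite lee_fin ler_pdivlMr ?ltr0Sn// mulrC.
rewrite -ler_pdivlMr// leNgt truncnS_gt.
  by [].
Qed.

Section coincidences.
Context {R : realType} {d} {Omega : measurableType d}.
Variables (P : probability Omega R) (N : ty -> Omega -> set (pt R)).
Variables (lam1 lam2 v1 v2 : R).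
Hypotheses (lam10 : 0 < lam1) (lam20 : 0 < lam2) (v20 : 0 < v2) (v21 : v2 < v1).
Hypothesis PPP : two_type_PPP P N lam1 lam2.

Local Notation mu := (@lebesgue_measure R).
Local Notation X := (measurableTypeR R * measurableTypeR R)%type.
Local Notation hd := (@station_head R v1 v2).
Local Notation m := (head_intensity lam10 lam20 v20 v21).
Local Notation sp := (sp v1 v2).
Local Notation void := (@void R _ _ _ _ _ N hd).
Local Notation head_count := (@head_count R _ _ _ _ _ N hd).
Local Notation count_eq := (@count_eq R _ _ _ _ _ N hd).
Local Notation finite_count := (@finite_count R _ _ _ _ _ N hd).

Let law : poisson_law P N hd m. Proof. exact: head_poisson_law. Qed.
Let ind : poisson_indep P N hd m. Proof. exact: head_poisson_indep. Qed.
Let sp_pos k : 0 < sp k. Proof. exact: sp_gt0. Qed.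

(** The time interval is half-open so that consecutive slabs tile a strip without overlap. *)
Definition slab (a b h : R) : set X := `[a, b[%classic `*` `[0, h]%classic.

Lemma measurable_slab a b h : measurable (slab a b h).
Proof. by apply: measurableX; exact: measurable_itv. Qed.

Lemma head_mean_slab l a b h : a <= b -> 0 <= h ->
  m l (slab a b h) = ((b - a) * (2 * lm lam1 lam2 l * sp l * h))%:E.
Proof.
move=> ab h0; rewrite [LHS]product_measure1E; do ?exact: measurable_itv.
have hH : mu (`[0, h]%classic `&` half) = h%:E.
  rewrite (_ : _ `&` _ = `[0, h]%classic); last first.
    by apply/setIidPl => x /=; rewrite /half /= !in_itv/= andbT => /andP[].
  rewrite lebesgue_measure_itv/= lte_fin oppr0 adde0.
  by case: ltP => // h0'; congr EFin; apply/le_anti; rewrite h0.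
have hl : half_leb (head_rate lam10 lam20 v20 v21 l) `[0, h]%classic =
    (2 * lm lam1 lam2 l * sp l * h)%:E.
  transitivity ((2 * lm lam1 lam2 l * sp l)%:E * mu (`[0%R, h]%classic `&` half))%E.
    by [].
  by rewrite hH -EFinM.
have hT : mu `[a, b[%classic = (b - a)%:E.
  rewrite lebesgue_measure_itv/= lte_fin -EFinB; case: ltP => // ba.
  by congr EFin; apply/eqP; rewrite eq_sym subr_eq0 eq_le ab ba.
transitivity ((b - a)%:E * (2 * lm lam1 lam2 l * sp l * h)%:E)%E; last by rewrite -EFinM.
by congr (_ * _)%E.
Qed.

Lemma fm_slab l a b h : a <= b -> 0 <= h -> finite_mean m l (slab a b h).
Proof.
move=> ab h0; split; first exact: measurable_slab.
by rewrite head_mean_slab// ltry.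
Qed.

Lemma slab_box (L : R) (z : R * R) : `|z.1| < L -> 0 <= z.2 -> z.2 <= L -> slab (- L) L L z.
Proof.
rewrite ltr_norml => /andP[h1 h2] h3 h4; split; rewrite /= in_itv/= ?h3//.
by rewrite h2 ltW.
Qed.

Lemma prob_two_points l A : finite_mean m l A ->
  (P (~` (count_eq l A 0 `|` count_eq l A 1)) <= ((fine (m l A)) ^+ 2)%:E)%E.
Proof.
move=> fA; have m0 : measurable (count_eq l A 0) by exact: (measurable_ev law).
have m1 : measurable (count_eq l A 1) by exact: (measurable_ev law).
have mU : measurable (count_eq l A 0 `|` count_eq l A 1) by exact: measurableU.
have d01 : count_eq l A 0 `&` count_eq l A 1 = set0.
  rewrite -subset0 => w [/= e0 e1]; have : (0%:R%:E : \bar R) == 1%:R%:E.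
    by apply/eqP; rewrite -e0; exact: e1.
  by rewrite eqe eqr_nat.
have PU : P (count_eq l A 0 `|` count_eq l A 1) = (poisson_mass (fine (m l A)) 0 +
    poisson_mass (fine (m l A)) 1)%:E.
  transitivity (P (count_eq l A 0) + P (count_eq l A 1))%E; first exact: measureU.
  by rewrite EFinD; congr (_ + _)%E; exact: (prob_ev law).
rewrite probability_setC// PU -EFinB lee_fin opprD addrA.
exact/poisson_mass_ge2/fine_ge0/measure_ge0.
Qed.

Lemma two_points l A w p q : N l w p -> N l w q -> p <> q ->
  A (hd l p) -> A (hd l q) -> ~ (count_eq l A 0 `|` count_eq l A 1) w.
Proof.
move=> Np Nq pq Ap Aq.
have : (2%:R%:E <= head_count l A w)%E.
  have -> : (2%:R%:E : \bar R) = card [set p; q].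
    rewrite cardU; last by rewrite -subset0 => x [/= -> /pq].
    by rewrite /card !esum_set1// -EFinD.
  by apply: le_card => x [] ->.
move=> h [|] /= e; move: h; rewrite e lee_fin ler_nat//.
Qed.

(* Cut a bounded strip into [K] slabs: two heads share a slab with probability
   O(1/K). *)
Lemma distinct_head_times l : P.-negligible [set w | exists p q,
  [/\ N l w p, N l w q, p <> q & (hd l p).1 = (hd l q).1]].
Proof.
pose bad (n : nat) := [set w | exists p q,
  [/\ N l w p, N l w q, p <> q & (hd l p).1 = (hd l q).1 /\
    slab (- n.+1%:R) n.+1%:R n.+1%:R (hd l p) /\
    slab (- n.+1%:R) n.+1%:R n.+1%:R (hd l q)]].
apply: (@negligibleS _ _ _ P (\bigcup_n bad n)).
  move=> w [p [q [Np Nq pq pqT]]].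
  have [n hn] : exists n : nat, [/\ `|(hd l p).1| < n%:R, (hd l p).2 < n%:R & (hd l q).2 < n%:R].
    exists (Num.truncn (`|(hd l p).1| + (hd l p).2 + (hd l q).2)).+1.
    have := truncnS_gt (`|(hd l p).1| + (hd l p).2 + (hd l q).2).
    have := normr_ge0 (hd l p).1; have : 0 <= (hd l p).2 by exact: normr_ge0.
    have : 0 <= (hd l q).2 by exact: normr_ge0.
    move: (`|(hd l p).1|) ((hd l p).2) ((hd l q).2) => x y z z0 y0 x0 h; split; lra.
  exists n => //; exists p, q; split=> //; split=> //.
  have nS : n%:R <= n.+1%:R :> R by rewrite ler_nat.
  have p20 : 0 <= (hd l p).2 by exact: normr_ge0.
  have q20 : 0 <= (hd l q).2 by exact: normr_ge0.
  move: hn => [h1 h3 h4]; split; apply: slab_box => //; rewrite -?pqT.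
  - exact: lt_le_trans h1 nS.
  - exact/ltW/(lt_le_trans h3 nS).
  - exact: lt_le_trans h1 nS.
  - exact/ltW/(lt_le_trans h4 nS).
apply: negligible_bigcup => n.
set L : R := n.+1%:R; have L0 : 0 < L by rewrite ltr0n.
(* [K.+1] slabs of width [2 * L / K.+1%:R] tile the strip of head times from [- L] to [L]. *)
pose S (K i : nat) := slab (- L + i%:R * (2 * L / K.+1%:R)) (- L + i.+1%:R * (2 * L / K.+1%:R)) L.
have hK (K : nat) : 0 < 2 * L / K.+1%:R by rewrite divr_gt0 ?mulr_gt0.
have SE (K i : nat) : finite_mean m l (S K i) /\
    fine (m l (S K i)) = 2 * L / K.+1%:R * (2 * lm lam1 lam2 l * sp l * L).
  have ab : - L + i%:R * (2 * L / K.+1%:R) <= - L + i.+1%:R * (2 * L / K.+1%:R).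
    by rewrite lerD2l ler_pM2r// ler_nat.
  split; first by apply: fm_slab => //; exact: ltW.
  have -> : m l (S K i) = _ := head_mean_slab l ab (ltW L0).
  by rewrite [LHS]/= -[i.+1]addn1 natrD; ring.
pose E (K i : nat) := ~` (count_eq l (S K i) 0 `|` count_eq l (S K i) 1).
have mE K i : measurable (E K i).
  apply: measurableC; apply: measurableU; apply: (measurable_ev law);
    exact: (SE K i).1.
(* For each [K] the union bound adds [K.+1] probabilities of order [K.+1%:R ^- 2]. The bad event
   lies in the union for every [K], hence in this intersection, which is null. *)
pose Z := \bigcap_K \big[setU/set0]_(i < K.+1) E K i.
have mZ : measurable Z.
  by apply: bigcap_measurable => // K _; exact: bigsetU_measurable.
exists Z; split=> //.
  apply: (@ereal_le_harmonic_eq0 _ _ ((2 * L * (2 * lm lam1 lam2 l * sp l * L)) ^+ 2)) => // K.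
  apply: (@le_trans _ _ (P (\big[setU/set0]_(i < K.+1) E K i))).
    apply: le_measure; rewrite ?inE//; first exact: bigsetU_measurable.
    by move=> w; apply.
  apply: (le_trans (Boole_inequality _ _)); first by move=> i _; exact: mE.
  apply: (@le_trans _ _ (\sum_(i < K.+1) ((2 * L / K.+1%:R * (2 * lm lam1 lam2 l * sp l * L)) ^+ 2)%:E)%E).
    apply: lee_sum => i _; have [fS <-] := SE K i; exact: prob_two_points.
  rewrite sumEFin sumr_const card_ord lee_fin -[_ *+ K.+1]mulr_natl.
  have : K.+1%:R != 0 :> R by rewrite pnatr_eq0.
  move: (K.+1%:R : R) => x x0.
  by rewrite le_eqVlt; apply/orP; left; apply/eqP; field.
move=> w [p [q [Np Nq pq [pqT [[pT pH] [qT qH]]]]]] K _.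
have [p1 p2] : - L <= (hd l p).1 /\ (hd l p).1 < L.
  by move: pT; move: (hd l p).1 => y; rewrite /= in_itv/= -/L => /andP.
pose x := ((hd l p).1 + L) / (2 * L / K.+1%:R).
have x0 : 0 <= x by rewrite divr_ge0 ?(ltW (hK K))//; lra.
have xK : (Num.truncn x < K.+1)%N.
  rewrite truncn_lt_nat// ltr_pdivrMr// mulrCA mulfV ?mulr1 ?pnatr_eq0//; lra.
have Sx (y : R * R) : y.1 = (hd l p).1 -> `[0, L]%classic y.2 -> S K (Num.truncn x) y.
  move=> yE yH; split=> //=; rewrite in_itv/= yE.
  have := truncn_itv x0; rewrite /x ler_pdivlMr// ltr_pdivrMr// => /andP[h1 h2].
  by rewrite ![- L + _]addrC lerBlDr ltrBrDr h1 h2.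
rewrite -bigcup_mkord; exists (Num.truncn x) => //.
by apply: (two_points Np Nq pq); apply: Sx => //; exact/esym.
Qed.

End coincidences.

(** * No three birds through one point *)

Section triple.
Context {R : realType} {d} {Omega : measurableType d}.
Variables (P : probability Omega R) (N : ty -> Omega -> set (pt R)).
Variables (lam1 lam2 v1 v2 : R).
Hypotheses (lam10 : 0 < lam1) (lam20 : 0 < lam2) (v20 : 0 < v2) (v21 : v2 < v1).
Hypothesis PPP : two_type_PPP P N lam1 lam2.

Local Notation mu := (@lebesgue_measure R).
Local Notation X := (measurableTypeR R * measurableTypeR R)%type.
Local Notation hd := (@station_head R v1 v2).
Local Notation m := (head_intensity lam10 lam20 v20 v21).
Local Notation sp := (sp v1 v2).
Local Notation void := (@void R _ _ _ _ _ N hd).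
Local Notation head_count := (@head_count R _ _ _ _ _ N hd).
Local Notation count_eq := (@count_eq R _ _ _ _ _ N hd).
Local Notation finite_count := (@finite_count R _ _ _ _ _ N hd).

Let law : poisson_law P N hd m. Proof. exact: head_poisson_law. Qed.
Let ind : poisson_indep P N hd m. Proof. exact: head_poisson_indep. Qed.
Let sp_pos k : 0 < sp k. Proof. exact: sp_gt0. Qed.

Definition annulus (v t r e : R) : set X := [set u | `|bird v u t - r| <= e].

Lemma measurable_annulus v t r e : measurable (annulus v t r e).
Proof.
have mb : measurable_fun setT (fun u : X => `|bird v u t - r|).
  apply: measurableT_comp => //; apply: measurable_funB => //; exact: measurable_bird.
rewrite (_ : annulus v t r e = setT `&` (fun u : X => `|bird v u t - r|) @^-1` `]-oo, e]).
  by apply: mb => //; exact: measurable_itv.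
by rewrite setTI; apply/seteqP; split=> u /=; rewrite in_itv.
Qed.

(** The annulus is closed and discs are open, so the outer disc has radius [r + 2 * e]. If [r - e]
    is positive the squared radii differ by [6 * r * e + 3 * e ^+ 2]; otherwise the inner disc is
    empty and [r ^+ 2 <= r * e] gives the bound. *)
Lemma mean_annulus l t r e : 0 <= r -> 0 < e ->
  (m l (annulus (sp l) t r e) <= (lm lam1 lam2 l * pi * (6 * r * e + 4 * e ^+ 2))%:E)%E.
Proof.
move=> r0 e0.
have sub : annulus (sp l) t r e `<=` disc (sp l) t (r + 2 * e) `\` disc (sp l) t (r - e).
  move=> u; rewrite /annulus /disc /= ler_norml => /andP[h1 h2].
  split; first by lra.
  by apply/negP; rewrite -leNgt; lra.
have mE s : m l (disc (sp l) t s) = (lm lam1 lam2 l * pi * (Num.max s 0) ^+ 2)%:E.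
  rewrite [LHS]head_mean_disc ?sp_pos//=; congr EFin.
  by field; rewrite gt_eqF.
have md s : measurable (disc (sp l) t s : set X) by exact: measurable_disc.
apply: (@le_trans _ _ (m l (disc (sp l) t (r + 2 * e) `\` disc (sp l) t (r - e)))).
  apply: le_measure => //; rewrite inE; first exact: measurable_annulus.
  exact: measurableD.
have dsub : disc (sp l) t (r - e) `<=` disc (sp l) t (r + 2 * e).
  by rewrite /disc => u /=; lra.
have -> : (m l (disc (sp l) t (r + 2 * e) `\` disc (sp l) t (r - e)) =
    m l (disc (sp l) t (r + 2 * e)) - m l (disc (sp l) t (r - e)))%E.
  rewrite [LHS](measureD (md _) (md _)); last by rewrite [X in (X < _)%E]mE ltry.
  by congr (_ - _)%E; rewrite (setIidr dsub).
rewrite !mE -EFinB lee_fin -mulrBr.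
apply: ler_wpM2l; first by rewrite mulr_ge0 ?pi_ge0// ltW// lm_gt0.
rewrite [Num.max (r + _) _]max_l; last by lra.
have [re|re] := leP (r - e) 0; nra.
Qed.

Section piece.
Variables (l k : ty) (A B D : set X).
Hypotheses (fA : finite_mean m l A) (fB : finite_mean m l B) (fD : finite_mean m k D).
(** Separation in time makes [A] and [B] disjoint and makes any two birds taken from them meet
    exactly once, at [same_time]. *)
Hypothesis AB : forall z z', A z -> B z' -> z.1 < z'.1.
Hypotheses (DA : k = l -> D `&` A = set0) (DB : k = l -> D `&` B = set0).

Let tau := same_time (sp l).
Let rho := meet_height v1 v2 l tau.
Let idx n (z : X * X) := cells n (tau z) (rho z).
Let near_set n (a b : int) : set X :=
  D `&` annulus (sp k) (a%:~R * step n) (b%:~R * step n) ((v1 + 1) * step n).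
Let W n j (k' : ty) : set X :=
  [set u | k' = k /\ near_set n (uncells j).1 (uncells j).2 u].
(** Voidness of this region says that no bird with head in [D] passes through the meeting point. The
    approximating annuli contain this limit, whereas the discs above were contained in theirs. *)
Let Wl z (k' : ty) : set X := [set u | k' = k /\ D u /\ bird (sp k) u (tau z) = rho z].

Let v10 : 0 < v1. Proof. exact: lt_trans v21. Qed.

Let cell_dist n (x : R) : `|x - (cell n x)%:~R * step n| <= step n.
Proof.
rewrite ger0_norm ?subr_ge0 ?cell_le// lerBlDl.
by apply/ltW; exact: cell_gt.
Qed.

Let bird_cell n z u : `|bird (sp k) u ((cell n (tau z))%:~R * step n) -
  bird (sp k) u (tau z)| <= v1 * step n.
Proof.
apply: (le_trans (bird_dist _ _ _ (sp_pos k))); rewrite distrC.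
by apply: ler_pM => //; [exact/ltW/sp_pos|exact: sp_le].
Qed.

(** The thickness [(v1 + 1) * step n] absorbs the rounding of the time, through the Lipschitz bound,
    and of the height. *)
Let Wl_sub n z k' : Wl z k' `<=` W n (idx n z) k'.
Proof.
move=> u [-> [Du ue]]; split=> //; split=> //; rewrite /idx cellsK; change
  (`|bird (sp k) u ((cell n (tau z))%:~R * step n) - (cell n (rho z))%:~R * step n| <= (v1 + 1) * step n).
have := bird_cell n z u; rewrite ue; have := cell_dist n (rho z).
rewrite !ler_norml => /andP[h1 h2] /andP[h3 h4]; apply/andP; split; lra.
Qed.

Let W_sub n z : near_set n (uncells (idx n z)).1 (uncells (idx n z)).2 `<=`
  annulus (sp k) (tau z) (rho z) ((2 * v1 + 2) * step n).
Proof.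
move=> u [_]; rewrite /idx cellsK; change
  (`|bird (sp k) u ((cell n (tau z))%:~R * step n) - (cell n (rho z))%:~R * step n| <=
   (v1 + 1) * step n -> `|bird (sp k) u (tau z) - rho z| <= (2 * v1 + 2) * step n).
have := bird_cell n z u; have := cell_dist n (rho z).
rewrite !ler_norml => /andP[h1 h2] /andP[h3 h4] /andP[h5 h6]; apply/andP; split; lra.
Qed.

Let fnear n a b : finite_mean m k (near_set n a b).
Proof. by apply: fmI => //; exact: measurable_annulus. Qed.

Let WE n j k' : W n j k' = near_set n (uncells j).1 (uncells j).2 /\ k' = k \/
  W n j k' = set0 /\ k' <> k.
Proof.
have [->|kk] := pselect (k' = k); [left|right]; split=> //.
  by apply/seteqP; split=> u; [case|].
by rewrite -subset0 => u [].
Qed.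

Let fW n j k' : finite_mean m k' (W n j k').
Proof.
by have [[-> ->]|[-> _]] := WE n j k'; [exact: fnear|exact: fm0].
Qed.

Let cvgM z : mean_void m (W n (idx n z)) @[n --> \oo] --> 0.
Proof.
pose K := lm lam1 lam2 ty1 * pi + lm lam1 lam2 ty2 * pi.
pose f n := 6 * rho z * ((2 * v1 + 2) * step n) + 4 * ((2 * v1 + 2) * step n) ^+ 2.
have rho0 : 0 <= rho z by exact: bird_ge0.
have e0 n : 0 < (2 * v1 + 2) * step n.
  by rewrite mulr_gt0 ?step_gt0//; have := v10; lra.
have f0 n : 0 <= f n.
  by rewrite /f; have := e0 n; move: (_ * step n) rho0 => e; nra.
apply: (@squeeze_cvgr _ _ _ _ (fun=> 0) (fun n => K * f n)); last 2 first.
- exact: cvg_cst.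
- have ce : (2 * v1 + 2) * step n @[n --> \oo] --> (0 : R).
    by rewrite -(mulr0 (2 * v1 + 2)); apply: cvgMr; exact: cvg_step.
  rewrite -(mulr0 K); apply: cvgMr.
  have -> : (0 : R) = 6 * rho z * 0 + 4 * (0 * 0) by ring.
  by apply: cvgD; apply: cvgMr => //; exact: cvgM.
apply: nearW => n; rewrite mean_void_ge0/=.
have bnd k' : fine (m k' (W n (idx n z) k')) <= lm lam1 lam2 k' * pi * f n.
  have [[-> ->]|[-> _]] := WE n (idx n z) k'; last first.
    rewrite measure0; apply: mulr_ge0 => //.
    by rewrite mulr_ge0 ?pi_ge0// ltW// lm_gt0.
  rewrite -lee_fin fineK; last first.
    by rewrite ge0_fin_numE//; case: (fnear n (uncells (idx n z)).1 (uncells (idx n z)).2).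
  apply: le_trans (mean_annulus k (tau z) rho0 (e0 n)).
  apply: le_measure; last exact: W_sub; rewrite inE; last exact: measurable_annulus.
  by case: (fnear n (uncells (idx n z)).1 (uncells (idx n z)).2).
by rewrite /mean_void /K mulrDl; apply: lerD.
Qed.

(* A third bird through the meeting point is a bird in an annulus of vanishing
   mean measure, so the pairs avoiding it have the same mean as all pairs. *)
Lemma negligible_triple_piece : P.-negligible [set w | exists p q s t,
  [/\ N l w p, N l w q & N k w s] /\
  [/\ A (hd l p), B (hd l q), D (hd k s),
     bird (sp l) (hd l p) t = bird (sp l) (hd l q) t &
     bird (sp l) (hd l p) t = bird (sp k) (hd k s) t]].
Proof.
have sep : l = l -> A `&` B = set0.
  by move=> _; rewrite -subset0 => z [/AB h /h]; rewrite ltxx.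
have mAB : measurable (A `*` B).
  by apply: measurableX; [case: fA|case: fB].
have midx n j : measurable (idx n @^-1` [set j]).
  apply: measurable_cells; first exact: measurable_same_time.
  by apply: measurable_meet_height; exact: measurable_same_time.
have avoid n z : (A `*` B) z -> ~ W n (idx n z) l z.1 /\ ~ W n (idx n z) l z.2.
  move=> [Az Bz]; split=> -[lk [Dz _]].
    by move: (DA (esym lk)); rewrite -subset0 => /(_ z.1); apply.
  by move: (DB (esym lk)); rewrite -subset0 => /(_ z.2); apply.
have mH : measurable (finite_count k D) by exact: (measurable_fin law).
have H0 : P (~` finite_count k D) = 0%E.
  by apply: conegligible1 => //; exact: (prob_fin law).
(* If no bird from [D] hits the meeting point, then each of the finitely many birds from [D] misses
   it by a positive distance, and all of them leave the annulus once it is thin enough. This is the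
   place where finiteness of the count in [D] is used. *)
have conv w z : finite_count k D w -> (A `*` B) z ->
    \forall n \near \oo, void (W n (idx n z)) w <-> void (Wl z) w.
  move=> wD _; have [vz|nvz] := pselect (void (Wl z) w); last first.
    apply: nearW => n; split=> // vW; exfalso; apply: nvz; apply/void_cnt => k' p Np /(@Wl_sub n).
    by move/void_cnt : vW; apply.
  have /card_fin/finite_fsetP[F FE] := wD.
  have : \forall n \near \oo, forall p, p \in F ->
      ~ near_set n (uncells (idx n z)).1 (uncells (idx n z)).2 (hd k p).
    have := @filter_bigI _ _ F (fun p => [set n |
      ~ near_set n (uncells (idx n z)).1 (uncells (idx n z)).2 (hd k p)]) \oo _.
    move=> /(_ _)[].
      move=> p pF; have : [set` F] p by [].
      rewrite -FE => -[Np Dp].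
      have d0 : 0 < `|bird (sp k) (hd k p) (tau z) - rho z|.
        rewrite normr_gt0 subr_eq0; apply/eqP => e.
        by move/void_cnt : vz => /(_ k p Np); apply.
      have c0 : 0 < 2 * v1 + 2 by have := v10; lra.
      move/cvgrPdist_lt: (@cvg_step R) => /(_ _ (divr_gt0 d0 c0)).
      apply: filterS => n; rewrite sub0r normrN (ger0_norm (ltW (step_gt0 n))) => h.
      move/W_sub; rewrite /annulus/= leNgt mulrC => /negP; apply.
      by rewrite -ltr_pdivlMr.
    by move=> n0 _ h; exists n0 => // n /h.
  apply: filterS => n Hn; split=> // _; apply/void_cnt => k' p Np [kk nr].
  move: Np nr; rewrite kk => Np nr; apply: (Hn p) => //.
  have : [set` F] p by rewrite -FE; split=> //; case: nr.
  by [].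
have := void_formula_null law ind fA fB sep mAB (fun z h => h) midx fW avoid
  (fun z _ => @cvgM z) mH H0 conv (fun z _ => erefl).
apply: negligibleS => w [p [q [s [t [[Np Nq Ns] [Ap Bq Ds e1 e2]]]]]].
exists (p, q); first by split=> //; split.
have pq : (hd l p).1 != (hd l q).1 by rewrite lt_eqF// AB.
have tE : t = tau (hd l p, hd l q).
  by apply/(same_meetP (sp_pos l) _ pq).
move/void_cnt/(_ k s Ns); apply; split=> //; split=> //.
by rewrite -tE -e2 /rho /meet_height -tE.
Qed.

End piece.
End triple.

Lemma cell_le_mono (R : realType) n (x y : R) : x <= y -> (cell n x <= cell n y)%R.
Proof. by move=> xy; rewrite /cell; apply: le_floor; rewrite ler_pM2l ?exprn_gt0. Qed.

Lemma cell_neq (R : realType) n (x y : R) : step n <= `|x - y| -> cell n x <> cell n y.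
Proof.
move=> xy e; move: xy; apply/negP; rewrite -ltNge ltr_norml.
have := cell_le n x; have := cell_gt n x; have := cell_le n y; have := cell_gt n y.
rewrite e; move: (_%:~R * step n) => c h1 h2 h3 h4; apply/andP; split; lra.
Qed.

Section regular.
Context {R : realType} {d} {Omega : measurableType d}.
Variables (P : probability Omega R) (N : ty -> Omega -> set (pt R)).
Variables (lam1 lam2 v1 v2 : R).
Hypotheses (lam10 : 0 < lam1) (lam20 : 0 < lam2) (v20 : 0 < v2) (v21 : v2 < v1).
Hypothesis PPP : two_type_PPP P N lam1 lam2.

Local Notation X := (measurableTypeR R * measurableTypeR R)%type.
Local Notation hd := (@station_head R v1 v2).
Local Notation m := (head_intensity lam10 lam20 v20 v21).
Local Notation sp := (sp v1 v2).

(** Among three birds of two types, two share a type; these are [p] and [q]. The third may be of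
    either type. *)
Definition triple l k w := exists p q s t,
  [/\ N l w p, N l w q & N k w s] /\ [/\ p <> q, (k = l -> s <> p /\ s <> q),
     bird (sp l) (hd l p) t = bird (sp l) (hd l q) t &
     bird (sp l) (hd l p) t = bird (sp k) (hd k s) t].

Definition box (n K : nat) (i : int) : set X := slab (i%:~R * step n) (i%:~R * step n + step n) K%:R.

Lemma fm_box l n K i : finite_mean m l (box n K i).
Proof. by apply: fm_slab => //; rewrite lerDl ltW// step_gt0. Qed.

Lemma box_cell n K (z : R * R) : 0 <= z.2 -> z.2 <= K%:R -> box n K (cell n z.1) z.
Proof.
by move=> z0 zK; split; rewrite /= in_itv/=; [rewrite cell_le cell_gt|rewrite z0].
Qed.

Lemma box_lt n K i j (z z' : R * R) : (i < j)%R -> box n K i z -> box n K j z' -> z.1 < z'.1.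
Proof.
move=> ij [+ _] [+ _]; rewrite /= !in_itv/= => /andP[_ h1] /andP[h2 _].
apply: (lt_le_trans h1); apply: le_trans h2; rewrite -{2}[step n]mul1r -mulrDl.
by rewrite ler_pM2r ?step_gt0// -[1]/(1%:~R) -intrD ler_int lezD1.
Qed.

Lemma box_disj n K i j : i <> j -> box n K i `&` box n K j = set0.
Proof.
move=> /eqP ij; rewrite -subset0 => z [zi zj]; have := ij.
rewrite neq_lt => /orP[h|h]; first by have := box_lt h zi zj; rewrite ltxx.
by have := box_lt h zj zi; rewrite ltxx.
Qed.

(** Almost surely heads of equal type have distinct head times, so at a fine enough dyadic scale
    they lie in different boxes. There are countably many choices of boxes, and each choice is
    covered by [negligible_triple_piece]. *)
Lemma negligible_triple l k : P.-negligible [set w | triple l k w].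
Proof.
pose bad (e : nat * nat * (int * int * int)) := let: (n, K, (i, j, h)) := e in
  [set w | ((i < j)%R /\ (k = l -> h <> i /\ h <> j)) /\ exists p q s t,
  [/\ N l w p, N l w q & N k w s] /\
  [/\ box n K i (hd l p), box n K j (hd l q), box n K h (hd k s),
     bird (sp l) (hd l p) t = bird (sp l) (hd l q) t &
     bird (sp l) (hd l p) t = bird (sp k) (hd k s) t]].
apply: (@negligibleS _ _ _ P ([set w | exists p q,
  [/\ N l w p, N l w q, p <> q & (hd l p).1 = (hd l q).1]] `|` \bigcup_e bad e)); last first.
  apply: negligibleU; first exact: (distinct_head_times lam10 lam20 v20 v21 PPP).
  apply: negligible_bigcup_count => -[[n K] [[i j] h]] /=.
  have [[ij hij]|nc] := pselect ((i < j)%R /\ (k = l -> h <> i /\ h <> j)); last first.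
    by apply: negligibleS (negligible_set0 _) => w [].
  have := @negligible_triple_piece _ _ _ P N _ _ _ _ lam10 lam20 v20 v21 PPP l k _ _ _
    (fm_box l n K i) (fm_box l n K j) (fm_box k n K h).
  move=> /(_ _ _ _)[z z'|/hij[hi _]|/hij[_ hj]|Z hZ].
  - exact: box_lt.
  - exact: box_disj.
  - exact: box_disj.
  - by exists Z; case: hZ => ? ? sub; split=> // w [_ /sub].
move=> w [p0 [q0 [s [t [[Np0 Nq0 Ns] [pq0 spq0 e1 e2]]]]]].
have [dt|ndt] := pselect (exists p q,
  [/\ N l w p, N l w q, p <> q & (hd l p).1 = (hd l q).1]); [by left|right].
have dist p q : N l w p -> N l w q -> p <> q -> (hd l p).1 != (hd l q).1.
  by move=> Np Nq pq; apply/eqP => e; apply: ndt; exists p, q.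
(* The configuration is symmetric in the two stations of type [l], so they may be ordered by head
   time. *)
have [p [q [[Np Nq] [pq spq] [e1' e2'] pqT]]] : exists p q,
  [/\ N l w p /\ N l w q, p <> q /\ (k = l -> s <> p /\ s <> q),
    bird (sp l) (hd l p) t = bird (sp l) (hd l q) t /\
    bird (sp l) (hd l p) t = bird (sp k) (hd k s) t & (hd l p).1 < (hd l q).1].
  have := dist _ _ Np0 Nq0 pq0; rewrite neq_lt => /orP[h|h]; first by exists p0, q0.
  exists q0, p0; split=> //; last by rewrite -e2 -e1.
  by split; [exact: nesym|move=> /spq0[]].
have [n hn] : exists n, [/\ step n <= `|(hd l p).1 - (hd l q).1|,
    k = l -> step n <= `|(hd k s).1 - (hd l p).1| & k = l -> step n <= `|(hd k s).1 - (hd l q).1|].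
  have small (x : R) : 0 < x -> \forall n \near \oo, step n <= x.
    move=> x0; move/cvgrPdist_le: (@cvg_step R) => /(_ _ x0).
    by apply: filterS => n; rewrite sub0r normrN (ger0_norm (ltW (step_gt0 n))).
  have smallk p' : N l w p' -> (k = l -> s <> p') ->
      \forall n \near \oo, k = l -> step n <= `|(hd k s).1 - (hd l p').1|.
    move=> Np' sp'; have [kl|kl] := pselect (k = l); last by apply: nearW => n /kl.
    have : 0 < `|(hd k s).1 - (hd l p').1|.
      rewrite normr_gt0 subr_eq0; move: Ns sp'; rewrite kl => Ns sp'.
      by apply: dist => //; exact: sp'.
    by move/small; apply: filterS.
  have h1 : \forall n \near \oo, step n <= `|(hd l p).1 - (hd l q).1|.
    by apply: small; rewrite normr_gt0 subr_eq0 lt_eqF.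
  have h2 := smallk p Np (fun e => (spq e).1); have h3 := smallk q Nq (fun e => (spq e).2).
  near \oo => n; exists n; split; near: n => //.
pose K := (Num.truncn ((hd l p).2 + (hd l q).2 + (hd k s).2)).+1.
have hK := truncnS_gt ((hd l p).2 + (hd l q).2 + (hd k s).2).
have p0' : 0 <= (hd l p).2 by exact: normr_ge0.
have q0' : 0 <= (hd l q).2 by exact: normr_ge0.
have s0 : 0 <= (hd k s).2 by exact: normr_ge0.
have [hp [hq hs]] : (hd l p).2 <= K%:R /\ (hd l q).2 <= K%:R /\ (hd k s).2 <= K%:R.
  move: hK p0' q0' s0; rewrite -/K.
  move: ((hd l p).2) ((hd l q).2) ((hd k s).2) (K%:R : R) => x y z L h x0 y0 z0.
  by split; [|split]; lra.
have [hn1 hn2 hn3] := hn.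
exists (n, K, (cell n (hd l p).1, cell n (hd l q).1, cell n (hd k s).1)) => //=; split.
  split; first by rewrite lt_neqAle cell_le_mono ?ltW// andbT; apply/eqP/cell_neq.
  by move=> kl; split; apply: cell_neq; [exact: hn2|exact: hn3].
by exists p, q, s, t; split=> //; split=> //; exact: box_cell.
Unshelve. all: by end_near. Qed.

Definition regular (w : Omega) : Prop :=
  (forall l p q, N l w p -> N l w q -> (hd l p).1 = (hd l q).1 -> p = q) /\
  (forall l k, ~ triple l k w).

Lemma regular_ae : exists G, [/\ measurable G, P (~` G) = 0%E & G `<=` regular].
Proof.
pose T l := [set w | exists p q, [/\ N l w p, N l w q, p <> q & (hd l p).1 = (hd l q).1]].
have : P.-negligible ((T ty1 `|` T ty2) `|` (([set w | triple ty1 ty1 w] `|`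
    [set w | triple ty1 ty2 w]) `|` ([set w | triple ty2 ty1 w] `|` [set w | triple ty2 ty2 w]))).
  by repeat apply: negligibleU;
    do ?[exact: negligible_triple|exact: (distinct_head_times lam10 lam20 v20 v21 PPP)].
move=> [Z [mZ Z0 sub]]; exists (~` Z); split; [exact: measurableC|by rewrite setCK|].
move=> w nZ; split=> [l p q Np Nq pqT|l k tr].
  apply: contrapT => pq; apply: nZ; apply: sub; left.
  by case: l Np Nq pqT => Np Nq pqT; [left|right]; exists p, q.
apply: nZ; apply: sub; right.
by case: l k tr => -[] tr; [left; left|left; right|right; left|right; right].
Qed.

End regular.

(** * Handovers as pairs of heads *)

Section comparison.
Context {d} {T : measurableType d} {R : realType}.
Variables f g : T -> R.
Hypotheses (mf : measurable_fun setT f) (mg : measurable_fun setT g).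

Lemma measurable_set_le : measurable [set x | f x <= g x].
Proof.
rewrite (_ : [set _ | _] = setT `&` (fun x => g x - f x) @^-1` `[0, +oo[).
  by apply: measurable_funB => //; exact: measurable_itv.
by rewrite setTI; apply/seteqP; split=> x /=; rewrite in_itv/= andbT subr_ge0.
Qed.

Lemma measurable_set_lt : measurable [set x | f x < g x].
Proof.
rewrite (_ : [set _ | _] = setT `&` (fun x => g x - f x) @^-1` `]0, +oo[).
  by apply: measurable_funB => //; exact: measurable_itv.
by rewrite setTI; apply/seteqP; split=> x /=; rewrite in_itv/= andbT subr_gt0.
Qed.

End comparison.

(** * Meetings of two birds of different speeds *)

Section mixed_geometry.
Context {R : realType}.
Variables (v1 v2 : R).
Hypotheses (v20 : 0 < v2) (v21 : v2 < v1).
Implicit Types z : (R * R) * (R * R).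

Definition discr (t h1 h2 : R) : R :=
  v1 ^+ 2 * v2 ^+ 2 * t ^+ 2 - (h1 ^+ 2 - h2 ^+ 2) * (v1 ^+ 2 - v2 ^+ 2).

Definition pair_discr z : R := discr (z.1.1 - z.2.1) z.1.2 z.2.2.

(** The delay from the head of the faster bird to a meeting, when that head comes [t] after the
    slower one. It is a root of a quadratic equation, and the sign [(-1) ^+ k] selects the smaller
    root for [k = 1] and the larger for [k = 2]. *)
Definition mixed_offset (k : nat) (t h1 h2 : R) : R :=
  (v2 ^+ 2 * t + (-1) ^+ k * Num.sqrt (discr t h1 h2)) / (v1 ^+ 2 - v2 ^+ 2).

Definition mixed_time (k : nat) z : R :=
  z.1.1 + mixed_offset k (z.1.1 - z.2.1) z.1.2 z.2.2.

Lemma dv_gt0 : 0 < v1 ^+ 2 - v2 ^+ 2.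
Proof. by have := v20; have := v21; nra. Qed.

Lemma mixed_offset1 t h1 h2 : mixed_offset 1 t h1 h2 =
  (v2 ^+ 2 * t - Num.sqrt (discr t h1 h2)) / (v1 ^+ 2 - v2 ^+ 2).
Proof. by rewrite /mixed_offset expr1 mulN1r. Qed.

Lemma mixed_offset2 t h1 h2 : mixed_offset 2 t h1 h2 =
  (v2 ^+ 2 * t + Num.sqrt (discr t h1 h2)) / (v1 ^+ 2 - v2 ^+ 2).
Proof. by rewrite /mixed_offset sqrrN expr1n mul1r. Qed.

(** Completing the square: with [u] the delay and [D = v1 ^+ 2 - v2 ^+ 2], [D] times the difference
    of the squared heights equals [(D * u - v2 ^+ 2 * t) ^+ 2 - discr t h1 h2]. *)
Lemma mixed_meetP z s : (bird v1 z.1 s = bird v2 z.2 s) <->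
  0 <= pair_discr z /\ (s = mixed_time 1 z \/ s = mixed_time 2 z).
Proof.
have D0 := dv_gt0; have Dn : v1 ^+ 2 - v2 ^+ 2 != 0 by rewrite gt_eqF.
rewrite bird_eqE /mixed_time mixed_offset1 mixed_offset2 /pair_discr.
set t := z.1.1 - z.2.1; set h1 := z.1.2; set h2 := z.2.2.
set D := v1 ^+ 2 - v2 ^+ 2 in D0 Dn *.
set u := s - z.1.1; have uE : s - z.2.1 = u + t by rewrite /u /t; ring.
rewrite uE.
have key : (v1 ^+ 2 * u ^+ 2 + h1 ^+ 2 = v2 ^+ 2 * (u + t) ^+ 2 + h2 ^+ 2) <->
    (D * u - v2 ^+ 2 * t) ^+ 2 = discr t h1 h2.
  have -> : (D * u - v2 ^+ 2 * t) ^+ 2 = D * (v1 ^+ 2 * u ^+ 2 + h1 ^+ 2 -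
    (v2 ^+ 2 * (u + t) ^+ 2 + h2 ^+ 2)) + discr t h1 h2 by rewrite /discr /D; ring.
  split=> [->|h]; first by rewrite subrr mulr0 add0r.
  have : D * (v1 ^+ 2 * u ^+ 2 + h1 ^+ 2 - (v2 ^+ 2 * (u + t) ^+ 2 + h2 ^+ 2)) == 0.
    by apply/eqP; lra.
  by rewrite mulf_eq0 (negbTE Dn)/= subr_eq0 => /eqP.
have root (y : R) : (s = z.1.1 + (v2 ^+ 2 * t + y) / D) <-> (D * u - v2 ^+ 2 * t = y).
  rewrite /u; split=> [->|<-]; first by field.
  by field.
rewrite key; split=> [e|[d0 [|]]].
- have d0 : 0 <= discr t h1 h2 by rewrite -e sqr_ge0.
  split=> //; have : (D * u - v2 ^+ 2 * t) ^+ 2 == (Num.sqrt (discr t h1 h2)) ^+ 2.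
    by rewrite sqr_sqrtr// e.
  rewrite eqf_sqr => /orP[/eqP h|/eqP h]; last by left; apply/root.
  by right; apply/root.
- by move/root => ->; rewrite sqrrN sqr_sqrtr.
- by move/root => ->; rewrite sqr_sqrtr.
Qed.

Lemma mixed_time_le z : mixed_time 1 z <= mixed_time 2 z.
Proof.
rewrite /mixed_time mixed_offset1 mixed_offset2 lerD2l.
rewrite ler_pM2r ?invr_gt0 ?dv_gt0// lerD2l.
by have := sqrtr_ge0 (discr (z.1.1 - z.2.1) z.1.2 z.2.2); lra.
Qed.

Lemma mixed_time_lt z : (mixed_time 1 z < mixed_time 2 z) = (0 < pair_discr z).
Proof.
rewrite /mixed_time mixed_offset1 mixed_offset2 ltrD2l.
rewrite ltr_pM2r ?invr_gt0 ?dv_gt0// ltrD2l -subr_gt0 opprK -mulr2n pmulrn_lgt0//.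
by rewrite sqrtr_gt0.
Qed.

Lemma measurable_pair_discr : measurable_fun setT pair_discr.
Proof.
have m11 : measurable_fun setT (fun z => z.1.1).
  exact: measurableT_comp measurable_fst measurable_fst.
have m12 : measurable_fun setT (fun z => z.1.2).
  exact: measurableT_comp measurable_snd measurable_fst.
have m21 : measurable_fun setT (fun z => z.2.1).
  exact: measurableT_comp measurable_fst measurable_snd.
have m22 : measurable_fun setT (fun z => z.2.2).
  exact: measurableT_comp measurable_snd measurable_snd.
apply: measurable_funB; apply: measurable_funM => //.
  by apply: measurable_funX; exact: measurable_funB.
by apply: measurable_funB; exact: measurable_funX.
Qed.

Lemma measurable_mixed_time k : measurable_fun setT (mixed_time k).
Proof.
have m11 : measurable_fun setT (fun z => z.1.1).
  exact: measurableT_comp measurable_fst measurable_fst.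
have m21 : measurable_fun setT (fun z => z.2.1).
  exact: measurableT_comp measurable_fst measurable_snd.
apply: measurable_funD => //; apply: measurable_funM => //.
apply: measurable_funD; apply: measurable_funM => //.
  exact: measurable_funB.
apply: (measurableT_comp measurable_sqrtr); exact: measurable_pair_discr.
Qed.

Lemma bird_mixed_time k z : (bird v1 z.1 (mixed_time k z)) ^+ 2 =
  hhat2 v1 v2 k (z.1.1 - z.2.1) z.1.2 z.2.2.
Proof.
rewrite /bird sqr_sqrtr; last by apply: addr_ge0; [apply: mulr_ge0|]; exact: sqr_ge0.
by rewrite /mixed_time addrAC subrr add0r.
Qed.

End mixed_geometry.

Section handovers.
Context {R : realType} {d} {Omega : measurableType d}.
Variables (N : ty -> Omega -> set (pt R)) (v1 v2 : R).
Hypotheses (v20 : 0 < v2) (v21 : v2 < v1).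

Local Notation X := (measurableTypeR R * measurableTypeR R)%type.
Local Notation hd := (@station_head R v1 v2).
Local Notation sp := (sp v1 v2).
Local Notation void := (@void R _ _ _ _ _ N hd).
Local Notation void_pairs := (@void_pairs R _ _ _ _ _ N hd).
Local Notation closer := (closer v1 v2).
Local Notation nearest := (nearest N v1 v2).
Local Notation hdp := (hdp hd).

Let sp_pos k : 0 < sp k. Proof. exact: sp_gt0. Qed.

Lemma sdist_bird k p t : sdist v1 v2 (k, p) t = bird (sp k) (hd k p) t.
Proof. by rewrite /sdist/= pdist_head// gt_eqF// sp_pos. Qed.

Lemma head_timeP k p T : is_head_time v1 v2 (k, p) T <-> T = (hd k p).1.
Proof.
have bT : bird (sp k) (hd k p) (hd k p).1 = (hd k p).2.
  rewrite /bird subrr expr0n/= mulr0 add0r sqrtr_sqr.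
  by rewrite ger0_norm// normr_ge0.
split=> [/(_ (hd k p).1)|-> t]; rewrite !sdist_bird bT; last first.
  rewrite /bird -{1}(ger0_norm (normr_ge0 _ : 0 <= (hd k p).2)) -sqrtr_sqr ler_wsqrtr//.
  by rewrite lerDr mulr_ge0// sqr_ge0.
rewrite -ler_sqr ?nnegrE ?normr_ge0 ?sqrtr_ge0//.
rewrite sqr_sqrtr; last by apply: addr_ge0; [apply: mulr_ge0|]; exact: sqr_ge0.
rewrite gerDr pmulr_rle0 ?exprn_gt0// => h.
have : (T - (hd k p).1) ^+ 2 == 0 by rewrite eq_le h sqr_ge0.
by rewrite sqrf_eq0 subr_eq0 => /eqP.
Qed.

Lemma nearest_void w k p t : nearest w (k, p) t <->
  N k w p /\ void (fun j => disc (sp j) t (bird (sp k) (hd k p) t)) w.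
Proof.
split=> -[Np h]; split=> //.
  apply/void_cnt => j q Nq; rewrite /disc/= -!sdist_bird ltNge; apply/negP/negPn.
  by apply: h.
move=> [j q] Nq; rewrite !sdist_bird leNgt; apply/negP => hq.
by move/void_cnt : h => /(_ j q Nq); apply.
Qed.

Section bijection.
Variables (l r : ty) (C : set (X * X)) (tau : X * X -> R) (w : Omega).
(** Two stations of equal type form two ordered pairs with the same epoch; fixing the order of the
    heads keeps one of them. *)
Hypothesis ordC : l = r -> forall z, C z -> z.1.1 < z.2.1.
Hypothesis meet : forall z, C z -> bird (sp l) z.1 (tau z) = bird (sp r) z.2 (tau z).
Hypothesis reg : regular N v1 v2 w.

Lemma void_pairsP pq : void_pairs l r C (closer l tau) w pq <->
  [/\ C (hdp l r pq), nearest w (l, pq.1) (tau (hdp l r pq)) &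
      nearest w (r, pq.2) (tau (hdp l r pq))].
Proof.
split=> [[[Np [Nq Cz]] vw]|[Cz /nearest_void[Np vw] /nearest_void[Nq _]]].
  split=> //; apply/nearest_void; split=> //.
  by rewrite -(meet Cz).
by split.
Qed.

(** Two pairs with a common epoch consist of birds that are all nearest at that time, hence through
    one point. A station outside the first pair would complete a triple, so the two pairs have the
    same members; the types, or the order of the heads, then match them component by component. *)
Lemma void_pairs_inj : {in void_pairs l r C (closer l tau) w &,
  injective (tau \o hdp l r)}.
Proof.
move=> [p q] [p' q'] /set_mem/void_pairsP[/= Cz np nq] /set_mem/void_pairsP[/= Cz' np' nq'].
set t := tau _ in np nq *; set t' := tau _ in np' nq' * => tt'.
rewrite -tt' in np' nq'.
have near2 s s' : nearest w s t -> nearest w s' t -> sdist v1 v2 s t = sdist v1 v2 s' t.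
  by move=> [Ns hs] [Ns' hs']; apply/le_anti; rewrite hs ?hs'.
have E s s' : nearest w s t -> nearest w s' t ->
    bird (sp s.1) (hd s.1 s.2) t = bird (sp s'.1) (hd s'.1 s'.2) t.
  by move=> /near2 h /h; case: s s' {h} => [k a] [k' a']; rewrite !sdist_bird.
have [_ notriple] := reg.
have Np : N l w p by case: np.
have Nq : N r w q by case: nq.
have Np' : N l w p' by case: np'.
have Nq' : N r w q' by case: nq'.
have [lr|lr] := pselect (l = r); last first.
  congr pair; apply: contrapT => ne.
    apply: (notriple l r); exists p, p', q, t; split=> //; split=> //.
    - by move=> /esym.
    - exact: (E (l, p) (l, p')).
    - exact: (E (l, p) (r, q)).
  apply: (notriple r l); exists q, q', p, t; split=> //; split=> //.
  - exact: (E (r, q) (r, q')).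
  - exact: (E (r, q) (l, p)).
have := ordC lr Cz; have := ordC lr Cz'.
rewrite /hdp /= => o' o.
move: nq nq' Nq Nq' o o'; rewrite -lr => nq nq' Nq Nq' o o'.
have pq : p <> q by move=> e; move: o; rewrite e ltxx.
have two s : N l w s -> nearest w (l, s) t -> s = p \/ s = q.
  move=> Ns ns; apply: contrapT => nsp; apply: (notriple l l); exists p, q, s, t.
  split=> //; split=> //.
  - by move=> _; split=> e; apply: nsp; [left|right].
  - exact: (E (l, p) (l, q)).
  - exact: (E (l, p) (l, s)).
have [p'E|p'E] := two _ Np' np'; have [q'E|q'E] := two _ Nq' nq'; subst p' q' => //.
- by move: o'; rewrite ltxx.
- by have := lt_trans o o'; rewrite ltxx.
- by move: o'; rewrite ltxx.
Qed.

Lemma card_handovers (E : set R) :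
  (forall t, E t <-> exists2 pq, void_pairs l r C (closer l tau) w pq & tau (hdp l r pq) = t) ->
  card E = card (void_pairs l r C (closer l tau) w) :> \bar R.
Proof.
move=> hE; apply/esym/(@card_bij _ _ _ _ _ (tau \o hdp l r)); split.
- by move=> pq vpq; apply/hE; exists pq.
- by move=> pq pq' h h'; apply: void_pairs_inj.
- by move=> t /hE[pq vpq <-]; exists pq.
Qed.

End bijection.

(** The order of head times selects one ordering of each unordered pair, and the last condition
    places the epoch in the unit window over which the intensity is counted. *)
Definition pure_pairs l : set (X * X) :=
  [set z | [/\ z.1.1 < z.2.1, 0 <= z.1.2, 0 <= z.2.2 &
     0 <= same_time (sp l) z /\ same_time (sp l) z <= 1]].

Lemma pure_pairs_meet l z : pure_pairs l z ->
  bird (sp l) z.1 (same_time (sp l) z) = bird (sp l) z.2 (same_time (sp l) z).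
Proof.
case: z => z z' [/= h _ _ _]; apply/(same_meetP (sp_pos l)) => //=.
by rewrite lt_eqF.
Qed.

Lemma card_pure_handover l w : regular N v1 v2 w ->
  card (pure_handover N v1 v2 l w `&` `[0, 1]) =
  card (void_pairs l l (pure_pairs l) (closer l (same_time (sp l))) w) :> \bar R.
Proof.
move=> reg; have meet := @pure_pairs_meet l.
apply: card_handovers => // [_ z []//|t]; split; last first.
  move=> [[p q] /(void_pairsP _ meet)[Cz np nq] <-]; split; last first.
    by case: Cz => _ _ _ [h1 h2]; rewrite /= in_itv/= h1.
  exists (l, p), (l, q); split=> //.
  by move=> [pq]; case: Cz; rewrite pq /= ltxx.
move=> [[[k p] [[k' q] [pq [kl [k'l [np nq]]]]]]]; rewrite /= in_itv/= => /andP[t0 t1].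
move: kl k'l pq np nq => /= -> -> pq np nq.
wlog pqT : p q pq np nq / (hd l p).1 < (hd l q).1.
  move=> wl; have := wl p q pq np nq; have := wl q p (nesym pq) nq np.
  case: (ltgtP (hd l p).1 (hd l q).1) => [_ _|_ + _|e _ _]; [exact|exact|].
  have [dist _] := reg.
  by exfalso; apply: pq; congr pair; apply: (dist l); [case: np|case: nq|exact: e].
have tE : t = same_time (sp l) (hd l p, hd l q).
  apply/(same_meetP (sp_pos l) t); first by rewrite lt_eqF.
  rewrite -!sdist_bird; case: np => Np hp; case: nq => Nq hq.
  by apply/le_anti; rewrite hp ?hq.
exists (p, q); last by rewrite tE.
apply/(void_pairsP _ meet); rewrite /= -tE; split=> //.
by rewrite /pure_pairs/= /hdp -tE; split=> //; exact: normr_ge0.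
Qed.

End handovers.

Section mixed_handovers.
Context {R : realType} {d} {Omega : measurableType d}.
Variables (N : ty -> Omega -> set (pt R)) (v1 v2 : R).
Hypotheses (v20 : 0 < v2) (v21 : v2 < v1).

Local Notation X := (measurableTypeR R * measurableTypeR R)%type.
Local Notation hd := (@station_head R v1 v2).
Local Notation void_pairs := (@void_pairs R _ _ _ _ _ N hd).
Local Notation closer := (closer v1 v2).
Local Notation hdp := (hdp hd).
Local Notation mtime := (mixed_time v1 v2).
Local Notation discr := (pair_discr v1 v2).

(* A tangency is a first meeting without a second one. *)
Definition valid_discr (k : nat) (x : R) : Prop := if k == 1%N then 0 <= x else 0 < x.

Lemma valid_discr_ge0 k x : valid_discr k x -> 0 <= x.
Proof. by rewrite /valid_discr; case: ifP => // _ /ltW. Qed.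

Lemma kth_meet_sym k s s' t : kth_meet v1 v2 k s s' t -> kth_meet v1 v2 k s' s t.
Proof.
rewrite /kth_meet /birds_meet => -[-> h]; split=> //; rewrite -h; congr esum.
by apply/seteqP; split=> u [/= ? ->].
Qed.

(** The number of earlier meetings identifies the root: none precedes the smaller one, and exactly
    one precedes the larger provided the discriminant is positive. At a zero discriminant the roots
    coincide and there is no second meeting. *)
Lemma kth_meetP k p q t : k = 1%N \/ k = 2%N ->
  kth_meet v1 v2 k (ty1, p) (ty2, q) t <->
  valid_discr k (discr (hdp ty1 ty2 (p, q))) /\ t = mtime k (hdp ty1 ty2 (p, q)).
Proof.
move=> k12; set z := hdp _ _ _.
have meetE u : birds_meet v1 v2 (ty1, p) (ty2, q) u <->
    0 <= discr z /\ (u = mtime 1 z \/ u = mtime 2 z).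
  rewrite -mixed_meetP// /birds_meet !sdist_bird//.
have m12 : mtime 1 z <= mtime 2 z by exact: mixed_time_le.
have mlt : (mtime 1 z < mtime 2 z) = (0 < discr z) by exact: mixed_time_lt.
rewrite /kth_meet -/(card _); case: k12 => -> /=; rewrite /valid_discr/=; split.
- move=> [/meetE[D0 tE] /card_eq0 S0]; split=> //.
  case: tE => // tE; apply/le_anti; rewrite {2}tE m12 andbT leNgt; apply/negP => lt.
  have : set0 (mtime 1 z) by rewrite -S0; split=> //; apply/meetE; split=> //; left.
  by [].
- move=> [D0 ->]; split; first by apply/meetE; split=> //; left.
  apply/card_eq0; rewrite -subset0 => u [ult /meetE[_ [uE|uE]]].
    by move: ult; rewrite uE ltxx.
  by move: ult; rewrite uE ltNge m12.
- move=> [/meetE[D0 tE] c1]; have t2 : t = mtime 2 z.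
    case: tE => // tE; exfalso; move: c1.
    rewrite (_ : [set _ | _] = set0) ?card0; last first.
      rewrite -subset0 => u [ult /meetE[_ [uE|uE]]].
        by move: ult; rewrite uE tE ltxx.
      by move: ult; rewrite uE tE ltNge m12.
    by move/eqP; rewrite eqe eq_sym oner_eq0.
  split=> //; rewrite -mlt ltNge; apply/negP => le21; move: c1.
  rewrite (_ : [set _ | _] = set0) ?card0; last first.
    rewrite -subset0 => u [ult /meetE[_ [uE|uE]]].
      by move: ult; rewrite uE t2 ltNge le21.
    by move: ult; rewrite uE t2 ltxx.
  by move/eqP; rewrite eqe eq_sym oner_eq0.
- move=> [D0 ->]; split; first by apply/meetE; split; [exact: ltW|right].
  rewrite (_ : [set _ | _] = [set mtime 1 z]); first by rewrite /card esum_set1.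
  apply/seteqP; split=> u /=.
    by move=> [ult /meetE[_ [//|uE]]]; move: ult; rewrite uE ltxx.
  by move=> ->; rewrite mlt; split=> //; apply/meetE; split; [exact: ltW|left].
Qed.

(** The first component is always the head of type 1, whichever comes first; [b] tells whether it
    precedes the head of type 2, so that both orders of types share one parametrization. *)
Definition mixed_pairs (k : nat) (b : bool) : set (X * X) :=
  [set z | [/\ 0 <= z.1.2, 0 <= z.2.2, valid_discr k (discr z),
     (if b then z.1.1 < z.2.1 else z.2.1 < z.1.1) &
     0 <= mtime k z /\ mtime k z <= 1]].

Lemma mixed_pairs_meet k b z : k = 1%N \/ k = 2%N -> mixed_pairs k b z ->
  bird (sp v1 v2 ty1) z.1 (mtime k z) = bird (sp v1 v2 ty2) z.2 (mtime k z).
Proof.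
move=> k12 [_ _ /valid_discr_ge0 D0 _ _]; apply/(mixed_meetP v20 v21); split=> //.
by case: k12 => ->; [left|right].
Qed.

Lemma card_mixed_handover k (b : bool) w : k = 1%N \/ k = 2%N -> regular N v1 v2 w ->
  card (mixed_handover N v1 v2 k (if b then ty1 else ty2) (if b then ty2 else ty1) w
    `&` `[0, 1]) =
  card (void_pairs ty1 ty2 (mixed_pairs k b) (closer ty1 (mtime k)) w) :> \bar R.
Proof.
move=> k12 reg; have meet z := @mixed_pairs_meet k b z k12.
have vpP pq := @void_pairsP _ _ _ N _ _ v20 v21 _ _ _ _ w meet pq.
have key t : (mixed_handover N v1 v2 k (if b then ty1 else ty2) (if b then ty2 else ty1) w
    `&` `[0, 1]) t <-> exists p q, [/\ 0 <= t <= 1, nearest N v1 v2 w (ty1, p) t,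
    nearest N v1 v2 w (ty2, q) t, (if b then (hd ty1 p).1 < (hd ty2 q).1
     else (hd ty2 q).1 < (hd ty1 p).1) & kth_meet v1 v2 k (ty1, p) (ty2, q) t].
  split.
    move=> [[_ [[k1 p] [[k2 q] [k1E [k2E [np [nq [[T [T' [hT [hT' TT']]]] km]]]]]]]]].
    rewrite /= in_itv/= => t01.
    case: b k1E k2E {vpP meet} => /= k1E k2E; rewrite k1E k2E in np nq hT hT' km.
      exists p, q; split=> //.
      by move/(head_timeP v20 v21) : hT TT' => ->; move/(head_timeP v20 v21) : hT' => ->.
    exists q, p; split=> //; last exact: kth_meet_sym.
    by move/(head_timeP v20 v21) : hT TT' => ->; move/(head_timeP v20 v21) : hT' => ->.
  move=> [p [q [t01 np nq o km]]]; split; last by rewrite /= in_itv.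
  case: b o {vpP meet} => o; split=> //.
    exists (ty1, p), (ty2, q); do 5![split=> //].
    by exists (hd ty1 p).1, (hd ty2 q).1; split; [|split] => //; exact/(head_timeP v20 v21).
  exists (ty2, q), (ty1, p); do 4![split=> //]; split; last exact: kth_meet_sym.
  by exists (hd ty2 q).1, (hd ty1 p).1; split; [|split] => //; exact/(head_timeP v20 v21).
apply: (card_handovers v20 v21) => // t; rewrite key; split.
  move=> [p [q [/andP[t0 t1] np nq o /(kth_meetP _ _ _ k12)[vd tE]]]].
  exists (p, q) => //; apply/vpP; rewrite -tE; split=> //.
  by split=> //; rewrite -?tE//; exact: normr_ge0.
move=> [[p q] /vpP[/= [_ _ vd o [t0 t1]] np nq] <-]; exists p, q; split=> //.
  by rewrite t0.
by apply/(kth_meetP _ _ _ k12).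
Qed.

End mixed_handovers.

Section intensities.
Context {R : realType} {d} {Omega : measurableType d}.
Variables (P : probability Omega R) (N : ty -> Omega -> set (pt R)).
Variables (lam1 lam2 v1 v2 : R).
Hypotheses (lam10 : 0 < lam1) (lam20 : 0 < lam2) (v20 : 0 < v2) (v21 : v2 < v1).
Hypothesis PPP : two_type_PPP P N lam1 lam2.

Local Notation X := (measurableTypeR R * measurableTypeR R)%type.
Local Notation hd := (@station_head R v1 v2).
Local Notation m := (head_intensity lam10 lam20 v20 v21).
Local Notation sp := (sp v1 v2).
Local Notation lam := (lam1 + lam2).
Local Notation void_pairs := (@void_pairs R _ _ _ _ _ N hd).
Local Notation closer := (closer v1 v2).
Local Notation mtime := (mixed_time v1 v2).

(** The number of epochs is identified with a number of pairs only on regular configurations, and is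
    not known to be measurable elsewhere. The integral is therefore first restricted to an almost
    sure event, where it equals that of a measurable function. *)
Lemma intensity_void_formula (l r : ty) (A B : nat -> set X) (C : set (X * X))
    (tau : X * X -> R) (E : Omega -> set R) :
  (forall i, finite_mean m l (A i)) -> (forall i, finite_mean m r (B i)) ->
  (forall i, l = r -> A i `&` B i = set0) ->
  measurable C -> C `<=` \bigcup_i (A i `*` B i) -> measurable_fun setT tau ->
  (forall z, C z -> bird (sp l) z.1 (tau z) = bird (sp r) z.2 (tau z)) ->
  (forall w, regular N v1 v2 w ->
    card (E w `&` `[0, 1]) = card (void_pairs l r C (closer l tau) w) :> \bar R) ->
  intensity P E = (\int[m l \x m r]_(z in C)
       (expR (- (lam * pi * (meet_height v1 v2 l tau z) ^+ 2)))%:E)%E.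
Proof.
move=> fA fB sep mC CAB mtau meet cE.
have [G [mG G0 mf <-]] := disc_void_formula_cover PPP fA fB sep
  mC CAB mtau meet.
have [H [mH H0 Hreg]] := regular_ae lam10 lam20 v20 v21 PPP.
have GH0 : P (~` (G `&` H)) = 0%E by exact: conegligibleI.
have mfGH : measurable_fun (G `&` H)
    (fun w => card (void_pairs l r C (closer l tau) w) : \bar R).
  by apply: measurable_funS mf => //; exact: subIsetl.
rewrite /intensity -/(card _).
rewrite (ge0_integral_conegligible (measurableI _ _ mG mH) GH0); first last.
- apply: eq_measurable_fun mfGH => w /set_mem[_ Hw]; apply/esym/cE; exact: Hreg.
- by move=> w; exact: card_ge0.
transitivity (\int[P]_(w in G `&` H) card (void_pairs l r C (closer l tau) w))%E.
  by apply: eq_integral => w /set_mem[_ Hw]; apply: cE; exact: Hreg.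
rewrite [RHS](ge0_negligible_integral (measurableC mH) mG mf _ H0) ?setDE ?setCK//.
by move=> w _; exact: card_ge0.
Qed.

Let m11 : measurable_fun setT (fun z : X * X => z.1.1).
Proof. exact: measurableT_comp measurable_fst measurable_fst. Qed.
Let m12 : measurable_fun setT (fun z : X * X => z.1.2).
Proof. exact: measurableT_comp measurable_snd measurable_fst. Qed.
Let m21 : measurable_fun setT (fun z : X * X => z.2.1).
Proof. exact: measurableT_comp measurable_fst measurable_snd. Qed.
Let m22 : measurable_fun setT (fun z : X * X => z.2.2).
Proof. exact: measurableT_comp measurable_snd measurable_snd. Qed.

Lemma measurable_pure_pairs l : measurable (pure_pairs v1 v2 l).
Proof.
have mt := @measurable_same_time _ (sp l).
rewrite (_ : pure_pairs v1 v2 l = [set z | z.1.1 < z.2.1] `&` [set z | 0 <= z.1.2] `&`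
  [set z | 0 <= z.2.2] `&` [set z | 0 <= same_time (sp l) z] `&`
  [set z | same_time (sp l) z <= 1]); last first.
  by apply/seteqP; split=> [z [? ? ? [? ?]]|z [[[[? ?] ?] ?] ?]].
repeat apply: measurableI; do ?[exact: measurable_set_lt|exact: measurable_set_le].
Qed.

Lemma measurable_mixed_pairs k b : measurable (mixed_pairs v1 v2 k b).
Proof.
have mt := @measurable_mixed_time R v1 v2 k.
have md := @measurable_pair_discr R v1 v2.
rewrite (_ : mixed_pairs v1 v2 k b = [set z | 0 <= z.1.2] `&` [set z | 0 <= z.2.2] `&`
  [set z | valid_discr k (pair_discr v1 v2 z)] `&`
  [set z | if b then z.1.1 < z.2.1 else z.2.1 < z.1.1] `&` [set z | 0 <= mtime k z] `&`
  [set z | mtime k z <= 1]); last first.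
  by apply/seteqP; split=> [z [? ? ? ? [? ?]]|z [[[[[? ?] ?] ?] ?] ?]].
have mv : measurable [set z : X * X | valid_discr k (pair_discr v1 v2 z)].
  rewrite /valid_discr; case: (k == 1%N); [exact: measurable_set_le|exact: measurable_set_lt].
have mo : measurable [set z : X * X | if b then z.1.1 < z.2.1 else z.2.1 < z.1.1].
  by case: b; exact: measurable_set_lt.
repeat apply: measurableI => //; exact: measurable_set_le.
Qed.

Lemma Lambda_pure_integral l : Lambda_pure P N v1 v2 l =
  (\int[m l \x m l]_(z in pure_pairs v1 v2 l) (expR (- (lam * pi *
    (meet_height v1 v2 l (same_time (sp l)) z) ^+ 2)))%:E)%E.
Proof.
(* The index runs through all pairs of boxes at all scales. A pair of boxes in the wrong order is
   replaced by an empty product, which keeps [A i] and [B i] disjoint; two heads are caught at a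
   scale finer than the gap between their times. *)
pose idx i := odflt ((0%N, 0%N), (0, 0)) (choice.unpickle i) : (nat * nat) * (int * int).
pose A i : set X := box (idx i).1.1 (idx i).1.2 (idx i).2.1.
pose B i : set X := if (idx i).2.1 < (idx i).2.2 then
  box (idx i).1.1 (idx i).1.2 (idx i).2.2 else set0.
apply: (@intensity_void_formula l l A B).
- by move=> i; exact: fm_box.
- by move=> i; rewrite /B; case: ifPn => _; [exact: fm_box|exact: fm0].
- move=> i _; rewrite /B; case: ifPn => [ij|_]; last by rewrite setI0.
  rewrite -subset0 => z [zi zj]; have := box_lt ij zi zj.
  by rewrite ltxx.
- exact: measurable_pure_pairs.
- move=> [z z'] [/= zz z0 z'0 _].
  have [n hn] : exists n, step n <= `|z.1 - z'.1|.
    have x0 : 0 < `|z.1 - z'.1| by rewrite normr_gt0 subr_eq0 lt_eqF.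
    have : \forall n \near \oo, step n <= `|z.1 - z'.1|.
      move/cvgrPdist_le: (@cvg_step R) => /(_ _ x0).
      by apply: filterS => n; rewrite sub0r normrN (ger0_norm (ltW (step_gt0 n))).
    by case=> n _ h; exists n; exact: h (leqnn n).
  pose K := (Num.truncn (z.2 + z'.2)).+1.
  have hK := truncnS_gt (z.2 + z'.2).
  exists (choice.pickle ((n, K), (cell n z.1, cell n z'.1))); first exact: I.
  rewrite /A /B /idx choice.pickleK /=.
  rewrite lt_neqAle cell_le_mono ?(ltW zz)// andbT ifT; last exact/eqP/cell_neq.
  by split=> /=; apply: box_cell => //; rewrite /K; lra.
- exact: measurable_same_time.
- by move=> z; exact: pure_pairs_meet.
- by move=> w; exact: card_pure_handover.
Qed.

Lemma Lambda_mixed_integral k (b : bool) : k = 1%N \/ k = 2%N ->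
  Lambda_mixed P N v1 v2 k (if b then ty1 else ty2) (if b then ty2 else ty1) =
  (\int[m ty1 \x m ty2]_(z in mixed_pairs v1 v2 k b) (expR (- (lam * pi *
    hhat2 v1 v2 k (z.1.1 - z.2.1) z.1.2 z.2.2)))%:E)%E.
Proof.
(* Heads of different types are independent over any two sets, so growing slabs suffice and no
   separation in time is needed. *)
move=> k12; pose A i : set X := slab (- i%:R) i%:R i%:R.
have fA l i : finite_mean m l (A i) by apply: fm_slab => //; rewrite lerNl (le_trans _ (ler0n _ _))// lerNl oppr0.
transitivity (\int[m ty1 \x m ty2]_(z in mixed_pairs v1 v2 k b) (expR (- (lam * pi *
    (meet_height v1 v2 ty1 (mtime k) z) ^+ 2)))%:E)%E; last first.
  by apply: eq_integral => z _; rewrite /meet_height bird_mixed_time.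
apply: (@intensity_void_formula ty1 ty2 A A) => //.
- exact: measurable_mixed_pairs.
- move=> [z z'] [/= z0 z'0 _ _ _].
  pose K := (Num.truncn (`|z.1| + `|z'.1| + z.2 + z'.2)).+1.
  have := truncnS_gt (`|z.1| + `|z'.1| + z.2 + z'.2).
  have := normr_ge0 z.1; have := normr_ge0 z'.1.
  move=> a b' h; exists K => //; rewrite /A -/K in h *.
  by split; apply: slab_box => //=; lra.
- exact: measurable_mixed_time.
- by move=> z; exact: mixed_pairs_meet.
- by move=> w; exact: card_mixed_handover.
Qed.

End intensities.

(** * Evaluation of the integrals *)

Section stationarity.
Context {R : realType}.
Local Open Scope ereal_scope.
Local Notation mu := (@lebesgue_measure R).
Local Notation X := (measurableTypeR R * measurableTypeR R)%type.

Lemma measurable_integral_half (f : R * R -> \bar R) : measurable_fun setT f ->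
  (forall z, 0 <= f z) ->
  measurable_fun setT (fun x => \int[mu]_(y in half) f (x, y)).
Proof.
move=> mf f0; have := @measurable_fun_fubini_tonelli_F _ _ _ _ _
  (half_leb (NngNum (ler01 : (0 <= 1 :> R)%R))) f mf f0.
apply: eq_measurable_fun => x _; rewrite /fubini_F ge0_integral_half_leb ?mul1e//.
exact: (@measurable_line R f).
Qed.

Definition unit_window (x : R) : \bar R := (\1_(`[0%R, 1%R]%classic : set R) x)%:E.

Lemma unit_window_ge0 x : 0 <= unit_window x. Proof. by rewrite lee_fin. Qed.

Lemma measurable_unit_window : measurable_fun setT unit_window.
Proof. by apply/measurable_EFinP; apply: measurable_indic; exact: measurable_itv. Qed.

Lemma integral_unit_window (b : R) : \int[mu]_x unit_window (x + b)%R = 1.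
Proof.
transitivity (\int[mu]_x unit_window (1 * x + b)%R).
  by apply: eq_integral => x _; rewrite mul1r.
rewrite (@ge0_integral_affine _ 1 b unit_window (oner_neq0 _) measurable_unit_window
  unit_window_ge0).
rewrite normr1 invr1 mul1e /unit_window integral_indic//.
transitivity (mu `[0%R, 1%R]); first by rewrite setIT.
by rewrite lebesgue_measure_itv/= lte_fin ltr01 oppr0 adde0.
Qed.

(** With the lag [t = x - y] in place of [y], integration in [x] at fixed [t] sees only the window,
    which has length one whatever the shift [s t]. *)
Lemma stationary_line (f : R -> \bar R) (s : R -> R) : measurable_fun setT f ->
  (forall t, 0 <= f t) -> measurable_fun setT s ->
  \int[mu]_x \int[mu]_y (f (x - y)%R * unit_window (x + s (x - y)%R)%R) = \int[mu]_t f t.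
Proof.
move=> mf f0 ms; pose g (z : R * R) := f z.2 * unit_window (z.1 + s z.2)%R.
have mg : measurable_fun setT g.
  apply: emeasurable_funM; first exact: (measurableT_comp mf).
  apply: (measurableT_comp measurable_unit_window); apply: measurable_funD => //.
  exact: (measurableT_comp ms).
have g0 z : 0 <= g z by rewrite mule_ge0// unit_window_ge0.
transitivity (\int[mu]_x \int[mu]_t g (x, t)).
  apply: eq_integral => x _.
  transitivity (\int[mu]_y g (x, (-1 * y + x)%R)).
    by apply: eq_integral => y _; rewrite mulN1r addrC.
  rewrite (@ge0_integral_affine _ (-1) x (fun t => g (x, t))) ?oppr_eq0 ?oner_eq0//.
    by rewrite normrN1 invr1 mul1e.
  exact: (@measurable_line R g).
rewrite integral_swap//; apply: eq_integral => t _.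
transitivity (\int[mu]_x (f t * unit_window (x + s t)%R)); first by [].
rewrite ge0_integralZl//; first by rewrite integral_unit_window mule1.
- apply: (measurableT_comp measurable_unit_window); exact: measurable_funD.
- by move=> x _; exact: unit_window_ge0.
Qed.

Variables (c c' : {nonneg R}).
Variables (f : R * (R * R) -> \bar R) (s : R * (R * R) -> R).
Hypotheses (mf : measurable_fun setT f) (f0 : forall u, 0 <= f u).
Hypothesis ms : measurable_fun setT s.

(** [u] gathers the lag and the two heights, which are unchanged by a shift of time; the epoch is
    the first head time plus a delay that depends on [u] only. *)
Let F (z : X * X) : \bar R := let u := ((z.1.1 - z.2.1)%R, (z.1.2, z.2.2)) in
  f u * unit_window (z.1.1 + s u)%R.

Let F0 z : 0 <= F z. Proof. by rewrite mule_ge0// unit_window_ge0. Qed.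

Let mF : measurable_fun setT F.
Proof.
have m11 : measurable_fun setT (fun z : X * X => z.1.1).
  exact: measurableT_comp measurable_fst measurable_fst.
have m12 : measurable_fun setT (fun z : X * X => z.1.2).
  exact: measurableT_comp measurable_snd measurable_fst.
have m21 : measurable_fun setT (fun z : X * X => z.2.1).
  exact: measurableT_comp measurable_fst measurable_snd.
have m22 : measurable_fun setT (fun z : X * X => z.2.2).
  exact: measurableT_comp measurable_snd measurable_snd.
have mu' : measurable_fun setT (fun z : X * X => ((z.1.1 - z.2.1)%R, (z.1.2, z.2.2))).
  by apply: measurable_fun_pair; [exact: measurable_funB|exact: measurable_fun_pair].
apply: emeasurable_funM; first exact: (measurableT_comp mf).
apply: (measurableT_comp measurable_unit_window); apply: measurable_funD => //.
exact: (measurableT_comp ms).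
Qed.

Lemma stationary_integral :
  \int[head_mean c \x head_mean c']_z F z =
  (c%:num * c'%:num)%:E *
  \int[mu]_(h in half) \int[mu]_(h' in half) \int[mu]_t f (t, (h, h')).
Proof.
have mhh : measurable_fun setT (fun w : (R * R) * R => f (w.2, w.1)).
  by apply: (measurableT_comp mf); exact: measurable_fun_pair.
have mI : measurable_fun setT (fun w : R * R => \int[mu]_t f (t, w)).
  exact: (@measurable_fun_fubini_tonelli_F _ _ _ _ _ mu (fun w : (R * R) * R => f (w.2, w.1))).
have I0 w : 0 <= \int[mu]_t f (t, w) by apply: integral_ge0.
have mJ : measurable_fun setT (fun h => \int[half_leb c']_h' \int[mu]_t f (t, (h, h'))).
  exact: (@measurable_fun_fubini_tonelli_F _ _ _ _ _ (half_leb c') (fun w : R * R => \int[mu]_t f (t, w))).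
transitivity (\int[half_leb c]_h \int[half_leb c']_h' \int[mu]_t f (t, (h, h'))); last first.
  rewrite ge0_integral_half_leb//; last by move=> h; apply: integral_ge0.
  rewrite EFinM -muleA; congr (_ * _).
  transitivity (\int[mu]_(h in half) (c'%:num%:E * \int[mu]_(h' in half) \int[mu]_t f (t, (h, h')))).
    apply: eq_integral => h _; rewrite ge0_integral_half_leb//.
    by apply: (@measurable_line R (fun w => \int[mu]_t f (t, w))).
  rewrite ge0_integralZl//; first exact: measurable_half.
  - by apply: measurable_funTS; apply: (measurable_integral_half (f := fun w => \int[mu]_t f (t, w))).
  - by move=> h _; apply: integral_ge0.
rewrite fubini_tonelli1// /fubini_F.
have mG : measurable_fun setT (fun x : X => \int[head_mean c']_y F (x, y)).
  exact: (@measurable_fun_fubini_tonelli_F _ _ _ _ _ (head_mean c') F).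
rewrite [LHS](@fubini_tonelli2 _ _ _ _ R mu (half_leb c) (fun x : X => \int[head_mean c']_y F (x, y)))//; last first.
  by move=> x; apply: integral_ge0.
apply: eq_integral => h _; rewrite /fubini_G.
pose H (w : (R * R) * R) := F ((w.1.1, h), (w.2, w.1.2)).
have mH : measurable_fun setT H.
  apply: (measurableT_comp mF); apply: measurable_fun_pair; apply: measurable_fun_pair => //.
  - exact: measurableT_comp measurable_fst measurable_fst.
  - exact: measurableT_comp measurable_snd measurable_fst.
have mK : measurable_fun setT (fun w : R * R => \int[mu]_y H (w, y)).
  exact: (@measurable_fun_fubini_tonelli_F _ _ _ _ _ mu H mH (fun w => F0 _)).
transitivity (\int[mu]_x \int[half_leb c']_h' \int[mu]_y H ((x, h'), y)).
  apply: eq_integral => x _.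
  rewrite [LHS](@fubini_tonelli2 _ _ _ _ R mu (half_leb c') (fun y : X => F ((x, h), y)))//.
  by apply: (measurableT_comp mF); exact: measurable_fun_pair.
rewrite (@fubini_tonelli _ _ _ _ _ mu (half_leb c') (fun w : R * R => \int[mu]_y H (w, y)))//; last first.
  by move=> w; apply: integral_ge0 => y _; exact: F0.
apply: eq_integral => h' _.
have mfh : measurable_fun setT (fun t => f (t, (h, h'))).
  by apply: (measurableT_comp mf); exact: measurable_fun_pair.
have msh : measurable_fun setT (fun t => s (t, (h, h'))).
  by apply: (measurableT_comp ms); exact: measurable_fun_pair.
have fh0 t : 0 <= f (t, (h, h')) by exact: f0.
exact: (stationary_line mfh fh0 msh).
Qed.

End stationarity.

(** * The mixed frequencies *)

Section mixed_lag.
Context {R : realType}.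
Variables (v1 v2 : R).
Hypotheses (v20 : 0 < v2) (v21 : v2 < v1).
Local Notation mu := (@lebesgue_measure R).

Lemma tstar_ge0 h1 h2 : 0 <= tstar v1 v2 h1 h2.
Proof.
have v10 := lt_trans v20 v21.
by rewrite /tstar !mulr_ge0 ?sqrtr_ge0// invr_ge0 mulr_ge0// ltW.
Qed.

(** By the value 0 of [Num.sqrt] at negative arguments. Thus the lags run from [tstar] in both
    regimes of heights, and the lower limit 0 of the second inner integral is the same
    expression. *)
Lemma tstar_eq0 h1 h2 : h1 ^+ 2 <= h2 ^+ 2 -> tstar v1 v2 h1 h2 = 0.
Proof. by move=> h; rewrite /tstar [Num.sqrt (_ - _)]ler0_sqrtr ?subr_le0// mulr0 mul0r. Qed.

Lemma discr_tstar h1 h2 : h2 ^+ 2 <= h1 ^+ 2 -> discr v1 v2 (tstar v1 v2 h1 h2) h1 h2 = 0.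
Proof.
move=> h; have v10 := lt_trans v20 v21.
have D0 := dv_gt0 v20 v21.
rewrite /discr /tstar !exprMn !sqr_sqrtr ?subr_ge0//; last by rewrite -subr_ge0 ltW.
by field; rewrite !gt_eqF.
Qed.

Lemma discr_lt (t t' h1 h2 : R) : 0 <= t -> 0 <= t' ->
  (discr v1 v2 t h1 h2 < discr v1 v2 t' h1 h2) = (t < t').
Proof.
move=> t0 t0'; have v10 := lt_trans v20 v21.
by rewrite /discr ltrD2r ltr_pM2l ?mulr_gt0 ?exprn_gt0// ltr_sqr.
Qed.

Lemma discr_gt0 (t h1 h2 : R) : 0 < t -> tstar v1 v2 h1 h2 < t -> 0 < discr v1 v2 t h1 h2.
Proof.
move=> t0 ts; have [h|h] := leP (h2 ^+ 2) (h1 ^+ 2).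
  by rewrite -(discr_tstar h) discr_lt ?tstar_ge0// ltW.
have v10 := lt_trans v20 v21; have D0 := dv_gt0 v20 v21.
rewrite /discr -mulNr opprB addr_gt0// mulr_gt0 ?exprn_gt0//.
  by rewrite mulr_gt0 ?exprn_gt0.
by rewrite subr_gt0.
Qed.

Lemma discr_ge0 (t h1 h2 : R) : 0 < t -> 0 <= discr v1 v2 t h1 h2 -> tstar v1 v2 h1 h2 <= t.
Proof.
move=> t0 d0; have [h|h] := leP (h2 ^+ 2) (h1 ^+ 2).
  rewrite leNgt -(discr_lt h1 h2) ?tstar_ge0// ?ltW//.
  by rewrite discr_tstar// -leNgt.
by rewrite tstar_eq0 ltW.
Qed.

Definition valid_lags k h1 h2 : set R :=
  [set t | 0 < t /\ valid_discr k (discr v1 v2 t h1 h2)].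

(** For positive lags the discriminant is positive beyond [tstar] and negative before it, so the two
    domains differ at most in the point [tstar], which has measure zero. This absorbs both the
    tangency and the lag 0. *)
Lemma integral_valid_lags k h1 h2 (f : R -> \bar R) : measurable_fun setT f ->
  (\int[mu]_(t in valid_lags k h1 h2) f t =
   \int[mu]_(t in `[tstar v1 v2 h1 h2, +oo[) f t)%E.
Proof.
move=> mf; set ts := tstar _ _ _ _.
have sub t : ts < t -> valid_lags k h1 h2 t.
  move=> tst; have t0 : 0 < t by apply: le_lt_trans tst; exact: tstar_ge0.
  split=> //; have := discr_gt0 t0 tst; rewrite /valid_discr.
  by case: (k == 1%N) => // /ltW.
have sup t : valid_lags k h1 h2 t -> ts <= t.
  by move=> [t0 /valid_discr_ge0]; exact: discr_ge0.
have [hts|hts] := pselect (valid_lags k h1 h2 ts).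
  congr (integral _ _ _); apply/seteqP; split=> t; rewrite /= in_itv/= andbT; first exact: sup.
  by rewrite le_eqVlt => /orP[/eqP <-//|]; exact: sub.
rewrite -integral_itv_obnd_cbnd; last exact: measurable_funTS.
congr (integral _ _ _); apply/seteqP; split=> t; rewrite /= in_itv/= andbT; last exact: sub.
move=> vt; rewrite lt_neqAle sup// andbT; apply/eqP => e.
by apply: hts; rewrite e.
Qed.

(** Reversing the lag fixes the discriminant and turns one root into the opposite of the other, and
    the root enters only through its square. For [k] in [{1, 2}] the exchange of the roots is
    [3 - k]. *)
Lemma hhat2N k (t h1 h2 : R) : k = 1%N \/ k = 2%N ->
  hhat2 v1 v2 k (- t) h1 h2 = hhat2 v1 v2 (3 - k) t h1 h2.
Proof.
rewrite /hhat2 sqrrN; set s := Num.sqrt _; set D := v1 ^+ 2 - v2 ^+ 2.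
by case=> -> /=; rewrite ?expr1 ?sqrrN ?expr1n ?mulN1r ?mul1r; congr (_ * _ + _);
  rewrite -[in RHS]sqrrN; congr (_ ^+ 2); rewrite -mulNr; congr (_ / _); ring.
Qed.

End mixed_lag.

Section mixed_intensity.
Context {R : realType} {d} {Omega : measurableType d}.
Variables (P : probability Omega R) (N : ty -> Omega -> set (pt R)).
Variables (lam1 lam2 v1 v2 : R).
Hypotheses (lam10 : 0 < lam1) (lam20 : 0 < lam2) (v20 : 0 < v2) (v21 : v2 < v1).
Hypothesis PPP : two_type_PPP P N lam1 lam2.
Local Open Scope ereal_scope.

Local Notation mu := (@lebesgue_measure R).
Local Notation X := (measurableTypeR R * measurableTypeR R)%type.
Local Notation m := (head_intensity lam10 lam20 v20 v21).
Local Notation lam := (lam1 + lam2)%R.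

Definition void_density (k : nat) (u : R * (R * R)) : \bar R :=
  (expR (- (lam * pi * hhat2 v1 v2 k u.1 u.2.1 u.2.2)))%:E.

Let m21 : measurable_fun setT (fun u : R * (R * R) => u.2.1).
Proof. exact: measurableT_comp measurable_fst measurable_snd. Qed.
Let m22 : measurable_fun setT (fun u : R * (R * R) => u.2.2).
Proof. exact: measurableT_comp measurable_snd measurable_snd. Qed.

Lemma measurable_discr : measurable_fun setT
  (fun u : R * (R * R) => discr v1 v2 u.1 u.2.1 u.2.2).
Proof.
apply: measurable_funB; apply: measurable_funM => //; first exact: measurable_funX.
by apply: measurable_funB; exact: measurable_funX.
Qed.

Lemma measurable_mixed_offset k : measurable_fun setT
  (fun u : R * (R * R) => mixed_offset v1 v2 k u.1 u.2.1 u.2.2).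
Proof.
apply: measurable_funM => //; apply: measurable_funD; apply: measurable_funM => //.
apply: (measurableT_comp measurable_sqrtr); exact: measurable_discr.
Qed.

Lemma measurable_void_density k : measurable_fun setT (void_density k).
Proof.
apply/measurable_EFinP; apply: measurableT_comp; first exact: measurable_expR.
apply: measurableT_comp => //; apply: measurable_funM => //.
apply: measurable_funD; last exact: measurable_funX.
by apply: measurable_funM => //; apply: measurable_funX; exact: measurable_mixed_offset.
Qed.

Lemma void_density_ge0 k u : 0 <= void_density k u.
Proof. by rewrite lee_fin expR_ge0. Qed.

(** The lag [u.1] is the head time of type 1 minus that of type 2, so it is negative when the type 1
    head comes first. *)
Definition mixed_dom k (b : bool) : set (R * (R * R)) :=
  [set u | [/\ (0 <= u.2.1)%R, (0 <= u.2.2)%R, valid_discr k (discr v1 v2 u.1 u.2.1 u.2.2) &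
     if b then (u.1 < 0)%R else (0 < u.1)%R]].

Lemma measurable_mixed_dom k b : measurable (mixed_dom k b).
Proof.
rewrite (_ : mixed_dom k b = [set u | 0 <= u.2.1]%R `&` [set u | 0 <= u.2.2]%R `&`
  [set u | valid_discr k (discr v1 v2 u.1 u.2.1 u.2.2)] `&`
  [set u | if b then u.1 < 0 else 0 < u.1]%R); last first.
  by apply/seteqP; split=> [u []|u [[[]]]].
have mv : measurable [set u : R * (R * R) | valid_discr k (discr v1 v2 u.1 u.2.1 u.2.2)].
  have md := measurable_discr.
  by rewrite /valid_discr; case: (k == 1%N); [exact: measurable_set_le|exact: measurable_set_lt].
have mo : measurable [set u : R * (R * R) | if b then u.1 < 0 else 0 < u.1]%R.
  by case: b; exact: measurable_set_lt.
by repeat apply: measurableI => //; exact: measurable_set_le.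
Qed.

Let mf k b : measurable_fun setT (void_density k \_ (mixed_dom k b)).
Proof.
apply/(measurable_restrict _ _ measurableT); first exact: measurable_mixed_dom.
by rewrite setTI; apply: measurable_funTS; exact: measurable_void_density.
Qed.

Let f0 k b u : 0 <= (void_density k \_ (mixed_dom k b)) u.
Proof. by rewrite patchE; case: ifPn => // _; exact: void_density_ge0. Qed.

Lemma Lambda_mixed_lags k b : k = 1%N \/ k = 2%N ->
  Lambda_mixed P N v1 v2 k (if b then ty1 else ty2) (if b then ty2 else ty1) =
  (4 * lam1 * lam2 * v1 * v2)%:E * \int[mu]_(h1 in half) \int[mu]_(h2 in half)
    \int[mu]_t (void_density k \_ (mixed_dom k b)) (t, (h1, h2)).
Proof.
move=> k12; rewrite (Lambda_mixed_integral lam10 lam20 v20 v21 PPP)//.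
rewrite integral_mkcond.
have -> : (4 * lam1 * lam2 * v1 * v2 = 2 * lam1 * v1 * (2 * lam2 * v2))%R by ring.
rewrite -(stationary_integral (head_rate lam10 lam20 v20 v21 ty1)
  (head_rate lam10 lam20 v20 v21 ty2) (mf k b) (f0 k b) (measurable_mixed_offset k)).
apply: eq_integral => z _; rewrite !patchE /unit_window indicE.
have -> : (z \in mixed_pairs v1 v2 k b) =
  (((z.1.1 - z.2.1)%R, (z.1.2, z.2.2)) \in mixed_dom k b) &&
  ((z.1.1 + mixed_offset v1 v2 k (z.1.1 - z.2.1) z.1.2 z.2.2)%R \in `[0%R, 1%R]%classic).
  apply/idP/andP.
    move=> /set_mem[h1 h2 vd o [t0 t1]]; split; apply/mem_set; last first.
      by rewrite /= in_itv/= -/(mixed_time _ _ _ _) t0.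
    split=> //; case: b o => /=; [by rewrite subr_lt0|by rewrite subr_gt0].
  move=> [/set_mem[/= h1 h2 vd o] /set_mem]; rewrite /= in_itv/= => /andP[t0 t1].
  apply/mem_set; split=> //; case: b o => /=; [by rewrite subr_lt0|by rewrite subr_gt0].
rewrite [X in _ = X * _]patchE /=; case: (_ \in mixed_dom k b); last by rewrite mul0e.
by case: (_ \in _); rewrite ?mule1 ?mule0.
Qed.

Let mvd k h1 h2 : measurable_fun setT (fun t => void_density k (t, (h1, h2))).
Proof.
apply: (measurableT_comp (measurable_void_density k)); exact: measurable_fun_pair.
Qed.

Lemma integral_lags_after k h1 h2 : (0 <= h1)%R -> (0 <= h2)%R ->
  \int[mu]_t (void_density k \_ (mixed_dom k false)) (t, (h1, h2)) =
  \int[mu]_(t in `[tstar v1 v2 h1 h2, +oo[) void_density k (t, (h1, h2)).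
Proof.
move=> h10 h20; rewrite -(integral_valid_lags v20 v21 k) ?mvd// [RHS]integral_mkcond.
apply: eq_integral => t _; rewrite !patchE; congr (if _ then _ else _).
by apply/idP/idP => /set_mem; [move=> [_ _ ? ?]|move=> [? ?]]; apply/mem_set.
Qed.

Lemma integral_lags_before k h1 h2 : k = 1%N \/ k = 2%N -> (0 <= h1)%R -> (0 <= h2)%R ->
  \int[mu]_t (void_density k \_ (mixed_dom k true)) (t, (h1, h2)) =
  \int[mu]_(t in `[tstar v1 v2 h1 h2, +oo[) void_density (3 - k) (t, (h1, h2)).
Proof.
move=> k12 h10 h20; rewrite -(integral_valid_lags v20 v21 k) ?mvd// [RHS]integral_mkcond.
pose g t := (void_density k \_ (mixed_dom k true)) (t, (h1, h2)).
have mg : measurable_fun setT g.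
  by apply: (measurableT_comp (mf k true)); exact: measurable_fun_pair.
have N1 : (-1 != 0 :> R)%R by rewrite oppr_eq0 oner_eq0.
have := @ge0_integral_affine _ (-1)%R 0%R g N1 mg (fun t => f0 _ _ _).
rewrite normrN1 invr1 mul1e => <-.
apply: eq_integral => t _; rewrite /g mulN1r addr0 !patchE.
have -> : void_density k (- t, (h1, h2))%R = void_density (3 - k) (t, (h1, h2)).
  by rewrite /void_density/= hhat2N.
congr (if _ then _ else _).
have dN : discr v1 v2 (- t) h1 h2 = discr v1 v2 t h1 h2 by rewrite /discr sqrrN.
apply/idP/idP => /set_mem.
  by move=> [/= _ _ + +]; rewrite dN oppr_lt0 => vd o; apply/mem_set.
by move=> [/= o vd]; apply/mem_set; split=> //=; rewrite ?dN// oppr_lt0.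
Qed.

Lemma mixed_symmetry k : k = 1%N \/ k = 2%N ->
  Lambda_mixed P N v1 v2 k ty1 ty2 = Lambda_mixed P N v1 v2 (3 - k) ty2 ty1.
Proof.
move=> k12; have k12' : (3 - k)%N = 1%N \/ (3 - k)%N = 2%N.
  by case: k12 => ->; [right|left].
have e1 : Lambda_mixed P N v1 v2 k ty1 ty2 = _ := Lambda_mixed_lags true k12.
have e2 : Lambda_mixed P N v1 v2 (3 - k) ty2 ty1 = _ := Lambda_mixed_lags false k12'.
refine (etrans e1 (etrans _ (esym e2))).
apply: (congr1 (fun x => (4 * lam1 * lam2 * v1 * v2)%:E * x)).
apply: eq_integral => h1 /set_mem; rewrite /half /= in_itv/= andbT => h10.
apply: eq_integral => h2 /set_mem; rewrite /half /= in_itv/= andbT => h20.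
by rewrite integral_lags_before// integral_lags_after.
Qed.

Lemma Lambda_mixedE k : k = 1%N \/ k = 2%N ->
  Lambda_mixed P N v1 v2 k ty2 ty1 = mixed_formula lam1 lam2 v1 v2 k.
Proof.
move=> k12; have e : Lambda_mixed P N v1 v2 k ty2 ty1 = _ := Lambda_mixed_lags false k12.
refine (etrans e _).
apply: (congr1 (fun x => (4 * lam1 * lam2 * v1 * v2)%:E * x)).
apply: eq_integral => h1 /set_mem; rewrite /half /= in_itv/= andbT => h10.
pose phi h2 := \int[mu]_t (void_density k \_ (mixed_dom k false)) (t, (h1, h2)).
have mphi : measurable_fun setT phi.
  pose g (w : R * R) := (void_density k \_ (mixed_dom k false)) (w.2, (h1, w.1)).
  have mg : measurable_fun setT g.
    by apply: (measurableT_comp (mf k false)); do 2 apply: measurable_fun_pair => //.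
  exact: (@measurable_integral_snd R g mg (fun w => f0 _ _ _)).
have phi0 h2 : 0 <= phi h2 by apply: integral_ge0 => t _; exact: f0.
(* In the claimed formula both ranges of [h2] contain [h1]. The integral is split with an open
   endpoint, and the point [h1] is then added at no cost. *)
transitivity (\int[mu]_(h2 in `[0%R, h1]) phi h2 + \int[mu]_(h2 in `]h1, +oo[) phi h2).
  have dis : [disjoint `[0%R, h1]%classic & `]h1, +oo[%classic].
    apply/disj_setPS => h2 [] /=; rewrite !in_itv/= andbT => /andP[_ a] b.
    by have := le_lt_trans a b; rewrite ltxx.
  rewrite -ge0_integral_setU//; last exact: measurable_funTS.
  by congr (integral _ _ _); rewrite -itv_bndbnd_setU// bnd_simp.
rewrite integral_itv_obnd_cbnd; last exact: measurable_funTS.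
congr (_ + _); apply: eq_integral => h2 /set_mem.
  by rewrite /mkset in_itv => /andP[h20 _]; exact: integral_lags_after.
rewrite /mkset in_itv => /andP[h12 _]; have h20 := le_trans h10 h12.
by rewrite /phi integral_lags_after// tstar_eq0// ler_sqr.
Qed.

End mixed_intensity.

(** * The pure frequencies: the Boole transformation and Gaussian integrals *)

Section boole.
Context {R : realType}.
Variables (a b : R).
Hypotheses (a0 : 0 < a) (b0 : 0 < b).
Local Notation mu := (@lebesgue_measure R).

Definition boole (t : measurableTypeR R) : measurableTypeR R := a * t - b / t.

Lemma measurable_boole : measurable_fun setT boole.
Proof.
apply: measurable_funB; first exact: measurable_funM.
apply: measurable_funM => //; exact: measurable_inv.
Qed.

HB.instance Definition _ := isMeasurableFun.Build _ _ _ _ boole measurable_boole.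

(** [rp x] and [rm x] are the roots of [a * t ^+ 2 - x * t - b], that is, the solutions of
    [boole t = x]. Their product is [- b / a], so they have opposite signs, and the map is
    increasing on each half-line. *)
Let S (x : R) := Num.sqrt (x ^+ 2 + 4 * a * b).
Let rp (x : R) := (x + S x) / (2 * a).
Let rm (x : R) := (x - S x) / (2 * a).

Let S2 x : S x ^+ 2 = x ^+ 2 + 4 * a * b.
Proof. by rewrite sqr_sqrtr// addr_ge0 ?sqr_ge0// !mulr_ge0// ltW. Qed.

Let S_gt x : `|x| < S x.
Proof.
rewrite -ltr_sqr ?nnegrE ?sqrtr_ge0//.
by rewrite S2 real_normK ?num_real// ltrDl !mulr_gt0.
Qed.

Let rp_gt0 x : 0 < rp x.
Proof.
rewrite /rp divr_gt0 ?mulr_gt0//; have := S_gt x; rewrite ltr_norml => /andP[]; lra.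
Qed.

Let rm_lt0 x : rm x < 0.
Proof.
rewrite /rm ltr_pdivrMr ?mulr_gt0// mul0r.
have := S_gt x; rewrite ltr_norml => /andP[]; lra.
Qed.

Let factor t x : t != 0 -> t * (boole t - x) = a * (t - rp x) * (t - rm x).
Proof.
move=> t0; have -> : a * (t - rp x) * (t - rm x) =
    a * t ^+ 2 - t * x - (S x ^+ 2 - x ^+ 2) / (4 * a).
  by rewrite /rp /rm; field; rewrite gt_eqF.
by rewrite S2 /boole; field; rewrite t0 gt_eqF.
Qed.

Let boole_le_pos t x : 0 < t -> (boole t <= x) = (t <= rp x).
Proof.
move=> t0; rewrite -subr_le0 -(pmulr_rle0 _ t0) factor ?gt_eqF//.
rewrite mulrAC pmulr_rle0 ?subr_le0// mulr_gt0// subr_gt0.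
exact: lt_trans (rm_lt0 x) t0.
Qed.

Let boole_le_neg t x : t < 0 -> (boole t <= x) = (t <= rm x).
Proof.
move=> t0; rewrite -subr_le0 -(nmulr_rge0 _ t0) factor ?lt_eqF//.
rewrite nmulr_rge0 ?subr_le0// pmulr_rlt0// subr_lt0.
exact: lt_trans t0 (rp_gt0 x).
Qed.

Let rp_le x y : x <= y -> rp x <= rp y.
Proof.
by move=> xy; rewrite -boole_le_pos// (le_trans _ xy)// boole_le_pos.
Qed.

Let rm_le x y : x <= y -> rm x <= rm y.
Proof.
by move=> xy; rewrite -boole_le_neg// (le_trans _ xy)// boole_le_neg.
Qed.

Let rp_rm x : rp x + rm x = x / a.
Proof. by rewrite /rp /rm; field; rewrite gt_eqF. Qed.

Lemma lebesgue_measure_oc (x y : R) : x <= y -> mu `]x, y]%classic = (y - x)%:E.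
Proof.
move=> xy; rewrite lebesgue_measure_itv/= lte_fin -EFinB; case: ltP => // yx.
by congr EFin; apply/eqP; rewrite eq_sym subr_eq0 eq_le yx xy.
Qed.

(* Each level has one root of each sign, and the two roots add up to [x / a]. *)
Lemma boole_preimage_itv (x y : R) :
  mu (boole @^-1` `]x, y]) = ((a^-1)%:E * mu `]x, y]%classic)%E.
Proof.
have [yx|xy] := leP y x.
  have -> : (`]x, y]%classic : set R) = set0 by rewrite set_itv_ge// bnd_simp -leNgt.
  by rewrite preimage_set0 !measure0 mule0.
have xy' := ltW xy.
pose A : set (measurableTypeR R) := `]rp x, rp y]%classic.
pose B : set (measurableTypeR R) := `]rm x, rm y]%classic.
have mA : measurable A by exact: measurable_itv.
have mB : measurable B by exact: measurable_itv.
have mp : measurable (boole @^-1` `]x, y]).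
  rewrite -[X in measurable X]setTI; apply: measurable_boole => //; exact: measurable_itv.
have AB0 : A `&` B = set0.
  rewrite -subset0 => t []; rewrite /A /B /= !in_itv/= => /andP[h1 _] /andP[_ h2].
  have := lt_trans (rp_gt0 x) h1; have := le_lt_trans h2 (rm_lt0 y); lra.
have muAB : mu (A `|` B) = ((y - x) / a)%:E.
  transitivity (mu A + mu B)%E; first exact: measureU.
  transitivity ((rp y - rp x)%:E + (rm y - rm x)%:E)%E.
    by congr (_ + _)%E; apply: lebesgue_measure_oc; [exact: rp_le|exact: rm_le].
  by rewrite -EFinD addrACA -opprD !rp_rm -mulrBl.
rewrite lebesgue_measure_oc// -EFinM mulrC -muAB.
apply/eqP; rewrite eq_le; apply/andP; split.
  (* Division by zero gives 0, so [boole 0 = 0] and the point 0 may belong to the preimage without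
     lying in [A] or [B]; it is added as a null set. *)
  apply: (@le_trans _ _ (mu ((A `|` B) `|` [set 0]))).
    apply: le_measure; rewrite ?inE//.
      by apply: measurableU; [exact: measurableU|exact: measurable_set1].
    move=> t; rewrite /A /B /= !in_itv/=.
    have [t0|t0|->] := ltgtP t 0; last by right.
      by rewrite ltNge boole_le_neg// boole_le_neg// -ltNge; left; right.
    by rewrite ltNge boole_le_pos// boole_le_pos// -ltNge; left; left.
  apply: (le_trans (measureU2 _ _ _)); first exact: measurableU.
    exact: measurable_set1.
  rewrite [X in (_ + X <= _)%E](_ : _ = 0%E) ?adde0//; exact: lebesgue_measure_set1.
apply: le_measure; rewrite ?inE//; first exact: measurableU.
move=> t; rewrite /A /B /= !in_itv/= => -[|] /andP[h1 h2].
  have t0 := lt_trans (rp_gt0 x) h1.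
  by rewrite ltNge !boole_le_pos// -ltNge h1 h2.
have t0 := le_lt_trans h2 (rm_lt0 y).
by rewrite ltNge !boole_le_neg// -ltNge h1 h2.
Qed.

Lemma ge0_integral_boole (f : R -> \bar R) : measurable_fun setT f ->
  (forall x, 0 <= f x)%E ->
  (\int[mu]_x f (boole x) = (a^-1)%:E * \int[mu]_x f x)%E.
Proof.
move=> mf f0.
pose pf : {measure set (measurableTypeR R) -> \bar R} :=
  measure_function_pushforward__canonical__measure_function_Measure
    mu measurable_boole.
pose nu := mscale (NngNum (ltW a0)) pf.
have nuE A : measurable A -> mu A = nu A.
  apply: lebesgue_measure_unique => _ [[x y] _ <-].
  transitivity (a%:E * mu (boole @^-1` `]x, y]))%E; last by [].
  rewrite boole_preimage_itv// muleA -EFinM.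
  by rewrite mulfV ?mul1e// gt_eqF.
rewrite [in RHS](eq_measure_integral nu); last by move=> A mA _; exact: nuE.
rewrite ge0_integral_mscale//= muleA -EFinM mulVf ?gt_eqF// mul1e.
by rewrite ge0_integral_pushforward//= ?preimage_setT//; exact: measurable_boole.
Qed.

End boole.

Section gaussian_integrals.
Context {R : realType}.
Local Open Scope ereal_scope.
Local Notation mu := (@lebesgue_measure R).

(** The value [b = 0] occurs for equal heights, where the map is linear instead of two-to-one; the
    factor is the same. *)
Lemma ge0_integral_boole_ge0 (a b : R) (f : R -> \bar R) : (0 < a)%R -> (0 <= b)%R ->
  measurable_fun setT f -> (forall x, 0 <= f x) ->
  \int[mu]_x f (boole a b x) = (a^-1)%:E * \int[mu]_x f x.
Proof.
move=> a0; rewrite le_eqVlt => /orP[/eqP <-|b0] mf f0; last exact: ge0_integral_boole.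
have an : (a != 0)%R by rewrite gt_eqF.
have := @ge0_integral_affine _ a 0%R f an mf f0; rewrite gtr0_norm// => <-.
by apply: eq_integral => x _; rewrite /boole mul0r subr0 addr0.
Qed.

Lemma integral_gaussian (al : R) : (0 < al)%R ->
  \int[mu]_x (expR (- (al * x ^+ 2)))%:E = (Num.sqrt (pi / al))%:E.
Proof.
move=> al0; have s0 : (0 < Num.sqrt al)%R by rewrite sqrtr_gt0.
have mg : measurable_fun setT (fun x : R => (gauss_fun x)%:E).
  apply/measurable_EFinP; apply: measurableT_comp; first exact: measurable_expR.
  by apply: measurableT_comp => //; exact: measurable_funX.
have sn : Num.sqrt al != 0%R by rewrite gt_eqF.
have g0 (x : R) : 0 <= (gauss_fun x)%:E by rewrite lee_fin expR_ge0.
have := @ge0_integral_affine _ (Num.sqrt al) 0%R _ sn mg g0.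
rewrite gtr0_norm// integralT_gauss => E.
transitivity (\int[mu]_x (gauss_fun (Num.sqrt al * x + 0)%R)%:E).
  apply: eq_integral => x _; rewrite /gauss_fun addr0 exprMn sqr_sqrtr//; exact: ltW.
by rewrite E -EFinM mulrC sqrtrM ?pi_ge0// sqrtrV// ltW.
Qed.

Lemma ge0_integral_neg_even (f : R -> \bar R) : measurable_fun setT f ->
  (forall x, 0 <= f x) -> (forall x, f (- x)%R = f x) ->
  \int[mu]_(x in `]-oo, 0%R[) f x = (2^-1)%:E * \int[mu]_x f x.
Proof.
move=> mf f0 fe.
have habs x : f `|x|%R = f x.
  have [x0|x0] := leP 0%R x; first by rewrite ger0_norm.
  by rewrite ltr0_norm// fe.
have -> : \int[mu]_x f x = 2%:E * \int[mu]_(x in half) f x.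
  by rewrite -ge0_integral_even//; apply: eq_integral => x _; rewrite habs.
rewrite muleA -EFinM mulVf ?mul1e//.
have N1 : (-1 != 0 :> R)%R by rewrite oppr_eq0 oner_eq0.
pose g := f \_ (`]-oo, 0%R[%classic : set R).
have mg : measurable_fun setT g.
  apply/(measurable_restrict _ _ measurableT); first exact: measurable_itv.
  by rewrite setTI; exact: measurable_funTS.
have g0 x : 0 <= g x by rewrite /g patchE; case: ifP.
rewrite [LHS]integral_mkcond.
have := @ge0_integral_affine _ (-1)%R 0%R g N1 mg g0.
rewrite normrN1 invr1 mul1e => <-.
rewrite /half -integral_itv_obnd_cbnd; last exact: measurable_funTS.
rewrite [RHS]integral_mkcond; apply: eq_integral => x _.
rewrite mulN1r addr0 /g !patchE fe; congr (if _ then _ else _).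
by apply/idP/idP => /set_mem h; apply/mem_set; move: h; rewrite /= !in_itv/= andbT oppr_lt0.
Qed.

End gaussian_integrals.

Section half_gaussian.
Context {R : realType}.
Variable al : R.
Hypothesis al0 : 0 < al.
Local Notation mu := (@lebesgue_measure R).

Lemma integral_half_gaussian :
  (\int[mu]_(x in half) (x * expR (- (al * x ^+ 2)))%:E = ((2 * al)^-1)%:E)%E.
Proof.
pose F (x : R) := - (2 * al)^-1 * expR (- (al * x ^+ 2)).
have al0' : al != 0 by rewrite gt_eqF.
have dF (x : R) : is_derive x 1 F (x * expR (- (al * x ^+ 2))).
  rewrite /F; apply: is_derive_eq.
  by rewrite /GRing.scale/=; field.
have contF (x : R) : {for x, continuous F}.
  by apply/differentiable_continuous/derivable1_diffP; have [] := dF x.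
have conte (x : R) : {for x, continuous (fun x : R => expR (- (al * x ^+ 2)))}.
  apply: continuous_comp; last exact: continuous_expR.
  by apply: cvgN; apply: cvgMr; exact: exprn_continuous.
rewrite (@ge0_continuous_FTC2y _ _ F 0 0).
- by rewrite /F expr0n/= mulr0 oppr0 expR0 mulr1 -EFinB sub0r opprK.
- by move=> x x0; rewrite mulr_ge0 ?expR_ge0.
- apply: continuous_subspaceT => x; apply: cvgM; first exact: cvg_id.
  exact: conte.
- rewrite -(mulr0 (- (2 * al)^-1)); apply: cvgMr.
  apply: (cvg_comp (fun x => al * x ^+ 2) (fun x => expR (- x))); last exact: cvgr_expR.
  by apply: gt0_cvgMry => //; exact: cvgr_expr2.
- by move=> x _; have [] := dF x.
- by apply: cvg_at_right_filter; exact: contF.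
- by move=> x _; rewrite derive1E; have [_ ->] := dF x.
Qed.

Local Notation gau x := (expR (- (al * x ^+ 2)))%:E.

Let mgau : measurable_fun setT (fun x : R => gau x).
Proof.
apply/measurable_EFinP; apply: measurableT_comp; first exact: measurable_expR.
by apply: measurableT_comp => //; apply: measurable_funM => //; exact: measurable_funX.
Qed.

Let gau0 (x : R) : (0 <= gau x)%E. Proof. by rewrite lee_fin expR_ge0. Qed.

(** The diagonal cuts the quadrant into two halves. In each, integrating out the smaller coordinate
    produces the larger one as a factor, and leaves [integral_half_gaussian] twice. *)
Lemma integral_half_plane_gaussian_max :
  (\int[mu]_(x in half) \int[mu]_(y in half) gau (Num.max x y) = (al^-1)%:E)%E.
Proof.
pose D : set (R * R) := [set z | 0 <= z.2 <= z.1].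
pose E : set (R * R) := [set z | 0 <= z.1 < z.2].
have mD : measurable D.
  rewrite (_ : D = [set z | 0 <= z.2] `&` [set z | z.2 <= z.1]).
    by apply: measurableI; exact: measurable_set_le.
  by apply/seteqP; split=> z /andP.
have mE : measurable E.
  rewrite (_ : E = [set z | 0 <= z.1] `&` [set z | z.1 < z.2]).
    by apply: measurableI; [exact: measurable_set_le|exact: measurable_set_lt].
  by apply/seteqP; split=> z /andP.
pose f := (fun z : R * R => gau z.1) \_ D.
pose g := (fun z : R * R => gau z.2) \_ E.
have mf : measurable_fun setT f.
  apply/(measurable_restrict _ _ measurableT) => //; rewrite setTI.
  by apply: measurable_funTS; exact: (measurableT_comp mgau).
have mg : measurable_fun setT g.
  apply/(measurable_restrict _ _ measurableT) => //; rewrite setTI.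
  by apply: measurable_funTS; exact: (measurableT_comp mgau).
have f0 z : (0 <= f z)%E by rewrite /f patchE; case: ifP.
have g0 z : (0 <= g z)%E by rewrite /g patchE; case: ifP.
pose J := (\int[mu]_(x in half) (x * expR (- (al * x ^+ 2)))%:E)%E.
(* Matches the conditional length of an interval with the restriction to [half]; the default [point]
   of the extended reals is 0. *)
have Jpt (x : R) : (gau x * (if (0 < x)%R then x%:E - 0%:E else 0) =
    if x \in half then (x * expR (- (al * x ^+ 2)))%:E else point)%E.
  have [x0|x0] := ltP 0 x; [rewrite mem_set|have [->|xn] := eqVneq x 0].
  - by rewrite sube0 -EFinM mulrC.
  - by rewrite /half /= in_itv/= ltW.
  - by rewrite mule0 mul0r; case: ifP.
  - rewrite memNset ?mule0// /half /= in_itv/= andbT => h.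
    by move: xn; rewrite (le_anti _ : x = 0) ?eqxx// x0 h.
have If : (\int[mu]_x \int[mu]_y f (x, y) = J)%E.
  rewrite /J [RHS]integral_mkcond; apply: eq_integral => x _.
  rewrite patchE.
  transitivity (\int[mu]_(y in `[0%R, x]) gau x)%E.
    rewrite [RHS]integral_mkcond; apply: eq_integral => y _; rewrite /f !patchE.
    by congr (if _ then _ else _); apply/idP/idP => /set_mem h; apply/mem_set; move: h;
      rewrite /D /= in_itv.
  transitivity (gau x * mu `[0%R, x]%classic)%E; first by rewrite integral_cst.
  rewrite lebesgue_measure_itv/= lte_fin; exact: Jpt.
have Ig : (\int[mu]_x \int[mu]_y g (x, y) = J)%E.
  refine (etrans (integral_swap mg g0) _).
  rewrite /J [RHS]integral_mkcond; apply: eq_integral => y _.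
  rewrite patchE.
  transitivity (\int[mu]_(x in `[0%R, y[) gau y)%E.
    rewrite [RHS]integral_mkcond; apply: eq_integral => x _; rewrite /g !patchE.
    by congr (if _ then _ else _); apply/idP/idP => /set_mem h; apply/mem_set; move: h;
      rewrite /E /= in_itv.
  transitivity (gau y * mu `[0%R, y[%classic)%E; first by rewrite integral_cst.
  rewrite lebesgue_measure_itv/= lte_fin; exact: Jpt.
transitivity (\int[mu]_x (\int[mu]_y f (x, y) + \int[mu]_y g (x, y)))%E.
  rewrite [LHS]integral_mkcond; apply: eq_integral => x _.
  have mfx : measurable_fun setT (fun y => f (x, y)) by exact: (@measurable_line R f).
  have mgx : measurable_fun setT (fun y => g (x, y)) by exact: (@measurable_line R g).
  rewrite patchE -ge0_integralD//.
  have [xh|xh] := boolP (x \in half); last first.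
    apply/esym/integral0_eq => y _; rewrite /f /g !patchE.
    by rewrite !memNset ?adde0// => h; move/negP : xh; apply; apply/mem_set;
      move: h; rewrite /D /E /half /= in_itv/= andbT; lra.
  move/set_mem : xh; rewrite /half /= in_itv/= andbT => x0.
  rewrite integral_mkcond; apply: eq_integral => y _; rewrite /f /g !patchE /=.
  have [y0|y0] := boolP (y \in half).
    move/set_mem : y0; rewrite /half /= in_itv/= andbT => y0.
    have [yx|xy] := leP y x.
      rewrite mem_set ?memNset ?adde0//; last by rewrite /D/= y0.
      by rewrite /E/= ltNge yx andbF.
    rewrite memNset ?mem_set ?add0e//; first by rewrite /E/= x0.
    by rewrite /D/= [y <= x]leNgt xy andbF.
  rewrite !memNset ?adde0// => h; move/negP : y0; apply; apply/mem_set;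
    move: h; rewrite /D /E /half /= in_itv/= andbT; lra.
rewrite ge0_integralD//.
- rewrite If Ig /J integral_half_gaussian -EFinD; congr EFin.
  by field; rewrite gt_eqF.
- by move=> x _; apply: integral_ge0.
- exact: measurable_integral_snd.
- by move=> x _; apply: integral_ge0.
- exact: measurable_integral_snd.
Qed.

End half_gaussian.

Section pure_lag.
Context {R : realType}.
Variables (v al : R).
Hypotheses (v0 : 0 < v) (al0 : 0 < al).
Local Notation mu := (@lebesgue_measure R).

(** The delay from the first head to the meeting, where [u.1] is the first head time minus the
    second. Only negative [u.1] enter the integral, so division by zero is not met. *)
Definition pure_offset (u : R * (R * R)) : R :=
  - (u.1 / 2) - (u.2.2 ^+ 2 - u.2.1 ^+ 2) / (2 * v ^+ 2 * u.1).

Lemma same_time_offset z :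
  same_time v z = z.1.1 + pure_offset (z.1.1 - z.2.1, (z.1.2, z.2.2)).
Proof.
rewrite /same_time /pure_offset /= -(opprB z.1.1) mulrN invrN mulrN addrA.
by congr (_ + _); field.
Qed.

Lemma measurable_pure_offset : measurable_fun setT pure_offset.
Proof.
have m1 : measurable_fun setT (fun u : R * (R * R) => u.2.1).
  exact: measurableT_comp measurable_fst measurable_snd.
have m2 : measurable_fun setT (fun u : R * (R * R) => u.2.2).
  exact: measurableT_comp measurable_snd measurable_snd.
apply: measurable_funB.
  by apply: measurableT_comp => //; apply: measurable_funM.
apply: measurable_funM; first by apply: measurable_funB; exact: measurable_funX.
by apply: (measurableT_comp measurable_inv); apply: measurable_funM.
Qed.

Definition pure_height2 (u : R * (R * R)) : R := v ^+ 2 * pure_offset u ^+ 2 + u.2.1 ^+ 2.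

(* Both height regimes reduce to the same map, up to a sign and a constant. *)
Lemma pure_height2_boole t h h' : t != 0 -> 0 <= h -> 0 <= h' ->
  pure_height2 (t, (h, h')) =
  boole (v / 2) (`|h ^+ 2 - h' ^+ 2| / (2 * v)) t ^+ 2 + Num.max h h' ^+ 2.
Proof.
move=> t0 h0 h0'; rewrite /pure_height2 /pure_offset /boole /=.
have vn : v != 0 by rewrite gt_eqF.
have [hh|hh] := leP h' h.
  rewrite ger0_norm ?subr_ge0 ?ler_sqr//.
  by field; rewrite t0 vn.
rewrite ler0_norm ?subr_le0 ?ler_sqr ?nnegrE// ?(ltW hh)//.
by field; rewrite t0 vn.
Qed.

(** The square of the Boole map is even, so negative lags carry half of the integral over the line;
    together with the factor [(v / 2)^-1] of the substitution this gives [v^-1]. The term with the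
    larger height is constant in the lag and factors out. *)
Lemma integral_pure_lag h h' : 0 <= h -> 0 <= h' ->
  (\int[mu]_(t in `]-oo, 0%R[) (expR (- (al * pure_height2 (t, (h, h')))))%:E =
   (v^-1 * Num.sqrt (pi / al))%:E * (expR (- (al * Num.max h h' ^+ 2)))%:E)%E.
Proof.
move=> h0 h0'; set b := `|h ^+ 2 - h' ^+ 2| / (2 * v).
have b0 : 0 <= b by rewrite divr_ge0// mulr_ge0// ltW.
have a0 : 0 < v / 2 by rewrite divr_gt0.
pose g (y : R) : \bar R := (expR (- (al * y ^+ 2)))%:E.
have mg : measurable_fun setT g.
  apply/measurable_EFinP; apply: measurableT_comp; first exact: measurable_expR.
  by apply: measurableT_comp => //; apply: measurable_funM => //; exact: measurable_funX.
have g0 y : (0 <= g y)%E by rewrite lee_fin expR_ge0.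
have mgb : measurable_fun setT (fun t => g (boole (v / 2) b t)).
  by apply: (measurableT_comp mg); exact: measurable_boole.
transitivity (\int[mu]_(t in `]-oo, 0%R[)
    ((expR (- (al * Num.max h h' ^+ 2)))%:E * g (boole (v / 2) b t)))%E.
  apply: eq_integral => t /set_mem; rewrite /= in_itv/= => t0.
  rewrite /g -EFinM -expRD; congr (expR _)%:E.
  by rewrite pure_height2_boole// ?lt_eqF// mulrDr opprD addrC.
rewrite ge0_integralZl//; last exact: measurable_funTS.
rewrite [RHS]muleC; congr (_ * _)%E.
rewrite ge0_integral_neg_even//; last first.
  by move=> t; rewrite /g /boole invrN !mulrN -opprD sqrrN.
rewrite ge0_integral_boole_ge0// integral_gaussian// -!EFinM; congr EFin.
by field; rewrite gt_eqF.
Qed.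

End pure_lag.

Section pure_intensity.
Context {R : realType} {d} {Omega : measurableType d}.
Variables (P : probability Omega R) (N : ty -> Omega -> set (pt R)).
Variables (lam1 lam2 v1 v2 : R).
Hypotheses (lam10 : 0 < lam1) (lam20 : 0 < lam2) (v20 : 0 < v2) (v21 : v2 < v1).
Hypothesis PPP : two_type_PPP P N lam1 lam2.

Local Notation mu := (@lebesgue_measure R).
Local Notation sp := (sp v1 v2).
Local Notation lm := (lm lam1 lam2).
Local Notation lam := (lam1 + lam2)%R.
Local Notation m := (head_intensity lam10 lam20 v20 v21).

Lemma Lambda_pureE l : Lambda_pure P N v1 v2 l =
  (4 * sp l * Num.sqrt lam / pi * (lm l / lam) ^+ 2)%:E.
Proof.
have s0 : 0 < sp l by exact: sp_gt0.
have lam0 : 0 < lam by rewrite addr_gt0.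
have al0 : 0 < lam * pi by rewrite mulr_gt0// pi_gt0.
pose D : set (R * (R * R)) := [set u | [/\ u.1 < 0, 0 <= u.2.1 & 0 <= u.2.2]].
have mD : measurable D.
  rewrite (_ : D = [set u | u.1 < 0] `&` [set u | 0 <= u.2.1] `&` [set u | 0 <= u.2.2]).
    have m1 : measurable_fun setT (fun u : R * (R * R) => u.2.1).
      exact: measurableT_comp measurable_fst measurable_snd.
    have m2 : measurable_fun setT (fun u : R * (R * R) => u.2.2).
      exact: measurableT_comp measurable_snd measurable_snd.
    by repeat apply: measurableI; [exact: measurable_set_lt|exact: measurable_set_le..].
  by apply/seteqP; split=> [u []|u [[]]].
pose F (u : R * (R * R)) : \bar R := (expR (- (lam * pi * pure_height2 (sp l) u)))%:E.
have mF : measurable_fun setT F.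
  apply/measurable_EFinP; apply: measurableT_comp; first exact: measurable_expR.
  apply: measurableT_comp => //; apply: measurable_funM => //.
  apply: measurable_funD.
    by apply: measurable_funM => //; apply: measurable_funX; exact: measurable_pure_offset.
  apply: measurable_funX; exact: measurableT_comp measurable_fst measurable_snd.
pose f := F \_ D.
have mf : measurable_fun setT f.
  apply/(measurable_restrict _ _ measurableT) => //; rewrite setTI.
  exact: measurable_funTS.
have f0 u : (0 <= f u)%E by rewrite /f patchE; case: ifP => // _; rewrite lee_fin expR_ge0.
rewrite (Lambda_pure_integral lam10 lam20 v20 v21 PPP) integral_mkcond.
transitivity (\int[m l \x m l]_z (let u := ((z.1.1 - z.2.1)%R, (z.1.2, z.2.2)) in
    f u * unit_window (z.1.1 + pure_offset (sp l) u)%R))%E.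
  apply: eq_integral => z _; rewrite patchE /= /unit_window indicE -same_time_offset.
  rewrite /f patchE.
  have -> : (z \in pure_pairs v1 v2 l) =
      (((z.1.1 - z.2.1)%R, (z.1.2, z.2.2)) \in D) &&
      (same_time (sp l) z \in `[0%R, 1%R]%classic).
    apply/idP/andP.
      move=> /set_mem[h1 h2 h3 [t0 t1]]; split; apply/mem_set.
        by split=> //=; rewrite subr_lt0.
      by rewrite /= in_itv/= t0.
    move=> [/set_mem[/= h1 h2 h3] /set_mem]; rewrite /= in_itv/= => /andP[t0 t1].
    by apply/mem_set; split=> //; rewrite -subr_lt0.
  case: (_ \in D); last by rewrite mul0e.
  case: (_ \in `[0%R, 1%R]%classic); last by rewrite mule0.
  rewrite mule1 /F /pure_height2 /= /meet_height /bird sqr_sqrtr; last first.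
    by apply: addr_ge0; [apply: mulr_ge0|]; exact: sqr_ge0.
  by rewrite same_time_offset addrAC subrr add0r.
rewrite [LHS](stationary_integral (head_rate lam10 lam20 v20 v21 l)
  (head_rate lam10 lam20 v20 v21 l) mf f0 (measurable_pure_offset (sp l))).
(* The factors are the squared rate of heads, the Gaussian integral over the lag, and the integral
   over the two heights. *)
transitivity ((2 * lm l * sp l * (2 * lm l * sp l))%:E *
  ((((sp l)^-1 * Num.sqrt (pi / (lam * pi))))%:E * ((lam * pi)^-1)%:E))%E; last first.
  rewrite -!EFinM; congr EFin.
  have pn : pi != 0 :> R by rewrite gt_eqF// pi_gt0.
  have ln : lam != 0 by rewrite gt_eqF.
  have sn : sp l != 0 by rewrite gt_eqF.
  have -> : pi / (lam * pi) = lam^-1 by rewrite invfM mulrCA mulfV// mulr1.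
  rewrite sqrtrV ?(ltW lam0)//.
  (* Writing the total rate as a square [q ^+ 2] leaves a rational identity. *)
  have [q [qn -> ->]] : exists q, [/\ q != 0, Num.sqrt lam = q & lam = q ^+ 2].
    by exists (Num.sqrt lam); rewrite sqr_sqrtr ?ltW// gt_eqF// sqrtr_gt0.
  move: (sp l) sn (lm l) (pi : R) pn => s sn L p pn.
  by field; rewrite sn qn pn.
congr (_ * _)%E.
rewrite -(integral_half_plane_gaussian_max al0).
have K0 : (0 <= ((sp l)^-1 * Num.sqrt (pi / (lam * pi)))%:E)%E.
  by rewrite lee_fin mulr_ge0// ?sqrtr_ge0// invr_ge0 ltW.
pose G (w : R * R) : \bar R := (expR (- (lam * pi * Num.max w.1 w.2 ^+ 2)))%:E.
have mG : measurable_fun setT G.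
  apply/measurable_EFinP; apply: measurableT_comp; first exact: measurable_expR.
  apply: measurableT_comp => //; apply: measurable_funM => //; apply: measurable_funX.
  exact: measurable_maxr.
have G0 w : (0 <= G w)%E by rewrite lee_fin expR_ge0.
rewrite -ge0_integralZl//; first last.
- by move=> h _; apply: integral_ge0 => h' _; exact: (G0 (h, h')).
- apply: measurable_funTS; exact: (measurable_integral_half mG G0).
- exact: measurable_half.
apply: eq_integral => h /set_mem; rewrite /half /= in_itv/= andbT => h0.
rewrite -ge0_integralZl//; first last.
- apply: measurable_funTS; exact: (@measurable_line R G).
apply: eq_integral => h' /set_mem; rewrite /half /= in_itv/= andbT => h'0.
rewrite -integral_pure_lag// [RHS]integral_mkcond; apply: eq_integral => t _.
rewrite /f !patchE; congr (if _ then _ else _).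
apply/idP/idP => /set_mem.
  by move=> [t0 _ _]; apply/mem_set; rewrite /= in_itv.
by rewrite /= in_itv/= => t0; apply/mem_set; split.
Qed.

End pure_intensity.

Theorem theorem7p20 (R : realType) (d : measure_display) (Omega : measurableType d)
  (P : probability Omega R) (N : ty -> Omega -> set (pt R))
  (lam1 lam2 v1 v2 : R) :
  0 < lam1 -> 0 < lam2 -> 0 < v2 -> v2 < v1 ->
  two_type_PPP P N lam1 lam2 ->
  let lam := lam1 + lam2 in
  Lambda_pure P N v1 v2 ty1 = (4 * v1 * Num.sqrt lam / pi * (lam1 / lam) ^+ 2)%:E /\
  Lambda_pure P N v1 v2 ty2 = (4 * v2 * Num.sqrt lam / pi * (lam2 / lam) ^+ 2)%:E /\
  Lambda_mixed P N v1 v2 1 ty1 ty2 = Lambda_mixed P N v1 v2 2 ty2 ty1 /\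
  Lambda_mixed P N v1 v2 2 ty1 ty2 = Lambda_mixed P N v1 v2 1 ty2 ty1 /\
  (forall k : nat, (k = 1%N \/ k = 2%N) ->
     Lambda_mixed P N v1 v2 k ty2 ty1 = mixed_formula lam1 lam2 v1 v2 k).
Proof.
move=> lam10 lam20 v20 v21 PPP lam.
split; first exact: (Lambda_pureE lam10 lam20 v20 v21 PPP ty1).
split; first exact: (Lambda_pureE lam10 lam20 v20 v21 PPP ty2).
split; first by apply: (@mixed_symmetry _ _ _ _ _ _ _ _ _ lam10 lam20 v20 v21 PPP 1); left.
split; first by apply: (@mixed_symmetry _ _ _ _ _ _ _ _ _ lam10 lam20 v20 v21 PPP 2); right.
by move=> k; exact: (Lambda_mixedE lam10 lam20 v20 v21 PPP).
Qed.
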